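(* Let $X$ be the real stationary Gaussian process on $\mathbb{R}$ with reduced covariance function $$C_X(t)=\prod_{k=1}^\infty\cos(t/k!),\qquad t\in\mathbb{R},$$ and for $T>0$ let $N_X(T)=\#\{t\in[-T,T]:X(t)=0\}$. Then for all $\varepsilon>0$, $$T^{\varepsilon-2}\,\mathrm{Var}(N_X(T))\to\infty\quad\text{as }T\to\infty.$$
   Context: $X$ is a (centered) Gaussian process with continuous (in fact analytic) sample paths and $\mathrm{Cov}(X(t),X(s))=C_X(t-s)$ for all $s,t\in\mathbb{R}$. *)

(* Defs.v *)
From HB Require Import structures.
From mathcomp Require Import all_boot all_order all_algebra.
From mathcomp Require Import all_classical all_reals all_analysis.

Set Implicit Arguments.
Unset Strict Implicit.
Unset Printing Implicit Defensive.

Import Order.TTheory GRing.Theory Num.Theory.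
Import numFieldNormedType.Exports.

Local Open Scope classical_set_scope.
Local Open Scope ring_scope.

(* Gaussian laws include the degenerate ones, i.e. point masses. These are
   given separately because [normal_prob m 0] is not [\d_m]. *)
Definition gaussian_law (d : measure_display) (Omega : measurableType d)
    (R : realType) (P : probability Omega R) (Y : Omega -> R) : Prop :=
  (exists m : R, forall A : set R, measurable A ->
     P (Y @^-1` A) = \d_m A) \/
  (exists m s : R, 0 < s /\ forall A : set R, measurable A ->
     P (Y @^-1` A) = normal_prob m s A).

Definition gaussian_process (d : measure_display) (Omega : measurableType d)
    (R : realType) (P : probability Omega R) (X : R -> {RV P >-> R}) : Prop :=
  forall (n : nat) (t a : 'I_n -> R),
    gaussian_law P (fun w => \sum_(i < n) a i * X (t i) w).
Arguments gaussian_process {d Omega R} P X.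

Definition centered_process (d : measure_display) (Omega : measurableType d)
    (R : realType) (P : probability Omega R) (X : R -> {RV P >-> R}) : Prop :=
  forall t : R, ('E_P[X t] = 0)%E.
Arguments centered_process {d Omega R} P X.

(* For a centered Gaussian process this includes stationarity. *)
Definition has_reduced_covariance (d : measure_display)
    (Omega : measurableType d) (R : realType) (P : probability Omega R)
    (X : R -> {RV P >-> R}) (C : R -> R) : Prop :=
  forall t s : R, covariance P (X t) (X s) = (C (t - s))%:E.
Arguments has_reduced_covariance {d Omega R} P X C.

(* The partial products converge for every [t], so this is a genuine limit. *)
Definition cos_fact_product (R : realType) (t : R) : R :=
  lim ((\prod_(1 <= k < n.+1) cos (t / k`!%:R)) @[n --> \oo]).

(* Equal to [+oo] when [f] has infinitely many zeros in [-T, T]. For the sample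
   paths of the process considered here this happens only on a null event, so
   taking [fine] of it does not change its variance. *)
Definition num_zeros (R : realType) (f : R -> R) (T : R) : \bar R :=
  counting [set t : R | t \in `[- T, T] /\ f t = 0].

(* Main.v *)
Require Import Defs.

(* Almost surely no zero is tangential (Bulinskaya), so the zeros are counted by
   the limit of the sign changes along dyadic grids.  For a grid of step [h] with
   [r = C h], let [x_i] be the sampled process; the number [N] of sign changes is
   tested against [S = \sum_i (2 x_i x_(i+1) - r (x_i^2 + x_(i+1)^2))].  The
   indicator of [x_j x_(j+1) < 0] has covariance [- kap j i / (pi sqrt (1 - r^2))]
   with the [i]-th summand; telescoping in [kap] leaves a lower bound by the double
   sum of the squares of [C (t + h) + C (t - h) - 2 C h C t], [t = (j - i) h].
   This gap is at least a multiple of [h^2 4^-n] when [t] is near [2 pi g] and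
   [g %% k! < k! / 8] for all [k]: then the first [n] factors have angles in the
   first quadrant modulo [2 pi].  A proportion of at least [16^-n] of the integers
   [g < n!] has this property.  Since [E S^2] is at most a multiple of
   [(h * size)^2 h^2], Cauchy-Schwarz gives [Var N >= c (n! / 256^n)^2] when
   [n! <= T], and [256^n] is negligible against any power of [n!]. *)

From HB Require Import structures.
From mathcomp Require Import all_boot all_order all_algebra finmap.
From mathcomp Require Import all_classical all_reals all_analysis.
From mathcomp Require Import measurable_realfun zify.
From mathcomp Require Import ring lra.

Set Implicit Arguments.
Unset Strict Implicit.
Unset Printing Implicit Defensive.

Import Order.TTheory GRing.Theory Num.Theory.
Import numFieldNormedType.Exports.

Local Open Scope classical_set_scope.
Local Open Scope ring_scope.

(** Up to the factor [- 2 pi sqrt (1 - r^2)], [2 x_i x_(i+1) - r (x_i^2 + x_(i+1)^2)] is the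
    component of the indicator of [x_i x_(i+1) < 0] in the second Wiener chaos, so [S] is a multiple
    of the projection of [N] there; hence the choice of test variable. The gap is the discrete form
    of [h^2 (C'' - C''(0) C)], so the process is never differentiated. Modulo [2 pi] the angle
    [2 pi g / k!] depends only on [g %% k!]; for the selected [g] the correlation therefore recurs
    at large times, and there are enough such [g] to make the variance almost quadratic.

    Two obstacles shape the proof. The hypothesis gives laws of single linear combinations only, so
    independence of uncorrelated variables is derived from cosines of one variable at a time,
    without multivariate densities. And the number of zeros may be measurable only up to a null set
    and have infinite variance; hence the variance estimate is made on a fixed grid, with an
    arbitrary centring constant, and only a lower bound is carried to the limit. *)

Lemma measurable_bool_set d (T : measurableType d) (b : T -> bool) :
  measurable_fun setT b -> measurable [set w | b w].
Proof.
move=> mb; have := mb measurableT [set true] I; rewrite setTI; congr measurable.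
Qed.

Lemma measurable_natr_bool d (T : measurableType d) (R : realType) (b : T -> bool) :
  measurable_fun setT b -> measurable_fun setT (fun w => (b w)%:R : R).
Proof.
move=> mb; rewrite (_ : (fun w => _) = (fun w => if b w then 1 else 0)).
  by apply: measurable_fun_ifT.
by apply/funext => w; case: (b w).
Qed.

Lemma natr_bool_le1 (R : numDomainType) (b : bool) : `|b%:R : R| <= 1.
Proof. by case: b; rewrite ?normr1 ?normr0. Qed.

(** * Integrability and integrals of real-valued functions *)

Section integrable_EFin.
Context d (T : measurableType d) (R : realType) (m : {measure set T -> \bar R}).
Implicit Types f g K : T -> R.

Lemma integrable_EFinD f g : m.-integrable setT (EFin \o f) ->
  m.-integrable setT (EFin \o g) -> m.-integrable setT (EFin \o (fun w => f w + g w)).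
Proof. by move=> i j; have := integrableD measurableT i j; apply: eq_integrable. Qed.

Lemma integrable_EFinZ c f : m.-integrable setT (EFin \o f) ->
  m.-integrable setT (EFin \o (fun w => c * f w)).
Proof. by move=> i; rewrite /comp; under eq_fun do rewrite EFinM; exact: integrableZl. Qed.

Lemma integrable_boundedM f K (M : R) :
  measurable_fun setT f -> (forall w, `|f w| <= M) ->
  m.-integrable setT (EFin \o K) -> m.-integrable setT (EFin \o (fun w => f w * K w)).
Proof.
move=> mf fM iK; apply: (le_integrable measurableT _ _ (integrable_EFinZ M iK)).
  apply/measurable_EFinP; apply: measurable_funM => //.
  by have /measurable_EFinP := measurable_int _ iK.
by move=> w _ /=; rewrite lee_fin normrM (le_trans (ler_wpM2r _ (fM w)))// normrM ler_wpM2r// ler_norm.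
Qed.

Lemma integrable_EFin_sum (I : Type) (s : seq I) (F : I -> T -> R) :
  (forall i, m.-integrable setT (EFin \o F i)) ->
  m.-integrable setT (EFin \o (fun w => \sum_(i <- s) F i w)).
Proof.
move=> iF; elim: s => [|i s ih].
  by apply: eq_integrable (integrable0 _ _) => //= w _; rewrite big_nil.
apply: eq_integrable (integrable_EFinD (iF i) ih) => //= w _.
by rewrite big_cons.
Qed.

Lemma Rintegral_sum (I : Type) (s : seq I) (F : I -> T -> R) :
  (forall i, m.-integrable setT (EFin \o F i)) ->
  \int[m]_w (\sum_(i <- s) F i w) = \sum_(i <- s) \int[m]_w F i w.
Proof.
move=> iF; elim: s => [|i s ih].
  rewrite big_nil; under eq_Rintegral do rewrite big_nil.
  by rewrite /Rintegral integral0.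
rewrite big_cons -ih -RintegralD//; last exact: integrable_EFin_sum.
by apply: eq_Rintegral => w _; rewrite big_cons.
Qed.

End integrable_EFin.

Lemma integrable_bounded d (T : measurableType d) (R : realType)
    (P : probability T R) (f : T -> R) (M : R) : measurable_fun setT f ->
  (forall w, `|f w| <= M) -> P.-integrable setT (EFin \o f).
Proof.
move=> mf fM; apply: (@le_integrable _ _ _ P _ measurableT _ (EFin \o cst M)).
- exact/measurable_EFinP.
- by move=> w _ /=; rewrite lee_fin (le_trans (fM w))// ler_norm.
- exact: finite_measure_integrable_cst.
Qed.

Lemma integrable_natr_bool d (T : measurableType d) (R : realType)
    (P : probability T R) (b : T -> bool) :
  measurable_fun setT (fun w => (b w)%:R : R) ->
  P.-integrable setT (EFin \o (fun w => (b w)%:R : R)).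
Proof. by move=> mb; apply: integrable_bounded mb _ => w; exact: natr_bool_le1. Qed.

(** * Moments and characteristic function of the normal density *)

Section normal_integrals.
Context {R : realType}.
Local Notation mu := (@lebesgue_measure R).

(* The boundary terms on [-n, n] vanish in the limit. *)
Lemma Rintegral_derive_eq0 (F f : R -> R) :
  (forall x, is_derive x (1:R) F (f x)) -> continuous f ->
  mu.-integrable setT (EFin \o f) ->
  F n%:R @[n --> \oo] --> 0 -> F (- n%:R) @[n --> \oo] --> 0 ->
  \int[mu]_x f x = 0.
Proof.
move=> dF cf intf F1 F2.
have mf : measurable_fun setT f by move: intf => /integrableP[/measurable_EFinP].
pose I n : set R := `[- n%:R, n%:R]%classic.
have cv : (\int[mu]_x ((f \_ (I n)) x)%:E)%E @[n --> \oo] --> (\int[mu]_x (f x)%:E)%E.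
  apply: (@dominated_cvg _ _ _ mu setT measurableT _ _ (fun x => `|f x|%:E)).
  - move=> n; apply/measurable_EFinP.
    by apply/(measurable_restrictT _ _).1; [exact: measurable_itv|exact: measurable_funTS].
  - move=> x _ /=; apply: cvg_near_cst.
    near=> n; congr EFin; rewrite patchE mem_set// /I /= in_itv/= -ler_norml.
    by near: n; exact: nbhs_infty_ger.
  - by [].
  - by move: intf => /integrable_norm.
  - move=> n x _ /=; rewrite patchE lee_fin; case: ifP => _ //.
    by rewrite normr0.
have eI n : (\int[mu]_x ((f \_ (I n.+1)) x)%:E)%E = (F n.+1%:R - F (- n.+1%:R))%:E.
  transitivity (\int[mu]_(x in I n.+1) (f x)%:E)%E.
    by rewrite [RHS]integral_mkcond/=; under [RHS]eq_integral do rewrite restrict_EFin.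
  rewrite (@continuous_FTC2 _ _ F) ?EFinB//.
  - by rewrite -subr_gt0 opprK addr_gt0// ltr0n.
  - by apply: continuous_subspaceT.
  - split.
    + by move=> x _; case: (dF x).
    + apply: cvg_at_right_filter; apply: differentiable_continuous.
      by apply/derivable1_diffP; case: (dF (- n.+1%:R)).
    + apply: cvg_at_left_filter; apply: differentiable_continuous.
      by apply/derivable1_diffP; case: (dF n.+1%:R).
  - by move=> x _; rewrite derive1E; apply: derive_val.
rewrite /Rintegral.
have : (F n.+1%:R - F (- n.+1%:R))%:E @[n --> \oo] --> (\int[mu]_x (f x)%:E)%E.
  by under eq_fun do rewrite -eI; move: cv; rewrite -cvg_shiftS.
move=> /cvg_lim <- //.
suff -> : (limn (fun n => (F n.+1%:R - F (- n.+1%:R))%:E) = 0%:E)%E by [].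
apply/cvg_lim => //; apply: cvg_EFin; first exact: nearW.
rewrite -cvg_shiftS/= in F1; rewrite -cvg_shiftS/= in F2.
by rewrite -[X in _ --> X](subr0 0); apply: cvgB.
Unshelve. all: by end_near. Qed.

Lemma normal_pdf_is_derive (m s x : R) : s != 0 ->
  is_derive x (1:R) (normal_pdf m s) (- ((x - m) / s ^+ 2) * normal_pdf m s x).
Proof.
move=> s0; rewrite normal_pdfE//.
have s20 : s ^+ 2 != 0 by rewrite expf_neq0.
apply: is_derive_eq.
rewrite /GRing.scale/= /normal_fun -[s ^+ 2 *+ 2]mulr_natr.
by field; rewrite s0.
Qed.

Lemma expR_ge_pow (k : nat) (y : R) : 0 <= y -> y ^+ k <= k`!%:R * expR y.
Proof.
move=> y0; case: k => [|k]; first by rewrite expr0 fact0 mul1r -expR0 ler_expR.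
rewrite mulrC -ler_pdivrMr ?ltr0n ?fact_gt0//.
by have := expR_ge1Dxn k y0; apply: le_trans; rewrite ler_wpDl.
Qed.

(** Half of the Gaussian exponent absorbs the power; the other half is the exponent for the variance
    [2 s^2]. *)
Lemma normal_pdf_pow_ub (m s : R) (k : nat) : s != 0 ->
  exists2 C : R, 0 <= C & forall x,
    `|x - m| ^+ k * normal_pdf m s x <= C * normal_pdf m (s * Num.sqrt 2) x.
Proof.
move=> s0; have s20 : 0 < s ^+ 2 by rewrite exprn_even_gt0.
have ss0 : s * Num.sqrt 2 != 0 by rewrite mulf_neq0// gt_eqF// sqrtr_gt0.
(* From [|u|^k <= 1 + u^(2k)], [u^2 = 4 s^2 y] and [y^k <= k! exp y]. *)
pose C0 : R := 1 + (4 * s ^+ 2) ^+ k * k`!%:R.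
have C00 : 0 <= C0 by rewrite addr_ge0// mulr_ge0// exprn_ge0// mulr_ge0// ltW.
exists (C0 * normal_peak s / normal_peak (s * Num.sqrt 2)).
  by rewrite !mulr_ge0 ?invr_ge0 ?normal_peak_ge0.
move=> x; rewrite !normal_pdfE// /normal_fun; set u := x - m.
set y := u ^+ 2 / (4 * s ^+ 2).
have y0 : 0 <= y by rewrite divr_ge0 ?sqr_ge0// mulr_ge0// ltW.
have -> : - u ^+ 2 / (s ^+ 2 *+ 2) = - y + - y.
  by rewrite /y -[s ^+ 2 *+ 2]mulr_natr; field; rewrite s0.
have -> : - u ^+ 2 / ((s * Num.sqrt 2) ^+ 2 *+ 2) = - y.
  by rewrite exprMn sqr_sqrtr// /y -[_ *+ 2]mulr_natr; field; rewrite s0.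
rewrite expRD [leRHS]mulrA mulfVK ?gt_eqF ?normal_peak_gt0//.
rewrite mulrCA [leRHS]mulrAC [leRHS]mulrC ler_wpM2l ?normal_peak_ge0//.
rewrite mulrA ler_wpM2r ?expR_ge0// expRN ler_pdivrMr ?expR_gt0//.
have uk : `|u| ^+ k <= 1 + u ^+ 2 ^+ k.
  rewrite -normrX -exprM mulnC exprM; set v := u ^+ k.
  have [v1|v1] := lerP `|v| 1; first by rewrite (le_trans v1)// lerDl sqr_ge0.
  by rewrite -real_normK ?num_real// ler_wpDl// expr2 ler_peMl// ltW.
apply: (le_trans uk); rewrite /C0 mulrDl mul1r; apply: lerD; first by rewrite -expR0 ler_expR.
rewrite [u ^+ 2](_ : _ = 4 * s ^+ 2 * y); last by rewrite /y; field; rewrite s0.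
rewrite exprMn -mulrA ler_wpM2l ?expR_ge_pow//.
by rewrite exprn_ge0// mulr_ge0// ltW.
Qed.

Lemma integrable_pow_normal_pdf (m s : R) (k : nat) : s != 0 ->
  mu.-integrable setT (EFin \o (fun x => `|x - m| ^+ k * normal_pdf m s x)).
Proof.
move=> s0; have [C C0 H] := normal_pdf_pow_ub m k s0.
apply: (@le_integrable _ _ _ mu _ measurableT _
  (fun x => (C * normal_pdf m (s * Num.sqrt 2) x)%:E)).
- apply/measurable_EFinP; apply: measurable_funM; last exact: measurable_normal_pdf.
  apply: measurable_funX; apply: measurableT_comp => //.
  exact: measurable_funB.
- move=> x _ /=; rewrite lee_fin ger0_norm ?mulr_ge0 ?exprn_ge0 ?normal_pdf_ge0//.
  by rewrite (le_trans (H x))// ler_norm.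
- under eq_fun do rewrite EFinM.
  by apply: integrableZl => //; exact: integrable_normal_pdf.
Qed.

(** With one more power the product is still bounded, so this one is at most a constant divided by
    [|x - m|]. *)
Lemma cvg_pow_normal_pdf (m s : R) (k : nat) (x_ : nat -> R) : s != 0 ->
  `|x_ n| @[n --> \oo] --> +oo ->
  `|x_ n - m| ^+ k * normal_pdf m s (x_ n) @[n --> \oo] --> 0.
Proof.
move=> s0 x_oo; have [C C0 H] := normal_pdf_pow_ub m k.+1 s0.
have ss0 : s * Num.sqrt 2 != 0 by rewrite mulf_neq0// gt_eqF// sqrtr_gt0.
pose D := C * normal_peak (s * Num.sqrt 2).
have D0 : 0 <= D by rewrite mulr_ge0// normal_peak_ge0.
have HD x : `|x - m| ^+ k.+1 * normal_pdf m s x <= D.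
  by rewrite (le_trans (H x))// ler_wpM2l// normal_pdf_ub.
apply/cvgr0Pnorm_le => e e0; near=> n.
have xm : D / e < `|x_ n - m|.
  rewrite (lt_le_trans _ (lerB_dist _ _))// ltrBrDr.
  by near: n; exact: cvgry_gt.
have xm0 : 0 < `|x_ n - m| by rewrite (le_lt_trans _ xm)// divr_ge0// ltW.
rewrite ger0_norm ?mulr_ge0 ?exprn_ge0 ?normal_pdf_ge0//.
rewrite -(@ler_pM2l _ `|x_ n - m|)// mulrA -exprS (le_trans (HD _))//.
by rewrite -ler_pdivrMr// ltW.
Unshelve. all: by end_near. Qed.

Lemma cvg_natr_normy : `|n%:R : R| @[n --> \oo] --> +oo.
Proof. by under eq_fun do rewrite normr_nat; exact: cvgr_idn. Qed.

Lemma cvg_Nnatr_normy : `|- n%:R : R| @[n --> \oo] --> +oo.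
Proof. by under eq_fun do rewrite normrN normr_nat; exact: cvgr_idn. Qed.

(* [(x - m)^k] times the density has derivative
   [k (x - m)^(k-1) - (x - m)^(k+1) / s^2] times the density. *)
Lemma normal_moment_rec (m s : R) (k : nat) : s != 0 ->
  \int[mu]_x ((x - m) ^+ k.+2 * normal_pdf m s x) =
  s ^+ 2 * k.+1%:R * \int[mu]_x ((x - m) ^+ k * normal_pdf m s x).
Proof.
move=> s0; have s20 : s ^+ 2 != 0 by rewrite expf_neq0.
have int_pow j : mu.-integrable setT (EFin \o (fun x => (x - m) ^+ j * normal_pdf m s x)).
  apply: (le_integrable measurableT _ _ (integrable_pow_normal_pdf m j s0)).
    apply/measurable_EFinP; apply: measurable_funM; last exact: measurable_normal_pdf.
    by apply: measurable_funX; exact: measurable_funB.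
  by move=> x _ /=; rewrite lee_fin !normrM normrX [ `|normal_pdf _ _ _|]ger0_norm ?normal_pdf_ge0// normrX normr_id.
pose F x := (x - m) ^+ k.+1 * normal_pdf m s x.
pose f x := k.+1%:R * ((x - m) ^+ k * normal_pdf m s x) -
  s ^- 2 * ((x - m) ^+ k.+2 * normal_pdf m s x).
have int1 : mu.-integrable setT (EFin \o (fun x => k.+1%:R * ((x - m) ^+ k * normal_pdf m s x))).
  by apply: integrable_EFinZ; exact: int_pow.
have int2 : mu.-integrable setT (EFin \o (fun x => s ^- 2 * ((x - m) ^+ k.+2 * normal_pdf m s x))).
  by apply: integrable_EFinZ; exact: int_pow.
have cF (x_ : nat -> R) : `|x_ n| @[n --> \oo] --> +oo -> F (x_ n) @[n --> \oo] --> 0.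
  move=> x_oo; apply: norm_cvg0.
  have := cvg_pow_normal_pdf m k.+1 s0 x_oo; apply: cvg_trans.
  apply: near_eq_cvg; apply: nearW => n.
  by rewrite /F normrM normrX [ `|normal_pdf _ _ _|]ger0_norm// normal_pdf_ge0.
have : \int[mu]_x f x = 0.
  apply: (@Rintegral_derive_eq0 F f).
  - move=> x.
    have := normal_pdf_is_derive m x s0 => Hd.
    have Hx : is_derive x (1:R) (fun y : R => (y - m) ^+ k.+1) (k.+1%:R * (x - m) ^+ k).
      have := @is_deriveX _ _ (fun y : R => y - m) k.+1 x 1 1 _.
      by rewrite exprfctE /= /GRing.scale/= mulr1; apply; apply: is_derive_eq; rewrite subr0.
    rewrite /F; apply: is_derive_eq.
    rewrite /f /GRing.scale/= !exprS.
    by field; rewrite s0.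
  - have cX j (x : R) : (y - m) ^+ j * normal_pdf m s y @[y --> x] --> (x - m) ^+ j * normal_pdf m s x.
      apply: cvgM; last exact: continuous_normal_pdf.
      apply: (cvg_comp (fun y => y - m) (fun y => y ^+ j)); last exact: exprn_continuous.
      by apply: (@cvgB _ R^o); [exact: cvg_id|exact: cvg_cst].
    by move=> x; apply: cvgB; apply: cvgM; try exact: cvg_cst; exact: cX.
  - by rewrite /f /comp; under eq_fun do rewrite EFinB; exact: integrableB.
  - exact/cF/cvg_natr_normy.
  - exact/cF/cvg_Nnatr_normy.
rewrite RintegralB// !RintegralZl// => /subr0_eq.
move=> /(congr1 (fun z => s ^+ 2 * z)) /=.
by rewrite !mulrA mulfV// mul1r => <-.
Qed.

Lemma integrable_id_normal_pdf (m s : R) : s != 0 ->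
  mu.-integrable setT (EFin \o (fun x => (x - m) * normal_pdf m s x)).
Proof.
move=> s0; apply: (le_integrable measurableT _ _ (integrable_pow_normal_pdf m 1 s0)).
  apply/measurable_EFinP; apply: measurable_funM; last exact: measurable_normal_pdf.
  exact: measurable_funB.
by move=> x _ /=; rewrite lee_fin !normrM normrX normr_id expr1.
Qed.

Lemma normal_mean (m s : R) : s != 0 -> \int[mu]_x ((x - m) * normal_pdf m s x) = 0.
Proof.
move=> s0; have s20 : s ^+ 2 != 0 by rewrite expf_neq0.
have cF (x_ : nat -> R) : `|x_ n| @[n --> \oo] --> +oo ->
    - s ^+ 2 * normal_pdf m s (x_ n) @[n --> \oo] --> 0.
  move=> x_oo; rewrite -(mulr0 (- s ^+ 2)); apply: cvgM; first exact: cvg_cst.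
  by have := cvg_pow_normal_pdf m 0 s0 x_oo; under eq_fun do rewrite expr0 mul1r.
apply: (@Rintegral_derive_eq0 (fun x => - s ^+ 2 * normal_pdf m s x) (fun x => (x - m) * normal_pdf m s x)).
- move=> x; have := normal_pdf_is_derive m x s0 => Hd.
  apply: is_derive_eq; rewrite /GRing.scale/=.
  by field; rewrite s0.
- move=> x; apply: cvgM; last exact: continuous_normal_pdf.
  by apply: cvgB; [exact: cvg_id|exact: cvg_cst].
- exact: integrable_id_normal_pdf.
- exact/cF/cvg_natr_normy.
- exact/cF/cvg_Nnatr_normy.
Qed.

Lemma normal_variance (m s : R) : s != 0 ->
  \int[mu]_x ((x - m) ^+ 2 * normal_pdf m s x) = s ^+ 2.
Proof.
move=> s0; rewrite normal_moment_rec// mulr1.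
under eq_Rintegral do rewrite expr0 mul1r.
by rewrite /Rintegral integral_normal_pdf mulr1.
Qed.

Lemma normal_moment4 (m s : R) : s != 0 ->
  \int[mu]_x ((x - m) ^+ 4 * normal_pdf m s x) = 3 * s ^+ 4.
Proof.
by move=> s0; rewrite normal_moment_rec// normal_variance//; ring.
Qed.

(** As a function of the frequency the integral [psi] satisfies [psi' c = - s^2 c psi c], by
    differentiation under the integral and integration by parts; so [psi c * exp (s^2 c^2 / 2)] is
    constant. The phase [t] carries the sine along with the cosine, which replaces complex
    exponentials. *)
Lemma cos_normal_pdf (s t b : R) : s != 0 ->
  \int[mu]_x (cos (b * x + t) * normal_pdf 0 s x) = expR (- (s ^+ 2 * b ^+ 2 / 2)) * cos t.
Proof.
move=> s0; have s20 : s ^+ 2 != 0 by rewrite expf_neq0.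
have intx : mu.-integrable setT (EFin \o (fun x => `|x| * normal_pdf 0 s x)).
  have := integrable_pow_normal_pdf 0 1 s0.
  by apply: eq_integrable => // x _ /=; rewrite subr0 expr1.
pose f (c x : R) := cos (c * x + t) * normal_pdf 0 s x.
pose ff (c x : R) := - sin (c * x + t) * x * normal_pdf 0 s x.
have mlin c : measurable_fun setT (fun x : R => c * x + t).
  by apply: measurable_funD => //; apply: measurable_funM.
have mcos : measurable_fun setT (@cos R) by apply: continuous_measurable_fun; exact: continuous_cos.
have msin : measurable_fun setT (@sin R) by apply: continuous_measurable_fun; exact: continuous_sin.
have df (c x : R) : is_derive c (1:R) (f ^~ x) (ff c x).
  by rewrite /f /ff; apply: is_derive_eq; rewrite /GRing.scale/=; ring.
have intf c : mu.-integrable setT (EFin \o f c).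
  apply: (le_integrable measurableT _ _ (integrable_normal_pdf 0 s)).
    apply/measurable_EFinP; apply: measurable_funM; last exact: measurable_normal_pdf.
    exact: (measurableT_comp mcos (mlin c)).
  move=> x _ /=; rewrite lee_fin normrM ler_piMl//.
  exact: cos_max.
have intff c : mu.-integrable setT (EFin \o ff c).
  apply: (le_integrable measurableT _ _ intx).
    apply/measurable_EFinP; apply: measurable_funM; last exact: measurable_normal_pdf.
    by apply: measurable_funM => //; apply: measurableT_comp => //; exact: (measurableT_comp msin (mlin c)).
  move=> x _ /=; rewrite lee_fin !normrM normrN normr_id -mulrA ler_piMl//.
  by rewrite ler_norml sin_geN1 sin_le1.
pose psi c := \int[mu]_x f c x.
have dpsi (c : R) : is_derive c (1:R) psi (- (s ^+ 2 * c) * psi c).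
  have cI : (`]c - 1, c + 1[%classic : set R) c by rewrite /= in_itv/= ltrBlDr !ltrDl ltr01.
  have d1 x y : ('D_1 (f ^~ y) x) = ff x y by apply: derive_val.
  have dex x y (_ : (`]c - 1, c + 1[%classic : set R) x) (_ : [set: R] y) :=
    @ex_derive _ _ _ _ _ _ _ (df x y).
  pose bound (y : R) := `|y| * normal_pdf 0 s y.
  have bound0 y : 0 <= bound y by rewrite mulr_ge0 ?normal_pdf_ge0.
  have H := @derivable_under_integral R _ _ mu f setT measurableT c (c-1) (c+1) cI
     (fun x _ => intf x) dex bound bound0 intx.
  have H2 := @differentiation_under_integral R _ _ mu f setT measurableT c (c-1) (c+1) cI
     (fun x _ => intf x) dex bound bound0 intx.
  have G x y : (`]c - 1, c + 1[%classic : set R) x -> [set: R] y -> `|(f ^~ y)^`()%classic x| <= bound y.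
    move=> _ _; rewrite derive1E d1 /ff /bound !normrM normrN [ `|normal_pdf _ _ _|]ger0_norm ?normal_pdf_ge0//.
    rewrite ler_wpM2r ?normal_pdf_ge0// ler_piMl//.
    by rewrite ler_norml sin_geN1 sin_le1.
  apply: DeriveDef; first exact: H.
  rewrite -derive1E H2//.
  under eq_Rintegral do rewrite partial1of2E d1.
  (* derivative of [s ^ 2 sin (c x + t)] times the density *)
  pose F x := s ^+ 2 * (sin (c * x + t) * normal_pdf 0 s x).
  have cF (x_ : nat -> R) : `|x_ n| @[n --> \oo] --> +oo -> F (x_ n) @[n --> \oo] --> 0.
    move=> x_oo; rewrite -(mulr0 (s ^+ 2)); apply: cvgM; first exact: cvg_cst.
    apply: norm_cvg0.
    apply: (@squeeze_cvgr _ _ _ _ (cst 0) _ _ _ _ _ (cvg_pow_normal_pdf 0 0 s0 x_oo)); last exact: cvg_cst.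
    apply: nearW => n; rewrite normr_ge0/= expr0 mul1r normrM [ `|normal_pdf _ _ _|]ger0_norm ?normal_pdf_ge0//.
    by rewrite ler_piMl ?normal_pdf_ge0// ler_norml sin_geN1 sin_le1.
  have : \int[mu]_x (s ^+ 2 * c * f c x + ff c x) = 0.
    have int1 : mu.-integrable setT (fun x => (s ^+ 2 * c * f c x)%:E).
      under eq_fun do rewrite EFinM.
      by apply: integrableZl => //; exact: intf.
    apply: (@Rintegral_derive_eq0 F (fun x => s ^+ 2 * c * f c x + ff c x)).
    - move=> x.
      have := normal_pdf_is_derive 0 x s0 => Hd.
      rewrite /F; apply: is_derive_eq.
      rewrite /f /ff /GRing.scale/= subr0.
      by field; rewrite s0.
    - have cl (x : R) : (fun x => c * x + t) x @[x --> x] --> c * x + t.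
        by apply: cvgD; [apply: cvgM; [exact: cvg_cst|exact: cvg_id]|exact: cvg_cst].
      move=> x; apply: cvgD.
        apply: cvgM; first exact: cvg_cst.
        apply: cvgM; last exact: continuous_normal_pdf.
        by apply: continuous_comp; [exact: cl|exact: continuous_cos].
      apply: cvgM; last exact: continuous_normal_pdf.
      apply: cvgM; last exact: cvg_id.
      by apply: cvgN; apply: continuous_comp; [exact: cl|exact: continuous_sin].
    - rewrite /comp; under eq_fun do rewrite EFinD.
      by apply: integrableD => //; exact: intff.
    - exact/cF/cvg_natr_normy.
    - exact/cF/cvg_Nnatr_normy.
  rewrite RintegralD//; last first.
    by apply: integrable_EFinZ; exact: intf.
  rewrite RintegralZl// => /eqP; rewrite addrC addr_eq0 => /eqP ->.
  by rewrite mulNr.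
pose G c := psi c * expR (s ^+ 2 * c ^+ 2 / 2).
have dG (c : R) : is_derive c (1:R) G 0.
  have := dpsi c => Hd; rewrite /G; apply: is_derive_eq.
  by rewrite /GRing.scale/=; field.
have GE : G b = G 0 by apply: is_derive_0_is_cst.
have G0 : G 0 = cos t.
  rewrite /G expr0n/= mulr0 mul0r expR0 mulr1 /psi /f.
  under eq_Rintegral do rewrite mul0r add0r.
  rewrite RintegralZl//; last exact: integrable_normal_pdf.
  by rewrite /Rintegral integral_normal_pdf mulr1.
by rewrite -G0 -GE /G mulrCA -expRD addNr expR0 mulr1.
Qed.

(** The Radon-Nikodym derivative allows the change of variables, and it agrees almost everywhere
    with the density because both have the same integral over every measurable set. *)
Lemma ge0_integral_normal_prob (m s : R) (f : R -> \bar R) :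
  measurable_fun setT f -> (forall x, 0 <= f x)%E ->
  (\int[normal_prob m s]_x f x = \int[mu]_x (f x * (normal_pdf m s x)%:E))%E.
Proof.
move=> mf f0; have nmu := normal_prob_dominates m s.
pose rn := Radon_Nikodym_SigmaFinite.f (normal_prob m s) mu.
have irn : mu.-integrable setT rn := Radon_Nikodym_SigmaFinite.f_integrable nmu.
have mpdf : measurable_fun setT (fun x => (normal_pdf m s x)%:E).
  by apply/measurable_EFinP; exact: measurable_normal_pdf.
rewrite -(Radon_Nikodym_SigmaFinite.change_of_variables nmu)//.
apply: ae_eq_integral => //; try by apply: emeasurable_funM => //; exact: measurable_int irn.
apply: ae_eqe_mul2l; apply: integral_ae_eq => //= A _ mA.
by rewrite -Radon_Nikodym_SigmaFinite.f_integral.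
Qed.

Lemma integrable_normal_prob (m s : R) (f : R -> R) :
  measurable_fun setT f ->
  mu.-integrable setT (EFin \o (fun x => f x * normal_pdf m s x)) ->
  (normal_prob m s).-integrable setT (EFin \o f).
Proof.
move=> mf /integrableP[mfn intfn]; apply/integrableP; split.
  exact/measurable_EFinP.
rewrite ge0_integral_normal_prob//; last by do 2 apply: measurableT_comp => //.
apply: le_lt_trans intfn; apply: ge0_le_integral => //.
- by move=> x _; rewrite mule_ge0// lee_fin normal_pdf_ge0.
- apply: emeasurable_funM; first by do 2 apply: measurableT_comp => //.
  by apply/measurable_EFinP; exact: measurable_normal_pdf.
- exact: measurableT_comp.
by move=> x _ /=; rewrite lee_fin normrM [ `|normal_pdf _ _ _|]ger0_norm ?normal_pdf_ge0.
Qed.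

Lemma Rintegral_normal_prob (m s : R) (f : R -> R) :
  measurable_fun setT f ->
  mu.-integrable setT (EFin \o (fun x => f x * normal_pdf m s x)) ->
  \int[normal_prob m s]_x f x = \int[mu]_x (f x * normal_pdf m s x).
Proof.
move=> mf intfn; rewrite /Rintegral; congr fine.
rewrite integralE [RHS]integralE; congr (_ - _)%E.
  rewrite ge0_integral_normal_prob//; last exact/measurable_funepos/measurable_EFinP.
  apply: eq_integral => x _ /=; rewrite !funeposE.
  by rewrite maxe_pMl ?lee_fin ?normal_pdf_ge0// mul0e.
rewrite ge0_integral_normal_prob//; last exact/measurable_funeneg/measurable_EFinP.
apply: eq_integral => x _ /=; rewrite !funenegE.
by rewrite maxe_pMl ?lee_fin ?normal_pdf_ge0// mul0e EFinM mulNe.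
Qed.

End normal_integrals.

(** * Step functions as limits of polynomials, and dominated convergence *)

Section real_sequences.
Context {R : realType}.

(** With [y = sqrt z] and [1 / y = 1 + u], Bernoulli's inequality bounds [n y^n] by [1 / u], and the
    remaining factor [y^n] tends to [0]. *)
Lemma cvg_natr_exprn (z : R) : 0 <= z < 1 -> n%:R * z ^+ n @[n --> \oo] --> 0.
Proof.
move=> /andP[z0 z1].
have [->|zn0] := eqVneq z 0.
  apply: cvg_near_cst; near=> n; rewrite expr0n.
  by rewrite (negbTE (_ : n != 0)%N) ?mulr0// -lt0n; near: n; exists 1%N.
have zgt0 : 0 < z by rewrite lt_neqAle eq_sym zn0.
pose y := Num.sqrt z.
have y0 : 0 < y by rewrite sqrtr_gt0.
have y1 : y < 1 by rewrite -sqrtr1 ltr_sqrt.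
pose u := y^-1 - 1.
have u0 : 0 < u by rewrite subr_gt0 invf_gt1.
have yE : y^-1 = u + 1 by rewrite subrK.
pose C := u^-1.
have H n : 0 <= n%:R * z ^+ n <= C * y ^+ n.
  rewrite mulr_ge0 ?exprn_ge0//=.
  have -> : z = y * y by rewrite -expr2 sqr_sqrtr.
  rewrite exprMn mulrA ler_wpM2r ?exprn_ge0 ?(ltW y0)// /C.
  rewrite -[leRHS]mul1r ler_pdivlMr// mulrAC -ler_pdivlMr ?exprn_gt0// mul1r -exprVn.
  rewrite yE.
  suff : 1 + n%:R * u <= (u + 1) ^+ n by apply: le_trans; rewrite lerDr.
  elim: n => [|n IH]; first by rewrite mul0r addr0.
  rewrite exprSr (le_trans _ (ler_wpM2r _ IH))//; last by rewrite addr_ge0 ?ltW.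
  have : 0 <= n%:R * u * u by rewrite !mulr_ge0 ?(ltW u0).
  by rewrite -[n.+1%:R]natr1; lra.
have c0 : C * y ^+ n @[n --> \oo] --> 0.
  rewrite -(mulr0 C); apply: cvgM; first exact: cvg_cst.
  by apply: cvg_expr; rewrite ger0_norm ?ltW.
by apply: (squeeze_cvgr _ (cvg_cst _) c0); exact: nearW.
Unshelve. all: by end_near. Qed.

(** By Bernoulli's inequality the value is at least [1 - n (2 v)^n] when [v < 1/2], and at most
    [1 / (1 + n (2 v)^n) <= 1 / (n + 1)] when [v >= 1/2]. The factor [n] in the exponent is what
    settles the boundary case [v = 1/2]. *)
Lemma cvg_step_polynomial (v : R) : 0 <= v <= 1 ->
  (1 - v ^+ n) ^+ (n * 2 ^ n) @[n --> \oo] --> ((v < 2^-1)%R%:R : R).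
Proof.
move=> /andP[v0 v1].
have vn n : 0 <= v ^+ n <= 1 by rewrite exprn_ge0//= exprn_ile1.
have [v2|v2] := ltP v 2^-1.
  have z01 : 0 <= 2 * v < 1 by rewrite mulr_ge0//= mulrC -ltr_pdivlMr// mul1r.
  have c1 : 1 - n%:R * (2 * v) ^+ n @[n --> \oo] --> (1 - 0 : R).
    by apply: cvgB; [exact: cvg_cst|exact: cvg_natr_exprn].
  rewrite subr0 in c1.
  apply: (squeeze_cvgr _ c1 (cvg_cst _)).
  apply: nearW => n; have /andP[a b] := vn n; apply/andP; split; last first.
    by rewrite exprn_ile1 ?subr_ge0// lerBlDr lerDl.
  rewrite exprMn mulrA -natrX -natrM mulrC.
  elim: (n * 2 ^ n)%N => [|k IH]; first by rewrite mulr0 subr0 expr0.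
  rewrite exprS (le_trans _ (ler_wpM2l _ IH)) ?subr_ge0//.
  rewrite -[k.+1]addn1 natrD.
  have : 0 <= v ^+ n * v ^+ n * k%:R by rewrite !mulr_ge0.
  nra.
have c2 : n.+1%:R^-1 @[n --> \oo] --> (0 : R).
  exact: cvg_harmonic.
apply: (squeeze_cvgr _ (cvg_cst _) c2).
apply: nearW => n; have /andP[a b] := vn n; rewrite exprn_ge0 ?subr_ge0//=.
set K := (n * 2 ^ n)%N.
have H : (1 - v ^+ n) ^+ K * (1 + K%:R * v ^+ n) <= 1.
  elim: K => [|k IH]; first by rewrite mul0r addr0 mulr1.
  apply: le_trans IH; rewrite exprS -mulrA mulrCA ler_wpM2l ?exprn_ge0 ?subr_ge0//.
  rewrite -[k.+1]addn1 natrD.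
  have : 0 <= v ^+ n * v ^+ n * (k%:R + 1) by rewrite !mulr_ge0// addr_ge0.
  nra.
have K1 : n.+1%:R <= 1 + K%:R * v ^+ n.
  rewrite -natr1 addrC lerD2l /K natrM -mulrA ler_peMr// natrX -exprMn exprn_ege1//.
  by rewrite -ler_pdivrMl// mulr1.
rewrite -[leRHS]mul1r ler_pdivlMr ?ltr0n// (le_trans _ H)// ler_wpM2l//.
by rewrite exprn_ge0 ?subr_ge0.
Qed.

End real_sequences.

Section real_integral.
Context d (T : measurableType d) (R : realType) (P : probability T R).
Implicit Types f g h : T -> R.

Lemma Rintegral_dominated_cvg (f_ : nat -> T -> R) f g :
  (forall n, measurable_fun setT (f_ n)) ->
  (forall w, f_ n w @[n --> \oo] --> f w) ->
  P.-integrable setT (EFin \o g) -> (forall n w, `|f_ n w| <= g w) ->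
  \int[P]_w f_ n w @[n --> \oo] --> \int[P]_w f w.
Proof.
move=> mf_ cf intg fg.
have mf : measurable_fun setT f by apply: measurable_fun_cvg mf_ _ => w _; exact: cf.
have [||||_] := @dominated_convergence _ _ _ P setT measurableT (fun n w => (f_ n w)%:E)
  (fun w => (f w)%:E) (EFin \o g) _ _ _ intg _.
- by move=> n; exact/measurable_EFinP.
- exact/measurable_EFinP.
- by apply: aeW => w _; apply: cvg_EFin; [exact: nearW|exact: cf].
- by apply: aeW => w n _; rewrite lee_fin.
- move=> _ cv; apply/fine_cvg; rewrite fineK//.
  apply: integrable_fin_num => //.
  apply: (le_integrable measurableT _ _ intg); first exact/measurable_EFinP.
  move=> w _ /=; rewrite lee_fin (le_trans _ (ler_norm _))//.
  by apply: (cvgr_to_le (cvg_norm (cf w))); exact: nearW.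
Qed.

End real_integral.

Section half_line_events.
Context d (T : measurableType d) (R : realType).

Lemma measurable_lt_set (f : T -> R) (y : R) : measurable_fun setT f ->
  measurable [set w | f w < y].
Proof.
by move=> mf; apply: measurable_bool_set; exact: measurable_fun_ltr.
Qed.

Lemma indic_lt_setE (f : T -> R) (y : R) :
  \1_[set w | f w < y] = (fun w => (f w < y)%R%:R) :> (T -> R).
Proof.
apply/funext => w; rewrite indicE; congr (nat_of_bool _)%:R.
by apply/idP/idP; rewrite inE.
Qed.

Lemma measurable_lt_indic (f : T -> R) (y : R) : measurable_fun setT f ->
  measurable_fun setT (fun w => (f w < y)%R%:R : R).
Proof.
by move=> mf; apply: measurable_natr_bool; exact: measurable_fun_ltr.
Qed.

End half_line_events.

(** * Orthogonality to cosines implies orthogonality to half-lines *)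

Section trigonometric_determination.
Context d (T : measurableType d) (R : realType) (P : probability T R).
Variables (g Y : T -> R) (M : R).
Hypothesis mg : measurable_fun setT g.
Hypothesis mY : measurable_fun setT Y.
Hypothesis gM : forall w, `|g w| <= M.

(** This class is linear and, by the product formula for cosines, stable under multiplication by a
    cosine of [Y]. Once it contains [1] it therefore contains all trigonometric polynomials in
    [Y]. *)
Let annihilates (h : T -> R) := [/\ measurable_fun setT h,
  (exists B : R, forall w, `|h w| <= B) &
  forall a t, \int[P]_w (g w * h w * cos (a * Y w + t)) = 0].

Let mcos a t : measurable_fun setT (fun w => cos (a * Y w + t)).
Proof.
apply: (@measurableT_comp _ _ _ _ _ _ (@cos R)).
  by apply: continuous_measurable_fun; exact: continuous_cos.
by apply: measurable_funD => //; exact: measurable_funM.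
Qed.

Let cosb (x : R) : `|cos x| <= 1.
Proof. exact: cos_max. Qed.

Let integrable_ghc (h : T -> R) (B : R) a t : measurable_fun setT h -> (forall w, `|h w| <= B) ->
  P.-integrable setT (EFin \o (fun w => g w * h w * cos (a * Y w + t))).
Proof.
move=> mh hB; apply: (@integrable_bounded _ _ _ _ _ (M * B)).
  by apply: measurable_funM; [exact: measurable_funM|exact: mcos].
move=> w; rewrite normrM -[leRHS]mulr1 ler_pM//.
by rewrite normrM ler_pM.
Qed.

Let annihilatesD h1 h2 b c : annihilates h1 -> annihilates h2 ->
  annihilates (fun w => b * h1 w + c * h2 w).
Proof.
move=> [m1 [B1 hB1] e1] [m2 [B2 hB2] e2]; split.
- by apply: measurable_funD; exact: measurable_funM.
- exists (`|b| * B1 + `|c| * B2) => w; rewrite (le_trans (ler_normD _ _))//.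
  by rewrite lerD// normrM ler_wpM2l.
move=> a t.
transitivity (\int[P]_w (b * (g w * h1 w * cos (a * Y w + t)) +
    c * (g w * h2 w * cos (a * Y w + t)))).
  by apply: eq_Rintegral => w _; ring.
have i1 := integrable_ghc a t m1 hB1; have i2 := integrable_ghc a t m2 hB2.
rewrite RintegralD//; last 2 first.
- exact: integrable_EFinZ.
- exact: integrable_EFinZ.
by rewrite !RintegralZl// e1 e2 !mulr0 addr0.
Qed.

Let annihilatesM h a t : annihilates h ->
  annihilates (fun w => h w * cos (a * Y w + t)).
Proof.
move=> [m1 [B hB] e]; split.
- by apply: measurable_funM => //; exact: mcos.
- by exists (B * 1) => w; rewrite normrM ler_pM.
move=> b u.
transitivity (\int[P]_w (2^-1 * (g w * h w * cos ((a + b) * Y w + (t + u))) +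
    2^-1 * (g w * h w * cos ((a - b) * Y w + (t - u))))).
  apply: eq_Rintegral => w _.
  rewrite (_ : (a + b) * Y w + (t + u) = (a * Y w + t) + (b * Y w + u)); last by ring.
  rewrite (_ : (a - b) * Y w + (t - u) = (a * Y w + t) - (b * Y w + u)); last by ring.
  move: (a * Y w + t) (b * Y w + u) => x y.
  by rewrite cosB cosD; field.
have i1 := integrable_ghc (a + b) (t + u) m1 hB.
have i2 := integrable_ghc (a - b) (t - u) m1 hB.
rewrite RintegralD//; last 2 first.
- exact: integrable_EFinZ.
- exact: integrable_EFinZ.
by rewrite !RintegralZl// !e !mulr0 addr0.
Qed.

(* Trigonometric polynomials converging boundedly to a square wave of period
   [2 pi k] separate [Y < y] from [Y >= y] as [k] goes to infinity. *)
Lemma trig_indicator (y : R) :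
  (forall a t, \int[P]_w (g w * cos (a * Y w + t)) = 0) ->
  \int[P]_w (g w * (Y w < y)%R%:R) = 0.
Proof.
move=> e0.
have ann1 : annihilates (fun=> 1).
  split; [exact: measurable_cst| by exists 1 => _; rewrite normr1|].
  by move=> a t; under eq_Rintegral do rewrite mulr1; exact: e0.
(* The sine is moved into [[0, 1]] to suit [cvg_step_polynomial]; the threshold [1/2] then tests its
   sign. *)
pose v (k : nat) w := 2^-1 + 2^-1 * sin ((Y w - y) / k.+1%:R).
have v01 k w : 0 <= v k w <= 1.
  have := sin_geN1 ((Y w - y) / k.+1%:R); have := sin_le1 ((Y w - y) / k.+1%:R).
  by rewrite /v; lra.
have annv k h : annihilates h -> annihilates (fun w => h w * v k w).
  move=> ah.
  have := annihilatesD 2^-1 2^-1 ah (annihilatesM (k.+1%:R^-1) (- y / k.+1%:R - pi / 2) ah).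
  congr annihilates; apply/funext => w; rewrite /v.
  rewrite addrA cosBpihalf (_ : k.+1%:R^-1 * Y w + - y / k.+1%:R = (Y w - y) / k.+1%:R); last by ring.
  by ring.
have annvn k n h : annihilates h -> annihilates (fun w => h w * v k w ^+ n).
  move=> ah; elim: n => [|n IH]; first by under eq_fun do rewrite mulr1.
  by have := annv k _ IH; congr annihilates; apply/funext => w; rewrite exprSr mulrA.
have ann1v k n m : annihilates (fun w => (1 - v k w ^+ n) ^+ m).
  elim: m => [|m IH]; first by under eq_fun do rewrite expr0.
  have := annihilatesD 1 (-1) IH (annvn k n _ IH); congr annihilates.
  by apply/funext => w; rewrite exprSr; ring.
have Ek k : \int[P]_w (g w * (v k w < 2^-1)%R%:R) = 0.
  have cv : \int[P]_w (g w * (1 - v k w ^+ n) ^+ (n * 2 ^ n)) @[n --> \oo] -->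
      \int[P]_w (g w * (v k w < 2^-1)%R%:R).
    apply: (@Rintegral_dominated_cvg _ _ _ _ _ _ (fun w => `|g w|)).
    - by move=> n; apply: measurable_funM => //; have [] := ann1v k n (n * 2 ^ n)%N.
    - by move=> w; apply: cvgM; [exact: cvg_cst|exact: (cvg_step_polynomial (v01 k w))].
    - apply: (@integrable_bounded _ _ _ _ _ M); first exact: measurableT_comp.
      by move=> w; rewrite normr_id.
    - move=> n w; rewrite normrM ler_piMr// normrX exprn_ile1// ler_norml.
      have /andP[a b] := v01 k w.
      have c : 0 <= v k w ^+ n by rewrite exprn_ge0.
      have c' : v k w ^+ n <= 1 by rewrite exprn_ile1.
      by apply/andP; split; lra.
  rewrite -(cvg_lim _ cv)//; apply/cvg_lim => //; apply: cvg_near_cst; apply: nearW => n.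
  have [_ _ /(_ 0 0)] := ann1v k n (n * 2 ^ n)%N.
  by under eq_Rintegral do rewrite mul0r addr0 cos0 mulr1.
have cv : \int[P]_w (g w * (v k w < 2^-1)%R%:R) @[k --> \oo] -->
    \int[P]_w (g w * (Y w < y)%R%:R).
  apply: (@Rintegral_dominated_cvg _ _ _ _ _ _ (fun w => `|g w|)).
  - move=> k; apply: measurable_funM => //.
    apply: measurable_lt_indic; have [+ _ _] := annv k _ ann1.
    by under eq_fun do rewrite mul1r.
  - move=> w; apply: cvgM; first exact: cvg_cst.
    apply: cvg_near_cst; near=> k; congr (_%:R).
    (* From here on [(Y w - y) / (k + 1)] lies strictly between [- pi] and [pi], so its sine has the
       sign of [Y w - y]. At [Y w = y] the sine is zero, in agreement with the strict inequality. *)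
    have kY : `|Y w - y| < pi * k.+1%:R.
      rewrite -ltr_pdivrMl ?pi_gt0//.
      near: k; have := @cvgr_idn R; rewrite -cvg_shiftS => /cvgryPgt/(_ (pi^-1 * `|Y w - y|)).
      by [].
    have -> : (v k w < 2^-1) = (sin ((Y w - y) / k.+1%:R) < 0).
      by rewrite /v -[X in _ < X]addr0 ltrD2l pmulr_rlt0.
    have kgt0 : 0 < k.+1%:R :> R by rewrite ltr0n.
    have [Yy|Yy] := ltP (Y w) y.
      have : 0 < sin (- ((Y w - y) / k.+1%:R)).
        apply: sin_gt0_pi; rewrite -mulNr opprB divr_gt0 ?subr_gt0//= ltr_pdivrMr//.
        by rewrite (le_lt_trans _ kY)// -normrN opprB ler_norm.
      by rewrite sinN oppr_gt0 => ->.
    have : 0 <= sin ((Y w - y) / k.+1%:R).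
      apply: sin_ge0_pi; rewrite divr_ge0 ?subr_ge0 ?(ltW kgt0)//=.
      by rewrite ler_pdivrMr// ltW// (le_lt_trans _ kY)// ler_norm.
    by rewrite leNgt => /negbTE ->.
  - apply: (@integrable_bounded _ _ _ _ _ M); first exact: measurableT_comp.
    by move=> w; rewrite normr_id.
  - by move=> n w; rewrite normrM ler_piMr//; case: (_ < _)%R; rewrite ?normr1 ?normr0.
rewrite -(cvg_lim _ cv)//; apply/cvg_lim => //.
by apply: cvg_near_cst; apply: nearW => k; rewrite Ek.
Unshelve. all: by end_near. Qed.

End trigonometric_determination.

(** * Integrals against Gaussian laws *)

Section laws.
Context d (T : measurableType d) (R : realType) (P : probability T R).
Local Notation mu := (@lebesgue_measure R).

Lemma normal_law_integral (X : T -> R) (m s : R) (h : R -> R) :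
  measurable_fun setT X ->
  (forall A, measurable A -> P (X @^-1` A) = normal_prob m s A) ->
  measurable_fun setT h ->
  mu.-integrable setT (EFin \o (fun x => h x * normal_pdf m s x)) ->
  P.-integrable setT (EFin \o (fun w => h (X w))) /\
  \int[P]_w h (X w) = \int[mu]_x (h x * normal_pdf m s x).
Proof.
move=> mX lawX mh inth.
have ge0E (k : R -> R) : measurable_fun setT k -> (forall x, 0 <= k x) ->
    (\int[P]_w (k (X w))%:E = \int[normal_prob m s]_x (k x)%:E)%E.
  move=> mk k0.
  pose X' : T -> measurableTypeR R := X.
  have mX' : measurable_fun setT X' := mX.
  pose Xm : {mfun T >-> measurableTypeR R} := HB.pack X' (isMeasurableFun.Build _ _ _ _ X' mX').
  transitivity (\int[distribution P Xm]_x (k x)%:E)%E.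
    by rewrite ge0_integral_distribution//; exact/measurable_EFinP.
  by apply: eq_measure_integral => A mA _; exact: lawX.
have inth' := integrable_normal_prob mh inth.
have ihX : P.-integrable setT (EFin \o (fun w => h (X w))).
  apply/integrableP; split; first exact/measurable_EFinP/measurableT_comp.
  rewrite (ge0E (fun x => `|h x|))//; last exact: measurableT_comp.
  by have /integrableP[_] := inth'.
split => //.
rewrite -(Rintegral_normal_prob mh inth) /Rintegral; congr fine.
rewrite integralE [RHS]integralE; congr (_ - _)%E.
  transitivity (\int[P]_w (h^\+ (X w))%:E)%E.
    by apply: eq_integral => w _; rewrite funeposE /funrpos EFin_max.
  rewrite ge0E//; last exact: measurable_funrpos.
  by apply: eq_integral => w _; rewrite funeposE /funrpos EFin_max.
transitivity (\int[P]_w (h^\- (X w))%:E)%E.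
  by apply: eq_integral => w _; rewrite funenegE /funrneg EFin_max.
rewrite ge0E//; last exact: measurable_funrneg.
by apply: eq_integral => w _; rewrite funenegE /funrneg EFin_max.
Qed.

Lemma dirac_law_ae_eq (X : T -> R) (m : R) : measurable_fun setT X ->
  (forall A, measurable A -> P (X @^-1` A) = \d_m A) ->
  {ae P, forall w, X w = m}.
Proof.
move=> mX lawX; exists (X @^-1` (~` [set m])); split.
- by rewrite -[X in measurable X]setTI; apply: mX => //; apply: measurableC; exact: measurable_set1.
- rewrite lawX; last by apply: measurableC; exact: measurable_set1.
  by rewrite diracE memNset//=; apply.
- by move=> w /=.
Qed.

Lemma gaussian_law_integrable (Y : T -> R) : measurable_fun setT Y ->
  gaussian_law P Y -> P.-integrable setT (EFin \o Y).
Proof.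
move=> mY [[m lawY]|[m [s [s0 lawY]]]].
  apply/integrableP; split; first exact/measurable_EFinP.
  rewrite (ae_eq_integral (cst `|m|%:E))//.
  - by rewrite integral_cst//= probability_setT mule1 ltry.
  - by apply/measurable_EFinP; exact: measurableT_comp.
  - by apply: filterS (dirac_law_ae_eq mY lawY) => w Yw _ /=; rewrite Yw.
have sn0 : s != 0 by rewrite gt_eqF.
have [iY _] := normal_law_integral mY lawY (measurable_funB (@measurable_id _ _ _) (measurable_cst m))
  (integrable_id_normal_pdf m sn0).
have := integrableD measurableT iY (finite_measure_integrable_cst P m measurableT).
by apply: eq_integrable => // w _ /=; rewrite -EFinD subrK.
Qed.

End laws.

Definition centered_gaussian_space d (T : measurableType d) (R : realType)
    (P : probability T R) (H : set (T -> R)) : Prop :=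
  (forall a b X Y, H X -> H Y -> H (fun w => a * X w + b * Y w)) /\
  (forall X, H X ->
    [/\ measurable_fun setT X, gaussian_law P X & \int[P]_w X w = 0]).

(** * Moments and independence in a Gaussian space *)

Section gaussian_space.
Context d (T : measurableType d) (R : realType) (P : probability T R).
Variable H : set (T -> R).
Hypothesis gH : centered_gaussian_space P H.
Local Notation mu := (@lebesgue_measure R).
Implicit Types X Y Z L W : T -> R.

Lemma gspaceD a b X Y : H X -> H Y -> H (fun w => a * X w + b * Y w).
Proof. by case: gH => + _; apply. Qed.

Lemma gspaceZ a X : H X -> H (fun w => a * X w).
Proof.
move=> HX; have := gspaceD a 0 HX HX; congr H; apply/funext => w.
by rewrite mul0r addr0.
Qed.

Lemma gspace_measurable X : H X -> measurable_fun setT X.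
Proof. by case: gH => _ /[apply] -[]. Qed.

(** Computing the mean forces [m = 0] in both cases of [gaussian_law], and the second moment
    identifies [s]. The point mass becomes an almost surely null variable, which the moment formulas
    treat apart. *)
Lemma gspace_law X : H X ->
  ({ae P, forall w, X w = 0} /\ \int[P]_w X w ^+ 2 = 0) \/
  exists s : R, [/\ 0 < s, \int[P]_w X w ^+ 2 = s ^+ 2 &
    forall A, measurable A -> P (X @^-1` A) = normal_prob 0 s A].
Proof.
move=> HX; have [_ /(_ _ HX)[mX gX X0]] := gH.
have gX' := gX; case: gX => [[m lawX]|[m [s [s0 lawX]]]].
  left; have Xm := dirac_law_ae_eq mX lawX.
  have m0 : m = 0.
    rewrite -X0 /Rintegral (ae_eq_integral (cst m%:E))//; last 2 first.
    - exact/measurable_EFinP.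
    - by apply: filterS Xm => w Xw _ /=; rewrite Xw.
    by rewrite integral_cst//= probability_setT mule1.
  rewrite m0 in Xm; split => //.
  rewrite /Rintegral (ae_eq_integral (cst 0%E))//.
  - by rewrite integral0.
  - by apply/measurable_EFinP; exact: measurable_funX.
  - by apply: filterS Xm => w Xw _ /=; rewrite Xw expr0n.
right; exists s.
have sn0 : s != 0 by rewrite gt_eqF.
have [iX eX] := normal_law_integral mX lawX (measurable_funB (@measurable_id _ _ _) (measurable_cst m))
  (integrable_id_normal_pdf m sn0).
have iX1 := gaussian_law_integrable mX gX'.
have m0 : m = 0.
  move: eX; rewrite normal_mean// RintegralB//; last exact: finite_measure_integrable_cst.
  have -> : \int[P]_x cst m (X x) = m.
    by rewrite /Rintegral (_ : (fun x => _) = cst m%:E)// integral_cst//= probability_setT mule1.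
  by rewrite X0 sub0r => /eqP; rewrite oppr_eq0 => /eqP.
rewrite {}m0 in lawX *; split => //.
have m2 : measurable_fun setT (fun x : R => x ^+ 2) by exact: measurable_funX.
have i2 : mu.-integrable setT (EFin \o (fun x => x ^+ 2 * normal_pdf 0 s x)).
  have := integrable_pow_normal_pdf 0 2 sn0.
  by apply: eq_integrable => // x _ /=; rewrite subr0 real_normK// num_real.
have [_ ->] := normal_law_integral mX lawX m2 i2.
rewrite -(normal_variance 0 sn0).
by apply: eq_Rintegral => x _; rewrite subr0.
Qed.

Lemma gspace_integrable_pow X k : H X -> P.-integrable setT (EFin \o (fun w => X w ^+ k)).
Proof.
move=> HX; have mX := gspace_measurable HX.
have mk : measurable_fun setT (fun x : R => x ^+ k) by exact: measurable_funX.
case: (gspace_law HX) => [[X0 _]|[s [s0 _ lawX]]].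
  have ik : P.-integrable setT (EFin \o cst (0 ^+ k : R)).
    exact: finite_measure_integrable_cst.
  apply/integrableP; split; first by apply/measurable_EFinP; exact: measurable_funX.
  have /integrableP[_] := ik; congr (_ < _)%E; apply: ae_eq_integral => //.
  - apply: measurableT_comp => //; apply/measurable_EFinP.
    by apply: measurableT_comp => //; exact: measurable_cst.
  - apply: measurableT_comp => //; apply/measurable_EFinP; exact: measurable_funX.
  - by apply: filterS X0 => w Xw _ /=; rewrite Xw.
have sn0 : s != 0 by rewrite gt_eqF.
have ik : mu.-integrable setT (EFin \o (fun x => x ^+ k * normal_pdf 0 s x)).
  apply: (le_integrable measurableT _ _ (integrable_pow_normal_pdf 0 k sn0)).
    by apply/measurable_EFinP; apply: measurable_funM => //; exact: measurable_normal_pdf.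
  by move=> x _ /=; rewrite subr0 lee_fin !normrM !normrX !normr_id.
by have [] := normal_law_integral mX lawX mk ik.
Qed.

Lemma gspace_moment4 X : H X ->
  \int[P]_w X w ^+ 4 = 3 * (\int[P]_w X w ^+ 2) ^+ 2.
Proof.
move=> HX; have mX := gspace_measurable HX.
case: (gspace_law HX) => [[X0 ->]|[s [s0 -> lawX]]].
  rewrite expr0n mulr0 /Rintegral (ae_eq_integral (cst 0%E))//.
  - by rewrite integral0.
  - by apply/measurable_EFinP; exact: measurable_funX.
  - by apply: filterS X0 => w Xw _ /=; rewrite Xw expr0n.
have sn0 : s != 0 by rewrite gt_eqF.
have m4 : measurable_fun setT (fun x : R => x ^+ 4) by exact: measurable_funX.
have i4 : mu.-integrable setT (EFin \o (fun x => x ^+ 4 * normal_pdf 0 s x)).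
  have := integrable_pow_normal_pdf 0 4 sn0.
  apply: eq_integrable => // x _ /=.
  by rewrite subr0 -normrX ger0_norm// (exprM x 2 2) sqr_ge0.
have [_ ->] := normal_law_integral mX lawX m4 i4.
rewrite -exprM -(normal_moment4 0 sn0).
by apply: eq_Rintegral => x _; rewrite subr0.
Qed.

Lemma measurable_fun_cos (f : T -> R) : measurable_fun setT f ->
  measurable_fun setT (fun w => cos (f w)).
Proof.
by apply: measurableT_comp; apply: continuous_measurable_fun; exact: continuous_cos.
Qed.

Lemma gspace_cos X t : H X ->
  \int[P]_w cos (X w + t) = expR (- (\int[P]_w X w ^+ 2 / 2)) * cos t.
Proof.
move=> HX; have mX := gspace_measurable HX.
case: (gspace_law HX) => [[X0 ->]|[s [s0 -> lawX]]].
  rewrite mul0r oppr0 expR0 mul1r /Rintegral (ae_eq_integral (cst (cos t)%:E))//.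
  - by rewrite integral_cst//= probability_setT mule1.
  - apply/measurable_EFinP/measurable_fun_cos; exact: measurable_funD.
  - by apply: filterS X0 => w Xw _ /=; rewrite Xw add0r.
have sn0 : s != 0 by rewrite gt_eqF.
have mc : measurable_fun setT (fun x : R => cos (x + t)).
  apply: (@measurableT_comp _ _ _ _ _ _ (@cos R)).
    by apply: continuous_measurable_fun; exact: continuous_cos.
  exact: measurable_funD.
have ic : mu.-integrable setT (EFin \o (fun x => cos (x + t) * normal_pdf 0 s x)).
  apply: (le_integrable measurableT _ _ (integrable_normal_pdf 0 s)).
    by apply/measurable_EFinP; apply: measurable_funM => //; exact: measurable_normal_pdf.
  by move=> x _ /=; rewrite lee_fin normrM ler_piMl// ler_norml cos_geN1 cos_le1.
have [_ ->] := normal_law_integral mX lawX mc ic.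
have := cos_normal_pdf t 1 sn0; rewrite expr1n mulr1 => <-.
by apply: eq_Rintegral => x _; rewrite mul1r.
Qed.

Lemma gspace_integrableM X Y : H X -> H Y ->
  P.-integrable setT (EFin \o (fun w => X w * Y w)).
Proof.
move=> HX HY; have mX := gspace_measurable HX; have mY := gspace_measurable HY.
apply: (le_integrable measurableT _ _ (integrableD measurableT
  (gspace_integrable_pow 2 HX) (gspace_integrable_pow 2 HY))).
  by apply/measurable_EFinP; exact: measurable_funM.
move=> w _ /=; rewrite lee_fin normrM [leRHS]ger0_norm ?addr_ge0 ?sqr_ge0//.
rewrite -(real_normK (num_real (X w))) -(real_normK (num_real (Y w))).
have := sqr_ge0 (`|X w| - `|Y w|); have := normr_ge0 (X w); have := normr_ge0 (Y w).
nra.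
Qed.

Lemma gspace_covDl a b X Y Z : H X -> H Y -> H Z ->
  \int[P]_w ((a * X w + b * Y w) * Z w) =
  a * \int[P]_w (X w * Z w) + b * \int[P]_w (Y w * Z w).
Proof.
move=> HX HY HZ.
have iX := gspace_integrableM HX HZ; have iY := gspace_integrableM HY HZ.
rewrite -!RintegralZl// -RintegralD//.
- by apply: eq_Rintegral => w _; ring.
- exact: integrable_EFinZ.
- exact: integrable_EFinZ.
Qed.

Lemma gspace_covC X Y : \int[P]_w (X w * Y w) = \int[P]_w (Y w * X w).
Proof. by apply: eq_Rintegral => w _; rewrite mulrC. Qed.

Lemma gspace_varD a b X Y : H X -> H Y ->
  \int[P]_w ((a * X w + b * Y w) ^+ 2) = a ^+ 2 * \int[P]_w X w ^+ 2 +
  2 * a * b * \int[P]_w (X w * Y w) + b ^+ 2 * \int[P]_w Y w ^+ 2.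
Proof.
move=> HX HY; under eq_Rintegral do rewrite expr2.
rewrite gspace_covDl//; last exact: gspaceD.
rewrite !(gspace_covC _ (fun w => a * X w + b * Y w)) !gspace_covDl//.
rewrite (gspace_covC Y X).
under [\int[P]_w X w ^+ 2]eq_Rintegral do rewrite expr2.
under [\int[P]_w Y w ^+ 2]eq_Rintegral do rewrite expr2.
by ring.
Qed.

(** A list of half-spaces, so that the intersection can be built one half-space at a time. *)
Definition below (s : seq ((T -> R) * R)) (w : T) : bool := all (fun p => p.1 w < p.2) s.

Definition orthogonal_to W (s : seq ((T -> R) * R)) :=
  {in s, forall p, H p.1 /\ \int[P]_w (p.1 w * W w) = 0}.

Lemma measurable_below W s : orthogonal_to W s ->
  measurable_fun setT (fun w => (below s w)%:R : R).
Proof.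
elim: s => [_|p s IH os]; first exact: measurable_cst.
under eq_fun do rewrite /= -mulnb natrM.
apply: measurable_funM; last by apply: IH => q qs; apply: os; rewrite inE qs orbT.
have [Hp _] := os p (mem_head _ _).
by apply: measurable_lt_indic; exact: gspace_measurable.
Qed.

Lemma integrable_below_cos W s L t : orthogonal_to W s -> measurable_fun setT L ->
  P.-integrable setT (EFin \o (fun w => (below s w)%:R * cos (L w + t))).
Proof.
move=> os mL; apply: integrable_boundedM (measurable_below os) (fun w => natr_bool_le1 _ _) _.
apply: (@integrable_bounded _ _ _ _ _ 1) => [|w]; last exact: cos_max.
by apply: measurable_fun_cos; exact: measurable_funD.
Qed.

(* The indicators of the half-spaces [Y < y] are introduced one at a time by
   [trig_indicator], so that only one-dimensional Gaussian laws are used. *)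
Lemma below_cos W s L t : H W -> orthogonal_to W s -> H L ->
  \int[P]_w (L w * W w) = 0 ->
  \int[P]_w ((below s w)%:R * cos (L w + W w + t)) =
  expR (- (\int[P]_w W w ^+ 2 / 2)) * \int[P]_w ((below s w)%:R * cos (L w + t)).
Proof.
move=> HW; elim: s L t => [|[Y y] s IH] L t os HL LW.
  under eq_Rintegral do rewrite mul1r.
  under [X in _ = _ * X]eq_Rintegral do rewrite mul1r.
  have HLW := gspaceD 1 1 HL HW.
  have := gspace_cos t HLW; under eq_Rintegral do rewrite !mul1r.
  move=> ->; rewrite gspace_cos// gspace_varD// LW mulrA -expRD.
  by congr (expR _ * _); field.
have [HY YW] := os (Y, y) (mem_head _ _); rewrite /= in HY YW.
have os' : orthogonal_to W s by move=> q qs; apply: os; rewrite inE qs orbT.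
set c := expR _ in IH *.
have mL := gspace_measurable HL; have mW := gspace_measurable HW.
have mY := gspace_measurable HY.
have i2 L' u := @integrable_below_cos W s L' u os'.
have i1 L' u (mL' : measurable_fun setT L') := i2 (fun w => L' w + W w) u (measurable_funD mL' mW).
(* The defect of the identity for the shorter list. Multiplying it by a cosine of [Y] only moves
   multiples of [Y] into [L], which stays orthogonal to [W]; for this reason [L] is arbitrary in the
   induction. *)
pose g L' u w := (below s w)%:R * cos (L' w + W w + u) + - c * ((below s w)%:R * cos (L' w + u)).
have bd (b : bool) (x : R) : `|b%:R * cos x| <= 1 by rewrite normrM mulr_ile1 ?natr_bool_le1// cos_max.
have gb L' u w : `|g L' u w| <= 1 + `|c|.
  by rewrite (le_trans (ler_normD _ _))// lerD ?bd// normrM normrN ler_piMr// bd.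
have ig L' u (mL' : measurable_fun setT L') : P.-integrable setT (EFin \o g L' u) :=
  integrable_EFinD (i1 _ u mL') (integrable_EFinZ (- c) (i2 _ u mL')).
have mg : measurable_fun setT (g L t).
  by have /integrableP[/measurable_EFinP] := ig _ t mL.
have g0 L' u : H L' -> \int[P]_w (L' w * W w) = 0 -> \int[P]_w g L' u w = 0.
  move=> HL' L'W; have mL' := gspace_measurable HL'.
  rewrite /g RintegralD//; [|exact: i1|by apply: integrable_EFinZ; exact: i2].
  by rewrite RintegralZl//; [rewrite IH// mulNr subrr|exact: i2].
have H1 : \int[P]_w (g L t w * (Y w < y)%R%:R) = 0.
  apply: (trig_indicator mg mY (gb L t)) => a u.
  have HLp := gspaceD 1 a HL HY; have HLm := gspaceD 1 (- a) HL HY.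
  transitivity (\int[P]_w (2^-1 * g (fun w => 1 * L w + a * Y w) (t + u) w +
      2^-1 * g (fun w => 1 * L w + - a * Y w) (t - u) w)).
    apply: eq_Rintegral => w _; rewrite /g !mul1r.
    rewrite (_ : L w + a * Y w + W w + (t + u) = (L w + W w + t) + (a * Y w + u)); last by ring.
    rewrite (_ : L w + - a * Y w + W w + (t - u) = (L w + W w + t) - (a * Y w + u)); last by ring.
    rewrite (_ : L w + a * Y w + (t + u) = (L w + t) + (a * Y w + u)); last by ring.
    rewrite (_ : L w + - a * Y w + (t - u) = (L w + t) - (a * Y w + u)); last by ring.
    move: (L w + W w + t) (L w + t) (a * Y w + u) => x1 x2 x3.
    by rewrite !cosB !cosD; field.
  rewrite RintegralD//; last 2 first.
  - by apply: integrable_EFinZ; apply: ig; exact: gspace_measurable.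
  - by apply: integrable_EFinZ; apply: ig; exact: gspace_measurable.
  rewrite !RintegralZl//; [|by apply: ig; exact: gspace_measurable..].
  by rewrite !g0 ?mulr0 ?addr0// gspace_covDl// LW YW !mulr0 addr0.
have j2 := integrable_below_cos t os mL.
have e1 : \int[P]_w (g L t w * (Y w < y)%R%:R) =
    \int[P]_w ((below ((Y, y) :: s) w)%:R * cos (L w + W w + t)) -
    c * \int[P]_w ((below ((Y, y) :: s) w)%:R * cos (L w + t)).
  rewrite -RintegralZl// -RintegralB//.
  - by apply: eq_Rintegral => w _; rewrite /g /= -mulnb natrM; ring.
  - exact: (integrable_below_cos t os (measurable_funD mL mW)).
  - exact: integrable_EFinZ.
by move/eqP: e1; rewrite H1 eq_sym subr_eq0 => /eqP.
Qed.

(** With [L = 0], [below_cos] says that the centered indicator of [below s] is orthogonal to all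
    cosines of [W]; [trig_indicator] replaces the cosines by a half-line. *)
Lemma below_independent W s x : H W -> orthogonal_to W s ->
  \int[P]_w ((below s w)%:R * (W w < x)%R%:R) =
  \int[P]_w (below s w)%:R * \int[P]_w (W w < x)%R%:R.
Proof.
move=> HW os; have mW := gspace_measurable HW; have mb := measurable_below os.
set p := \int[P]_w (below s w)%:R.
have ib := integrable_natr_bool P mb.
have mx := measurable_lt_indic x mW.
have ix : P.-integrable setT (EFin \o (fun w => (W w < x)%R%:R : R)).
  by apply: integrable_bounded mx _ => w; exact: natr_bool_le1.
have ibx : P.-integrable setT (EFin \o (fun w => (below s w)%:R * (W w < x)%R%:R : R)).
  exact: integrable_boundedM mb (fun w => natr_bool_le1 _ _) ix.
have : \int[P]_w (((below s w)%:R - p) * (W w < x)%R%:R) = 0.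
  apply: (@trig_indicator _ _ _ P _ W (1 + `|p|)) => //.
  - exact: measurable_funB.
  - by move=> w; rewrite (le_trans (ler_normB _ _))// lerD2r natr_bool_le1.
  move=> a t.
  have HaW := gspaceZ a HW; have H0 := gspaceZ 0 HW.
  have os' : orthogonal_to (fun w => a * W w) s.
    move=> q qs; have [Hq Wq] := os q qs; split => //.
    by rewrite gspace_covC; have := gspace_covDl a 0 HW HW Hq;
      under eq_Rintegral do rewrite mul0r addr0; move=> ->; rewrite mul0r addr0 gspace_covC Wq mulr0.
  have e1 := @below_cos _ s _ t HaW os' H0 _.
  have maW := gspace_measurable HaW.
  have ic : P.-integrable setT (EFin \o (fun w => cos (a * W w + t))).
    apply: (@integrable_bounded _ _ _ _ _ 1) => [|w]; last exact: cos_max.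
    by apply: measurable_fun_cos; exact: measurable_funD.
  under eq_Rintegral do rewrite mulrBl.
  rewrite RintegralB//; last 2 first.
  - exact: (integrable_below_cos t os maW).
  - exact: integrable_EFinZ.
  rewrite RintegralZl// gspace_cos//.
  move: e1; under eq_Rintegral do rewrite mul0r mul0r.
  rewrite Rintegral_cst// mul0r => /(_ erefl).
  under eq_Rintegral do rewrite mul0r add0r.
  move=> ->; under [X in _ * X - _]eq_Rintegral do rewrite mul0r add0r.
  by rewrite RintegralZr// mulrCA subrr.
rewrite (_ : (fun w => _) = (fun w => (below s w)%:R * (W w < x)%R%:R - p * (W w < x)%R%:R)).
  rewrite RintegralB//; last exact: integrable_EFinZ.
  by rewrite RintegralZl// => /subr0_eq.
by apply/funext => w; rewrite mulrBl.
Qed.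

End gaussian_space.

(** * From half-lines to measures and independence *)

Section half_line_uniqueness.
Context {R : realType}.

Lemma is_derive1_continuous (F : R -> R) (x df : R) :
  is_derive x (1:R) F df -> F y @[y --> x] --> F x.
Proof.
by move=> dF; apply: differentiable_continuous; apply/derivable1_diffP; case: dF.
Qed.

Lemma half_line_measure_unique (m1 m2 : {measure set (measurableTypeR R) -> \bar R}) :
  (forall x : R, m1 `]-oo, x[%classic = m2 `]-oo, x[%classic) ->
  (forall x : R, (m1 `]-oo, x[%classic < +oo)%E) ->
  forall A, measurable A -> m1 A = m2 A.
Proof.
move=> m12 m1oo A mA.
apply: (@measure_unique _ R (measurableTypeR R) (@RGenInftyO.G R) (fun k : nat => `]-oo, (k%:R : R)[%classic)) => //.
- exact: RGenInftyO.measurableE.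
- move=> _ _ [x ->] [y ->]; exists (Num.min x y).
  by apply/seteqP; split => z /=; rewrite !in_itv/= lt_min => /andP.
- by move=> i; exists i%:R.
- apply/seteqP; split => // x _.
  exists (Num.Def.truncn `|x|).+1 => //=; rewrite in_itv/= (le_lt_trans (ler_norm x))//.
  exact: truncnS_gt.
- by move=> _ [x ->].
Qed.

End half_line_uniqueness.

Section independence.
Context d (T : measurableType d) (R : realType) (P : probability T R).

(** For fixed [E] both sides are finite measures in [A] that agree on half-lines, a generating class
    stable under intersection. *)
Lemma half_line_independence (U : T -> R) (E : set T) :
  measurable_fun setT U -> measurable E ->
  (forall x, P ([set w | (U w < x)%R] `&` E) = (P [set w | (U w < x)%R] * P E)%E) ->
  forall A : set R, measurable A -> P (U @^-1` A `&` E) = (P (U @^-1` A) * P E)%E.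
Proof.
move=> mU mE indep A mA.
pose U' : T -> measurableTypeR R := U.
have mU' : measurable_fun setT U' := mU.
have PE0 : 0 <= fine (P E) by rewrite fine_ge0.
have PEfin : P E \is a fin_num by rewrite fin_num_measure.
pose m1 : {measure set (measurableTypeR R) -> \bar R} :=
  measure_function_pushforward__canonical__measure_function_Measure (mrestr P mE) mU'.
pose m2 : {measure set (measurableTypeR R) -> \bar R} := mscale (NngNum PE0)
  (measure_function_pushforward__canonical__measure_function_Measure P mU').
have m1E B : m1 B = P (U @^-1` B `&` E) by [].
have m2E B : m2 B = (P (U @^-1` B) * P E)%E by rewrite /m2 /= /mscale /= fineK// muleC.
have lt_preimage (x : R) : U @^-1` `]-oo, x[%classic = [set w | U w < x].
  by apply/seteqP; split => w /=; rewrite in_itv.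
rewrite -m1E -m2E; apply: half_line_measure_unique => // x.
  by rewrite m1E m2E lt_preimage indep.
rewrite m1E -ge0_fin_numE// fin_num_measure//; apply: measurableI => //.
by rewrite lt_preimage; exact: measurable_lt_set.
Qed.

(** Half-lines are replaced by measurable sets in one coordinate after the other; rectangles then
    determine the product measure, and Tonelli gives the iterated integral. *)
Lemma independent_joint_law (U V : T -> R) (m1 m2 : probability (measurableTypeR R) R) :
  measurable_fun setT U -> measurable_fun setT V ->
  (forall A, measurable A -> P (U @^-1` A) = m1 A) ->
  (forall A, measurable A -> P (V @^-1` A) = m2 A) ->
  (forall x y, P ([set w | (U w < x)%R] `&` [set w | (V w < y)%R]) =
     (P [set w | (U w < x)%R] * P [set w | (V w < y)%R])%E) ->
  forall f : R * R -> \bar R, measurable_fun setT f -> (forall z, 0 <= f z)%E ->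
  (\int[P]_w f (U w, V w) = \int[m2]_v \int[m1]_u f (u, v))%E.
Proof.
move=> mU mV lU lV indep f mf f0.
have rect (A B : set R) : measurable A -> measurable B ->
    P (U @^-1` A `&` V @^-1` B) = (m1 A * m2 B)%E.
  move=> mA mB; rewrite setIC -lU// -lV// muleC.
  apply: half_line_independence => //.
    by rewrite -[X in measurable X]setTI; exact: mU.
  move=> y; rewrite setIC muleC; apply: half_line_independence => //.
  exact: measurable_lt_set.
pose UV w : measurableTypeR R * measurableTypeR R := (U w, V w).
have mUV : measurable_fun setT UV by exact/measurable_fun_pair.
pose UVm : {mfun T >-> (measurableTypeR R * measurableTypeR R)%type} :=
  HB.pack UV (isMeasurableFun.Build _ _ _ _ UV mUV).
transitivity (\int[distribution P UVm]_z f z)%E.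
  by rewrite ge0_integral_distribution.
transitivity (\int[(m1 \x m2)%E]_z f z)%E; last by rewrite fubini_tonelli2.
apply: eq_measure_integral => A mA _; apply/esym.
by apply: (@product_measure_unique _ _ _ _ _ m1 m2 (distribution P UVm)) => // B C mB mC; exact: rect.
Qed.

End independence.

(** * Gaussian integrals over plane cones *)

Section gaussian_cone.
Context {R : realType}.
Local Notation mu := (@lebesgue_measure R).
Local Notation phi := (normal_pdf (0:R) 1).

Lemma normal_peak1_le : normal_peak (1:R) <= 2^-1.
Proof.
have h : (0:R) < pi *+ 2 by rewrite pmulrn_lgt0 ?pi_gt0.
rewrite /normal_peak expr1n mul1r lef_pV2 ?posrE ?sqrtr_gt0//.
rewrite -(@ler_pXn2r _ 2) ?nnegrE ?sqrtr_ge0// sqr_sqrtr ?(ltW h)//.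
by have := pi_ge2 R; rewrite -mulr_natr; lra.
Qed.

Lemma continuous_abs_gauss (a : R) :
  continuous (fun x : R => `|x| * expR (- (a * x ^+ 2 / 2))).
Proof.
move=> x; apply: cvgM; first by apply: norm_continuous.
apply: continuous_comp; last exact: continuous_expR.
apply: (@cvgN _ R^o); apply: cvgM; last exact: cvg_cst.
by apply: cvgM; [exact: cvg_cst|exact: exprn_continuous].
Qed.

Lemma integral_abs_gauss (a : R) : 0 < a ->
  (\int[mu]_x (`|x| * expR (- (a * x ^+ 2 / 2)))%:E = (2 / a)%:E)%E.
Proof.
move=> a0; pose f x := `|x| * expR (- (a * x ^+ 2 / 2)).
have cf : continuous f by exact: continuous_abs_gauss.
rewrite (@ge0_symfun_integralT _ f)//; last 2 first.
- by move=> x; rewrite mulr_ge0// expR_ge0.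
- by move=> x; rewrite /f /= normrN sqrrN.
rewrite -set_itvcy.
have dF x : is_derive x (1:R) (fun x => - a^-1 * expR (- (a * x ^+ 2 / 2)))
    (x * expR (- (a * x ^+ 2 / 2))).
  by apply: is_derive_eq; rewrite /GRing.scale/=; field; rewrite gt_eqF.
rewrite (@ge0_continuous_FTC2y _ f (fun x => - a^-1 * expR (- (a * x ^+ 2 / 2))) 0 0).
- by rewrite expr0n/= mulr0 mul0r oppr0 expR0 mulr1 -EFinB sub0r opprK -EFinM.
- by move=> x _; rewrite mulr_ge0// expR_ge0.
- exact: continuous_subspaceT.
- rewrite -(mulr0 (- a^-1)); apply: cvgM; first exact: cvg_cst.
  apply: (cvg_comp (fun x => a * x ^+ 2 / 2) (fun y => expR (- y)) _ (@cvgr_expR R)).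
  apply/cvgryPge => A; near=> x.
  have x1 : 1 <= x by near: x; exact: nbhs_pinfty_ge.
  have xA : 2 * A / a <= x by near: x; apply: nbhs_pinfty_ge; exact: num_real.
  have : 2 * A <= a * x by rewrite -ler_pdivrMl// mulrC.
  have : a * x <= a * x ^+ 2 by rewrite ler_pM2l// expr2 ler_peMl// (le_trans _ x1).
  by lra.
- by move=> x _; case: (dF x).
- apply: cvg_at_right_filter; exact: is_derive1_continuous (dF 0).
- move=> x; rewrite in_itv/= andbT => x0; rewrite derive1E.
  have -> := @derive_val _ _ _ _ _ _ _ (dF x); by rewrite /f gtr0_norm.
Unshelve. all: by end_near. Qed.

Lemma phiE x : phi x = normal_peak 1 * expR (- (x ^+ 2 / 2)).
Proof.
by rewrite normal_pdfE ?oner_neq0// /normal_fun subr0 expr1n mulNr.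
Qed.

Lemma phi_norm x : phi `|x| = phi x.
Proof. by rewrite !phiE real_normK// num_real. Qed.

(** Integration by parts: [- u phi u] has derivative [u^2 phi u - phi u]. Written as a sum of
    nonnegative terms, the identity can be integrated again over [c] in the extended reals. *)
Lemma integral_phi_sqr (c : R) : 0 <= c ->
  (\int[mu]_(u in `[(- c)%R, c]) (u ^+ 2 * phi u)%:E + (2 * c * phi c)%:E =
   \int[mu]_(u in `[(- c)%R, c]) (phi u)%:E)%E.
Proof.
rewrite le_eqVlt => /predU1P[<-|c0].
  by rewrite oppr0 set_itv1 !integral_set1 mulr0 mul0r adde0.
have cphi : continuous phi by apply: continuous_normal_pdf; exact: oner_neq0.
have n10 : (1:R) != 0 by exact: oner_neq0.
have cont1 : {within `[(- c), c], continuous (fun u => u ^+ 2 * phi u)}.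
  apply: continuous_subspaceT => x; apply: cvgM; last exact: cphi.
  exact: exprn_continuous.
have cont2 : {within `[(- c), c], continuous phi} by apply: continuous_subspaceT.
have i1 : mu.-integrable `[(- c), c] (EFin \o (fun u => u ^+ 2 * phi u)).
  by apply: continuous_compact_integrable => //; exact: segment_compact.
have i2 : mu.-integrable `[(- c), c] (EFin \o phi).
  by apply: continuous_compact_integrable => //; exact: segment_compact.
have dF x : is_derive x (1:R) (fun u => - (u * phi u)) (x ^+ 2 * phi x - phi x).
  have := normal_pdf_is_derive 0 x n10 => Hd.
  by apply: is_derive_eq; rewrite /GRing.scale/= subr0; field.
have := @continuous_FTC2 R (fun u => u ^+ 2 * phi u - phi u) (fun u => - (u * phi u)) (- c) c.
move=> /(_ _ _ _ _) FTC.
have : (\int[mu]_(u in `[(- c)%R, c]) (u ^+ 2 * phi u - phi u)%:E = (- (2 * c * phi c))%:E)%E.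
  rewrite FTC.
  - by rewrite -(phi_norm (- c)) normrN phi_norm -EFinB; congr EFin; ring.
  - by rewrite -subr_gt0 opprK addr_gt0.
  - by move=> x; apply: cvgB; [exact: cont1|exact: cont2].
  - split.
    + by move=> x _; case: (dF x).
    + apply: cvg_at_right_filter; exact: is_derive1_continuous (dF (- c)).
    + apply: cvg_at_left_filter; exact: is_derive1_continuous (dF c).
  - by move=> x _; rewrite derive1E; exact: derive_val.
under eq_integral do rewrite EFinB.
rewrite integralB//.
have f1 : (\int[mu]_(u in `[(- c)%R, c]) (u ^+ 2 * phi u)%:E)%E \is a fin_num.
  exact: integrable_fin_num.
have f2 : (\int[mu]_(u in `[(- c)%R, c]) (phi u)%:E)%E \is a fin_num.
  exact: integrable_fin_num.
rewrite -(fineK f1) -(fineK f2) /= -EFinB => -[e].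
by rewrite -EFinD; congr EFin; rewrite -(opprK (2 * c * phi c)) -e; ring.
Qed.

(** The strict and the large version both occur: with the coordinates exchanged, the complement of
    the open cone of slope [k] is the closed cone of slope [1 / k]. *)
Definition cone (b : bool) (k u v : R) : bool := `|u| < k * `|v| ?<= if b.

Lemma measurable_cone b k d (T : measurableType d) (U V : T -> R) :
  measurable_fun setT U -> measurable_fun setT V ->
  measurable_fun setT (fun w => (cone b k (U w) (V w))%:R : R).
Proof.
move=> mU mV; apply: measurable_natr_bool; rewrite /cone.
have m1 : measurable_fun setT (fun w => `|U w|) by exact: measurableT_comp.
have m2 : measurable_fun setT (fun w => k * `|V w|).
  by apply: measurable_funM => //; exact: measurableT_comp.
by case: b => /=; [exact: measurable_fun_ler|exact: measurable_fun_ltr].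
Qed.

(** The endpoints of a section are null sets, so both kinds of cone lead to the same closed
    interval. *)
Lemma integral_cone_section b k v (h : R -> R) : 0 <= k ->
  measurable_fun setT h -> (forall u, 0 <= h u) ->
  (\int[normal_prob 0 1]_u ((cone b k u v)%:R * h u)%:E =
   \int[mu]_(u in `[(- (k * `|v|))%R, (k * `|v|)%R]) (h u * phi u)%:E)%E.
Proof.
move=> k0 mh h0; set c := k * `|v|.
have c0 : 0 <= c by rewrite mulr_ge0.
have mc : measurable_fun setT (fun u : R => (cone b k u v)%:R : R).
  exact: measurable_cone.
rewrite ge0_integral_normal_prob; last 2 first.
- by apply/measurable_EFinP; exact: measurable_funM.
- by move=> u; rewrite lee_fin mulr_ge0.
have mhp : measurable_fun setT (fun u => (h u * phi u)%:E).
  by apply/measurable_EFinP; apply: measurable_funM => //; exact: measurable_normal_pdf.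
have coneE u : cone b k u v = (u \in Interval (BSide b (- c)) (BSide (~~ b) c)).
  rewrite /cone -/c /= itv_boundlr /=.
  by case: b {mc} => /=; rewrite ?ler_norml ?ltr_norml.
pose I : set R := [set` Interval (BSide b (- c)) (BSide (~~ b) c)].
transitivity (\int[mu]_(u in I) (h u * phi u)%:E)%E.
  rewrite [RHS]integral_mkcond /=; apply: eq_integral => u _.
  rewrite patchE -EFinM /I mem_setE -coneE.
  by case: cone; rewrite ?mul1r ?mul0r.
rewrite /I; case: b {mc coneE I} => //=.
rewrite integral_itv_obnd_cbnd; last exact: measurable_funTS.
by rewrite integral_itv_bndo_bndc//; exact: measurable_funTS.
Qed.

End gaussian_cone.

(** * Joint law of an orthonormal pair *)

Section gaussian_pairs.
Context d (T : measurableType d) (R : realType) (P : probability T R).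
Variable H : set (T -> R).
Hypothesis gH : centered_gaussian_space P H.
Local Notation mu := (@lebesgue_measure R).
Local Notation phi := (normal_pdf (0:R) 1).
Local Notation nu := (normal_prob (0:R) 1).
Implicit Types U V : T -> R.

Lemma gspace_standard_law U : H U -> \int[P]_w U w ^+ 2 = 1 ->
  forall A, measurable A -> P (U @^-1` A) = nu A.
Proof.
move=> HU U1; case: (gspace_law gH HU) => [[_]|[s [s0 + lawU]]].
  by rewrite U1 => /eqP; rewrite oner_eq0.
rewrite U1 => /esym/eqP; rewrite sqrf_eq1 => /orP[] /eqP s1; first by rewrite -s1.
by move: s0; rewrite s1 ltr0N1.
Qed.

Lemma Rintegral_indic_fine (A : set T) : measurable A ->
  \int[P]_w \1_A w = fine (P A).
Proof. by move=> mA; rewrite /Rintegral integral_indic// setIT. Qed.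

Lemma gspace_below_independence W s x : H W -> orthogonal_to P H W s ->
  P ([set w | below s w] `&` [set w | (W w < x)%R]) =
  (P [set w | below s w] * P [set w | (W w < x)%R])%E.
Proof.
move=> HW os; have mW := gspace_measurable gH HW.
have bE : \1_[set w | below s w] = (fun w => (below s w)%:R) :> (T -> R).
  by apply/funext => w; rewrite indicE; congr (nat_of_bool _)%:R; apply/idP/idP; rewrite inE.
have mb : measurable [set w | below s w].
  have /(_ measurableT _ (measurable_set1 1)) := measurable_below gH os.
  rewrite setTI; congr measurable; apply/seteqP; split => w /=; last by move=> ->.
  by case: below => //= /eqP; rewrite eq_sym oner_eq0.
have := below_independent gH x HW os.
have mx := measurable_lt_set x mW.
rewrite -indic_lt_setE -bE !Rintegral_indic_fine//.
rewrite (_ : \int[P]_w _ = \int[P]_w \1_([set w | below s w] `&` [set w | W w < x]) w).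
  rewrite Rintegral_indic_fine; last exact: measurableI.
  move=> e; rewrite -[LHS]fineK ?fin_num_measure//; last exact: measurableI.
  by rewrite e EFinM !fineK ?fin_num_measure.
apply: eq_Rintegral => w _; rewrite [RHS]indicE in_setI -mulnb natrM -!indicE.
by rewrite indic_lt_setE bE.
Qed.

Lemma gspace_half_space_independence U V x y : H U -> H V ->
  \int[P]_w (U w * V w) = 0 ->
  P ([set w | (U w < x)%R] `&` [set w | (V w < y)%R]) =
  (P [set w | (U w < x)%R] * P [set w | (V w < y)%R])%E.
Proof.
move=> HU HV UV.
have os : orthogonal_to P H V [:: (U, x)] by move=> p; rewrite inE => /eqP -> /=.
have e : [set w | below [:: (U, x)] w] = [set w | (U w < x)%R].
  by apply/seteqP; split => w /=; rewrite /below/= andbT.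
by have := gspace_below_independence y HV os; rewrite e.
Qed.

Lemma orthonormal_joint_law U V (f : R * R -> \bar R) : H U -> H V ->
  \int[P]_w U w ^+ 2 = 1 -> \int[P]_w V w ^+ 2 = 1 -> \int[P]_w (U w * V w) = 0 ->
  measurable_fun setT f -> (forall z, 0 <= f z)%E ->
  (\int[P]_w f (U w, V w) = \int[nu]_v \int[nu]_u f (u, v))%E.
Proof.
move=> HU HV U1 V1 UV mf f0.
apply: independent_joint_law => //.
- exact: (gspace_measurable gH).
- exact: (gspace_measurable gH).
- exact: gspace_standard_law.
- exact: gspace_standard_law.
- by move=> x y; exact: gspace_half_space_independence.
Qed.

Lemma integral_cone b k U V (h : R -> R) : 0 <= k -> H U -> H V ->
  \int[P]_w U w ^+ 2 = 1 -> \int[P]_w V w ^+ 2 = 1 -> \int[P]_w (U w * V w) = 0 ->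
  measurable_fun setT h -> (forall u, 0 <= h u) ->
  (\int[P]_w ((cone b k (U w) (V w))%:R * h (U w))%:E =
   \int[nu]_v \int[mu]_(u in `[(- (k * `|v|))%R, (k * `|v|)%R]) (h u * phi u)%:E)%E.
Proof.
move=> k0 HU HV U1 V1 UV mh h0.
rewrite (@orthonormal_joint_law U V (fun z => ((cone b k z.1 z.2)%:R * h z.1)%:E))//.
- by apply: eq_integral => v _; exact: integral_cone_section.
- apply/measurable_EFinP; apply: measurable_funM.
    by apply: measurable_cone; [exact: measurable_fst|exact: measurable_snd].
  exact: measurableT_comp.
- by move=> z; rewrite lee_fin mulr_ge0.
Qed.

End gaussian_pairs.

(** * Elementary bounds for sine and cosine *)

Section trigonometric_bounds.
Context {R : realType}.
Implicit Types x y : R.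

Lemma sin_mean_value x : 0 <= x -> exists2 c, 0 <= c <= x & sin x = cos c * x.
Proof.
move=> x0; have [c + e] := @MVT_segment R sin cos 0 x x0 (fun y _ => is_derive_sin y)
  (continuous_subspaceT (@continuous_sin R)).
by rewrite in_itv/= => cx; exists c => //; rewrite sin0 !subr0 in e.
Qed.

Lemma sin_le_norm x : `|sin x| <= `|x|.
Proof.
have pos y : 0 <= y -> `|sin y| <= y.
  move=> y0; have [c _ ->] := sin_mean_value y0.
  by rewrite normrM [ `|y|]ger0_norm// ler_piMl// cos_max.
have [x0|x0] := leP 0 x; first by rewrite (le_trans (pos _ x0))// ler_norm.
rewrite -normrN -sinN -[ `|x|]normrN (le_trans (pos _ _)) ?ler_norm//.
by rewrite oppr_ge0 ltW.
Qed.

Lemma one_minus_cos x : 1 - cos x = 2 * sin (x / 2) ^+ 2.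
Proof.
have := cos_mulr2n (x / 2).
rewrite -[x / 2 *+ 2]mulr_natr divfK// => ->.
by rewrite cos2sin2 -mulr_natr; ring.
Qed.

Lemma one_minus_cos_le x : 1 - cos x <= x ^+ 2 / 2.
Proof.
rewrite one_minus_cos.
have : sin (x / 2) ^+ 2 <= (x / 2) ^+ 2.
  by rewrite -[leLHS]real_normK ?num_real// -[leRHS]real_normK ?num_real// lerXn2r ?nnegrE// sin_le_norm.
by lra.
Qed.

(** A consequence of the mean value theorem, hence the [1/2] in place of the optimal [1/6]. *)
Lemma sin_ge_cubic x : 0 <= x -> x - x ^+ 3 / 2 <= sin x.
Proof.
move=> x0; have [c /andP[c0 cx] ->] := sin_mean_value x0.
have := one_minus_cos_le c.
have : c ^+ 2 <= x ^+ 2 by rewrite lerXn2r ?nnegrE.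
move=> h1 h2; have h3 : 1 - x ^+ 2 / 2 <= cos c by lra.
have := ler_wpM2r x0 h3.
by rewrite (_ : (1 - x ^+ 2 / 2) * x = x - x ^+ 3 / 2)//; field.
Qed.

Lemma scaled_cos_le (n : nat) x : 2 * n.+1%:R ^+ 2 * (1 - cos (n.+1%:R^-1 * x)) <= x ^+ 2.
Proof.
have n0 : 0 < n.+1%:R :> R by rewrite ltr0n.
have := one_minus_cos_le (n.+1%:R^-1 * x).
have n2 : 0 <= 2 * n.+1%:R ^+ 2 :> R by rewrite mulr_ge0// sqr_ge0.
move=> /(ler_wpM2l n2) h; apply: (le_trans h).
by rewrite le_eqVlt; apply/orP; left; apply/eqP; field; rewrite gt_eqF.
Qed.

Lemma cvg_scaled_cos x :
  2 * n.+1%:R ^+ 2 * (1 - cos (n.+1%:R^-1 * x)) @[n --> \oo] --> x ^+ 2.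
Proof.
pose y n : R := 2 * n.+1%:R * sin (`|x| / (2 * n.+1%:R)).
have cy : y n @[n --> \oo] --> `|x|.
  have h0 : `|x| - `|x| ^+ 3 / 8 * n.+1%:R^-1 @[n --> \oo] --> `|x| - `|x| ^+ 3 / 8 * 0.
    apply: cvgB; first exact: cvg_cst.
    by apply: cvgM; [exact: cvg_cst|exact: cvg_harmonic].
  rewrite mulr0 subr0 in h0.
  apply: (squeeze_cvgr _ h0 (cvg_cst _)).
  apply: nearW => n; rewrite /y.
  have n0 : 0 < 2 * n.+1%:R :> R by rewrite mulr_gt0.
  have z0 : 0 <= `|x| / (2 * n.+1%:R) by rewrite divr_ge0// ltW.
  apply/andP; split; last first.
    rewrite -ler_pdivlMl// (le_trans (ler_norm _))// (le_trans (sin_le_norm _))//.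
    by rewrite ger0_norm// mulrC.
  apply: le_trans (ler_wpM2l (ltW n0) (sin_ge_cubic z0)).
  have -> : 2 * n.+1%:R * (`|x| / (2 * n.+1%:R) - (`|x| / (2 * n.+1%:R)) ^+ 3 / 2) =
      `|x| - `|x| ^+ 3 / 8 * n.+1%:R^-1 * n.+1%:R^-1.
    by field; rewrite ?addr_ge0 ?gt_eqF ?ltr0n.
  rewrite lerD2l lerN2 ler_piMr//; last by rewrite invf_le1 ?ltr0n// ler1n.
rewrite -[x ^+ 2]real_normK ?num_real// expr2.
have : y n * y n @[n --> \oo] --> `|x| * `|x| by exact: cvgM.
apply: cvg_trans; apply: near_eq_cvg; apply: nearW => n.
rewrite one_minus_cos /y.
have -> : sin (n.+1%:R^-1 * x / 2) ^+ 2 = sin (`|x| / (2 * n.+1%:R)) ^+ 2.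
  have -> : n.+1%:R^-1 * x / 2 = x / (2 * n.+1%:R) by field; rewrite ?gt_eqF ?ltr0n.
  have [x0|x0] := leP 0 x; first by rewrite ger0_norm.
  by rewrite ltr0_norm// mulNr sinN sqrrN.
by ring.
Qed.

End trigonometric_bounds.

(** * Second moments restricted to cones and half-spaces *)

Section sign_changes.
Context d (T : measurableType d) (R : realType) (P : probability T R).
Variable H : set (T -> R).
Hypothesis gH : centered_gaussian_space P H.
Local Notation mu := (@lebesgue_measure R).
Local Notation phi := (normal_pdf (0:R) 1).
Local Notation nu := (normal_prob (0:R) 1).
Implicit Types U V W L X Y Z : T -> R.

(** These section integrals are the inner integrals of Tonelli's theorem for the indicator of a
    cone. *)
Lemma measurable_cone_section (k : R) (h : R -> R) : 0 <= k ->
  measurable_fun setT h -> (forall u, 0 <= h u) ->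
  measurable_fun setT (fun v : R =>
    (\int[mu]_(u in `[(- (k * `|v|))%R, (k * `|v|)%R]) (h u * phi u)%:E)%E).
Proof.
move=> k0 mh h0.
have := @measurable_fun_fubini_tonelli_G _ _ (measurableTypeR R) (measurableTypeR R) R nu
  (fun z => ((cone true k z.1 z.2)%:R * h z.1)%:E).
move=> /(_ _ _)/(_ _ _) mG.
have {mG} : measurable_fun setT (fun v => (\int[nu]_u ((cone true k u v)%:R * h u)%:E)%E).
  apply: mG.
    apply/measurable_EFinP; apply: measurable_funM.
      by apply: measurable_cone; [exact: measurable_fst|exact: measurable_snd].
    exact: measurableT_comp.
  by move=> z; rewrite lee_fin mulr_ge0.
by apply: eq_measurable_fun => v _; rewrite integral_cone_section.
Qed.

(** The densities at [k v] and at [v] combine into the exponent [(1 + k^2) v^2 / 2], so that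
    [integral_abs_gauss] applies; the squared peak [1 / (2 pi)] puts [pi] in the denominator. *)
Lemma integral_abs_normal_pdf (k : R) : 0 <= k ->
  (\int[nu]_v (2 * (k * `|v|) * phi (k * `|v|))%:E = (2 * k / (pi * (1 + k ^+ 2)))%:E)%E.
Proof.
move=> k0.
have mf : measurable_fun setT (fun v : R => 2 * (k * `|v|) * phi (k * `|v|)).
  have m1 : measurable_fun setT (fun v : R => k * `|v|).
    by apply: measurable_funM => //; exact: measurableT_comp.
  apply: measurable_funM; first by apply: measurable_funM.
  by apply: (measurableT_comp (measurable_normal_pdf 0 1)).
rewrite ge0_integral_normal_prob; last 2 first.
- exact/measurable_EFinP.
- by move=> v; rewrite lee_fin !mulr_ge0 ?normal_pdf_ge0.
have a0 : 0 < 1 + k ^+ 2 by rewrite ltr_wpDr ?sqr_ge0.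
transitivity (\int[mu]_v ((2 * k * normal_peak 1 ^+ 2)%:E *
    (`|v| * expR (- ((1 + k ^+ 2) * v ^+ 2 / 2)))%:E))%E.
  apply: eq_integral => v _; rewrite -!EFinM; congr EFin.
  rewrite !phiE exprMn real_normK ?num_real//.
  rewrite (_ : - ((1 + k ^+ 2) * v ^+ 2 / 2) = - (k ^+ 2 * v ^+ 2 / 2) + - (v ^+ 2 / 2)); last by field.
  by rewrite expRD; ring.
rewrite ge0_integralZl//; last 2 first.
- apply/measurable_EFinP; apply: continuous_measurable_fun; exact: continuous_abs_gauss.
- by rewrite lee_fin !mulr_ge0 ?normal_peak_ge0.
rewrite integral_abs_gauss// -EFinM; congr EFin.
have pi0 : pi != 0 :> R by rewrite gt_eqF ?pi_gt0.
have pi2 : 0 <= pi *+ 2 :> R by rewrite mulrn_wge0 ?pi_ge0.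
rewrite /normal_peak expr1n mul1r exprVn sqr_sqrtr// -[pi *+ 2]mulr_natr.
have an0 : 1 + k ^+ 2 != 0 by rewrite gt_eqF.
by move: pi pi0 pi2 => p p0 _; field; rewrite an0 p0.
Qed.

(** Integration by parts in every section [[- k |v|, k |v|]]. The boundary terms
    [2 k |v| phi (k |v|)] integrate to the constant that is subtracted. *)
Lemma Rintegral_cone_sqr b k U V : 0 <= k -> H U -> H V ->
  \int[P]_w U w ^+ 2 = 1 -> \int[P]_w V w ^+ 2 = 1 -> \int[P]_w (U w * V w) = 0 ->
  \int[P]_w ((cone b k (U w) (V w))%:R * U w ^+ 2) =
  \int[P]_w (cone b k (U w) (V w))%:R - 2 * k / (pi * (1 + k ^+ 2)).
Proof.
move=> k0 HU HV U1 V1 UV.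
have mU := gspace_measurable gH HU; have mV := gspace_measurable gH HV.
have msqr : measurable_fun setT (fun u : R => u ^+ 2) by exact: measurable_funX.
have mone : measurable_fun setT (fun u : R => 1 : R) by exact: measurable_cst.
have e : (\int[P]_w ((cone b k (U w) (V w))%:R * U w ^+ 2)%:E +
    (2 * k / (pi * (1 + k ^+ 2)))%:E = \int[P]_w ((cone b k (U w) (V w))%:R)%:E)%E.
  rewrite (integral_cone gH _ _ HU HV (h := fun u => u ^+ 2))//; last exact: sqr_ge0.
  transitivity (\int[P]_w ((cone b k (U w) (V w))%:R * 1)%:E)%E; last first.
    by under eq_integral do rewrite mulr1.
  rewrite (integral_cone gH _ _ HU HV (h := fun=> 1))//.
  rewrite -integral_abs_normal_pdf// -ge0_integralD//.
  - apply: eq_integral => v _; rewrite integral_phi_sqr ?mulr_ge0//.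
    by under [RHS]eq_integral do rewrite mul1r.
  - by move=> v _; apply: integral_ge0 => u _; rewrite lee_fin mulr_ge0 ?sqr_ge0 ?normal_pdf_ge0.
  - apply: measurable_cone_section => //; exact: sqr_ge0.
  - by move=> v _; rewrite lee_fin !mulr_ge0 ?normal_pdf_ge0.
  - apply/measurable_EFinP.
    have m1 : measurable_fun setT (fun v : R => k * `|v|).
      by apply: measurable_funM => //; exact: measurableT_comp.
    apply: measurable_funM; first by apply: measurable_funM.
    by apply: (measurableT_comp (measurable_normal_pdf 0 1)).
have i0 := integrable_natr_bool P (measurable_cone b k mU mV).
have i2 : P.-integrable setT (EFin \o (fun w => (cone b k (U w) (V w))%:R * U w ^+ 2 : R)).
  apply: (@integrable_boundedM _ _ _ _ _ _ 1); first exact: measurable_cone.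
    by move=> w; exact: natr_bool_le1.
  exact: (gspace_integrable_pow gH).
have f2 : (\int[P]_w ((cone b k (U w) (V w))%:R * U w ^+ 2)%:E)%E \is a fin_num.
  exact: integrable_fin_num.
have := congr1 fine e; rewrite fineD// => e'.
by apply/eqP; rewrite eq_sym subr_eq eq_sym; apply/eqP; exact: e'.
Qed.

(** A section has length [2 k |v|], the density is at most [1/2], and [E |V| <= 1]. *)
Lemma Rintegral_cone_le b k U V : 0 <= k -> H U -> H V ->
  \int[P]_w U w ^+ 2 = 1 -> \int[P]_w V w ^+ 2 = 1 -> \int[P]_w (U w * V w) = 0 ->
  \int[P]_w (cone b k (U w) (V w))%:R <= k.
Proof.
move=> k0 HU HV U1 V1 UV.
have mU := gspace_measurable gH HU; have mV := gspace_measurable gH HV.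
have mone : measurable_fun setT (fun u : R => 1 : R) by exact: measurable_cst.
have i0 := integrable_natr_bool P (measurable_cone b k mU mV).
rewrite -lee_fin fineK; last exact: integrable_fin_num i0.
under eq_integral do rewrite -[X in X%:E]mulr1.
rewrite (integral_cone gH _ _ HU HV (h := fun=> 1))//.
apply: (@le_trans _ _ (\int[nu]_v (k * `|v|)%:E)%E).
  apply: ge0_le_integral => //.
  - by move=> v _; apply: integral_ge0 => u _; rewrite lee_fin mulr_ge0 ?normal_pdf_ge0.
  - exact: measurable_cone_section.
  - by apply/measurable_EFinP; apply: measurable_funM => //; exact: measurableT_comp.
  move=> v _; have c0 : 0 <= k * `|v| by rewrite mulr_ge0.
  apply: (@le_trans _ _ (\int[mu]_(u in `[(- (k * `|v|))%R, (k * `|v|)%R]) (2^-1)%:E)%E).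
    apply: ge0_le_integral => //.
    - by move=> u _; rewrite lee_fin mulr_ge0 ?normal_pdf_ge0.
    - apply/measurable_EFinP; apply: measurable_funM => //.
      by apply: measurable_funTS; exact: measurable_normal_pdf.
    - by move=> u _; rewrite lee_fin mul1r (le_trans _ normal_peak1_le)// normal_pdf_ub.
  rewrite integral_cst//= lebesgue_measure_itv/=; case: ifPn => _.
    by rewrite -EFinD -EFinM lee_fin; lra.
  by rewrite mule0 lee_fin.
rewrite ge0_integral_normal_prob; last 2 first.
- by apply/measurable_EFinP; apply: measurable_funM => //; exact: measurableT_comp.
- by move=> v; rewrite lee_fin mulr_ge0.
have -> : (\int[mu]_v ((k * `|v|)%:E * (phi v)%:E) =
    \int[mu]_v ((k * normal_peak 1)%:E * (`|v| * expR (- (1 * v ^+ 2 / 2)))%:E))%E.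
  by apply: eq_integral => v _; rewrite -!EFinM phiE mul1r; congr EFin; ring.
rewrite ge0_integralZl//; last 2 first.
- apply/measurable_EFinP; apply: continuous_measurable_fun; exact: continuous_abs_gauss.
- by rewrite lee_fin mulr_ge0 ?normal_peak_ge0.
rewrite integral_abs_gauss// -EFinM lee_fin divr1 -mulrA ler_piMr//.
by have := @normal_peak1_le R; lra.
Qed.

(** The law of [(U, V)] is invariant under [U -> - U], which preserves the cone and reverses the
    sign of [U V]. As [orthonormal_joint_law] concerns nonnegative functions, the symmetry is
    applied to the positive part of [U V]. *)
Lemma Rintegral_cone_cross b k U V : 0 <= k -> H U -> H V ->
  \int[P]_w U w ^+ 2 = 1 -> \int[P]_w V w ^+ 2 = 1 -> \int[P]_w (U w * V w) = 0 ->
  \int[P]_w ((cone b k (U w) (V w))%:R * (U w * V w)) = 0.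
Proof.
move=> k0 HU HV U1 V1 UV.
have mU := gspace_measurable gH HU; have mV := gspace_measurable gH HV.
have HN := gspaceZ gH (-1) HU.
have N1 : \int[P]_w (-1 * U w) ^+ 2 = 1.
  by rewrite -[RHS]U1; apply: eq_Rintegral => w _; rewrite mulN1r sqrrN.
have NV : \int[P]_w (-1 * U w * V w) = 0.
  transitivity (\int[P]_w (-1 * (U w * V w))).
    by apply: eq_Rintegral => w _; rewrite mulrA.
  by rewrite RintegralZl ?UV ?mulr0//; exact: (gspace_integrableM gH).
pose f (z : R * R) := (cone b k z.1 z.2)%:R * Num.max (z.1 * z.2) 0.
have mf : measurable_fun setT (fun z => (f z)%:E).
  apply/measurable_EFinP; apply: measurable_funM.
    by apply: measurable_cone; [exact: measurable_fst|exact: measurable_snd].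
  apply: measurable_maxr => //; apply: measurable_funM; [exact: measurable_fst|exact: measurable_snd].
have f0 z : (0 <= (f z)%:E)%E by rewrite lee_fin mulr_ge0// le_max lexx orbT.
have e : (\int[P]_w (f (U w, V w))%:E = \int[P]_w (f (-1 * U w, V w))%:E)%E.
  rewrite (orthonormal_joint_law gH HU HV U1 V1 UV mf f0).
  by rewrite (orthonormal_joint_law gH HN HV N1 V1 NV mf f0).
have ifU U' : H U' -> P.-integrable setT (EFin \o (fun w => f (U' w, V w))).
  move=> HU'; have mU' := gspace_measurable gH HU'.
  apply: (le_integrable measurableT _ _ (gspace_integrableM gH HU' HV)).
    apply/measurable_EFinP; apply: measurable_funM; first exact: measurable_cone.
    by apply: measurable_maxr => //; exact: measurable_funM.
  move=> w _ /=; rewrite lee_fin /f /= normrM.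
  rewrite (le_trans (ler_piMl _ (natr_bool_le1 _ _)))//.
  by rewrite /Num.max; case: ifP => _; rewrite ?normr0.
have -> : \int[P]_w ((cone b k (U w) (V w))%:R * (U w * V w)) =
    \int[P]_w (f (U w, V w) - f (-1 * U w, V w)).
  apply: eq_Rintegral => w _; rewrite /f /= mulN1r mulNr.
  rewrite /cone normrN -mulrBr; congr (_ * _).
  rewrite /Num.max; move: (U w * V w) => x.
  by case: ltP => ?; case: ltP => ?; lra.
rewrite RintegralB//; [|exact: ifU|exact: (ifU _ HN)].
by rewrite /Rintegral e subrr.
Qed.

(* [n^2 (2 - 2 cos (Z / n))] tends to [Z^2] and is bounded by it. *)
Lemma cvg_cos_second_moment (g Z : T -> R) (M : R) :
  measurable_fun setT g -> (forall w, `|g w| <= M) -> H Z ->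
  2 * n.+1%:R ^+ 2 * (\int[P]_w g w - \int[P]_w (g w * cos (n.+1%:R^-1 * Z w)))
    @[n --> \oo] --> \int[P]_w (g w * Z w ^+ 2).
Proof.
move=> mg gM HZ; have mZ := gspace_measurable gH HZ.
have iZ := gspace_integrable_pow gH 2 HZ.
have M0 : 0 <= M.
  suff [w] : exists w : T, True by move=> _; exact: le_trans (gM w).
  apply: contrapT => nT; have := @probability_setT _ _ _ P.
  rewrite (_ : setT = set0); last by apply/seteqP; split => // w; case: nT; exists w.
  by rewrite measure0 => /esym/eqP; rewrite onee_eq0.
have ig : P.-integrable setT (EFin \o g) by exact: integrable_bounded mg gM.
have mc n : measurable_fun setT (fun w => cos (n.+1%:R^-1 * Z w)).
  by apply: measurable_fun_cos; exact: measurable_funM.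
have igc n : P.-integrable setT (EFin \o (fun w => g w * cos (n.+1%:R^-1 * Z w))).
  apply: (@integrable_bounded _ _ _ _ _ (M * 1)); first exact: measurable_funM.
  by move=> w; rewrite normrM ler_pM// cos_max.
pose f_ n w := g w * (2 * n.+1%:R ^+ 2 * (1 - cos (n.+1%:R^-1 * Z w))).
have mf n : measurable_fun setT (f_ n).
  by apply: measurable_funM => //; apply: measurable_funM => //; exact: measurable_funB.
have : \int[P]_w f_ n w @[n --> \oo] --> \int[P]_w (g w * Z w ^+ 2).
  apply: (@Rintegral_dominated_cvg _ _ _ _ _ _ (fun w => M * Z w ^+ 2)) => //.
  - by move=> w; apply: cvgM; [exact: cvg_cst|exact: cvg_scaled_cos].
  - exact: integrable_EFinZ.
  - move=> n w; rewrite normrM ler_pM// ger0_norm ?scaled_cos_le//.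
apply: cvg_trans; apply: near_eq_cvg; apply: nearW => n.
rewrite -RintegralB// -RintegralZl//.
  by apply: eq_Rintegral => w _; rewrite /f_; ring.
have := integrableB measurableT ig (igc n).
by apply: eq_integrable => // w _ /=.
Qed.

(** Second-order expansion of [below_cos] at the small frequencies [1 / (n + 1)]. In effect [W] is
    independent of [L] and of the event together, so the cross term vanishes and [W^2] factors
    out. *)
Lemma below_second_moment W s L : H W -> orthogonal_to P H W s -> H L ->
  \int[P]_w (L w * W w) = 0 ->
  \int[P]_w ((below s w)%:R * (L w + W w) ^+ 2) =
  \int[P]_w ((below s w)%:R * L w ^+ 2) +
  \int[P]_w W w ^+ 2 * \int[P]_w (below s w)%:R.
Proof.
move=> HW os HL LW.
have mb := measurable_below gH os.
have b1 w : `|(below s w)%:R : R| <= 1 by exact: natr_bool_le1.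
have HLW : H (fun w => L w + W w).
  have := gspaceD gH 1 1 HL HW; congr H; apply/funext => w; by rewrite !mul1r.
have cLW := cvg_cos_second_moment mb b1 HLW.
have cL := cvg_cos_second_moment mb b1 HL.
set v := \int[P]_w W w ^+ 2; set p := \int[P]_w (below s w)%:R in cLW cL *.
have v0 : 0 <= v by apply: Rintegral_ge0 => w _; exact: sqr_ge0.
pose e n := expR (- (n.+1%:R^-1 ^+ 2 * v / 2)).
have E n : \int[P]_w ((below s w)%:R * cos (n.+1%:R^-1 * (L w + W w))) =
    e n * \int[P]_w ((below s w)%:R * cos (n.+1%:R^-1 * L w)).
  have HnW := gspaceZ gH n.+1%:R^-1 HW; have HnL := gspaceZ gH n.+1%:R^-1 HL.
  have WZ Y : H Y -> \int[P]_w (Y w * W w) = 0 ->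
      forall c c', \int[P]_w ((c * Y w) * (c' * W w)) = 0.
    move=> HY YW c c'; transitivity (\int[P]_w (c * c' * (Y w * W w))).
      by apply: eq_Rintegral => w _; ring.
    by rewrite RintegralZl ?YW ?mulr0//; exact: (gspace_integrableM gH).
  have os' : orthogonal_to P H (fun w => n.+1%:R^-1 * W w) s.
    move=> q qs; have [Hq qW] := os q qs; split => //.
    by have := WZ _ Hq qW 1 n.+1%:R^-1; under eq_Rintegral do rewrite mul1r.
  have := below_cos gH 0 HnW os' HnL (WZ _ HL LW _ _).
  have -> : \int[P]_w (n.+1%:R^-1 * W w) ^+ 2 = n.+1%:R^-1 ^+ 2 * v.
    rewrite -RintegralZl//; last exact: (gspace_integrable_pow gH).
    by apply: eq_Rintegral => w _; rewrite exprMn.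
  move=> h; transitivity (\int[P]_w ((below s w)%:R * cos (n.+1%:R^-1 * L w + n.+1%:R^-1 * W w + 0))).
    by apply: eq_Rintegral => w _; rewrite addr0 mulrDr.
  rewrite h; congr (_ * _).
  by apply: eq_Rintegral => w _; rewrite addr0.
pose y n : R := n.+1%:R^-1 ^+ 2 * v / 2.
have y0 n : 0 <= y n by rewrite divr_ge0// mulr_ge0// sqr_ge0.
have cy : y n @[n --> \oo] --> (0:R).
  rewrite (_ : 0 = 0 * 0 * v / 2 :> R); last by rewrite !mul0r.
  under eq_fun do rewrite /y expr2.
  by do 2 (apply: cvgM; last exact: cvg_cst); apply: cvgM; exact: cvg_harmonic.
have e_le1 n : e n <= 1 by rewrite /e -[leRHS]expR0 ler_expR oppr_le0 y0.
have e1 : e n @[n --> \oo] --> (1:R).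
  have h1 : 1 - y n @[n --> \oo] --> (1:R).
    by rewrite -[X in _ --> X]subr0; apply: cvgB => //; exact: cvg_cst.
  apply: (squeeze_cvgr _ h1 (cvg_cst _)); apply: nearW => n.
  by rewrite e_le1 andbT; exact: expR_ge1Dx.
have yv n : 2 * n.+1%:R ^+ 2 * y n = v by rewrite /y; field; rewrite ?gt_eqF ?ltr0n.
have ev : 2 * n.+1%:R ^+ 2 * (1 - e n) @[n --> \oo] --> v.
  have h1 : v * e n @[n --> \oo] --> v.
    by rewrite -[X in _ --> X]mulr1; apply: cvgM => //; exact: cvg_cst.
  apply: (squeeze_cvgr _ h1 (cvg_cst _)); apply: nearW => n.
  have n2 : 0 <= 2 * n.+1%:R ^+ 2 :> R by rewrite mulr_ge0// sqr_ge0.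
  apply/andP; split.
    have : (1 + y n) * e n <= 1.
      by rewrite /e expRN ler_pdivrMr ?expR_gt0// mul1r expR_ge1Dx.
    move=> h; have /(ler_wpM2l n2) : y n * e n <= 1 - e n by lra.
    by rewrite mulrA yv.
  rewrite -[leRHS](yv n) ler_wpM2l// lerBlDr -lerBlDl.
  exact: expR_ge1Dx.
rewrite -(cvg_lim _ cLW)//; apply/cvg_lim => //.
rewrite addrC -[X in _ + X]mul1r.
(* Writes [p - e I] as [(1 - e) p + e (p - I)], where [I] is the integral with [L] alone. *)
have : 2 * n.+1%:R ^+ 2 * (1 - e n) * p + e n * (2 * n.+1%:R ^+ 2 *
    (p - \int[P]_w ((below s w)%:R * cos (n.+1%:R^-1 * L w)))) @[n --> \oo] -->
    v * p + 1 * \int[P]_w ((below s w)%:R * L w ^+ 2).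
  by apply: cvgD; apply: cvgM => //; exact: cvg_cst.
by apply: cvg_trans; apply: near_eq_cvg; apply: nearW => n; rewrite E; ring.
Qed.

End sign_changes.

(** * Covariance of a sign change with a square *)

Section sign_change_covariance.
Context d (T : measurableType d) (R : realType) (P : probability T R).
Variable H : set (T -> R).
Hypothesis gH : centered_gaussian_space P H.
Variables X Y : T -> R.
Hypotheses (HX : H X) (HY : H Y).
Hypotheses (X1 : \int[P]_w X w ^+ 2 = 1) (Y1 : \int[P]_w Y w ^+ 2 = 1).
Let r := \int[P]_w (X w * Y w).
Hypothesis r1 : `|r| < 1.

(** The norms of [X + Y] and [X - Y]. Thus [U], [V] form an orthonormal basis of the plane of [X]
    and [Y], and since [4 X Y = (al U)^2 - (be V)^2] the event [X Y < 0] is a cone of slope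
    [be / al]. *)
Let al := Num.sqrt (2 * (1 + r)).
Let be := Num.sqrt (2 * (1 - r)).
Let U w : R := al^-1 * X w + al^-1 * Y w.
Let V w : R := be^-1 * X w + - be^-1 * Y w.

Let rp : 0 < 1 + r.
Proof. by move: r1; rewrite ltr_norml => /andP[? ?]; lra. Qed.

Let rm : 0 < 1 - r.
Proof. by move: r1; rewrite ltr_norml => /andP[? ?]; lra. Qed.

Let al2 : al ^+ 2 = 2 * (1 + r).
Proof. by rewrite sqr_sqrtr// mulr_ge0// ltW. Qed.

Let be2 : be ^+ 2 = 2 * (1 - r).
Proof. by rewrite sqr_sqrtr// mulr_ge0// ltW. Qed.

Let al0 : 0 < al.
Proof. by rewrite sqrtr_gt0 mulr_gt0. Qed.

Let be0 : 0 < be.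
Proof. by rewrite sqrtr_gt0 mulr_gt0. Qed.

Let HU : H U. Proof. exact: (gspaceD gH). Qed.
Let HV : H V. Proof. exact: (gspaceD gH). Qed.

Let covU W : H W -> \int[P]_w (U w * W w) =
  al^-1 * \int[P]_w (X w * W w) + al^-1 * \int[P]_w (Y w * W w).
Proof. by move=> HW; exact: (gspace_covDl gH). Qed.

Let covV W : H W -> \int[P]_w (V w * W w) =
  be^-1 * \int[P]_w (X w * W w) + - be^-1 * \int[P]_w (Y w * W w).
Proof. by move=> HW; exact: (gspace_covDl gH). Qed.

Let sqE W : \int[P]_w (W w * W w) = \int[P]_w W w ^+ 2.
Proof. by apply: eq_Rintegral => w _; rewrite expr2. Qed.

Let U1 : \int[P]_w U w ^+ 2 = 1.
Proof.
rewrite (gspace_varD gH)// X1 Y1 -/r.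
have e : al^-1 ^+ 2 * al ^+ 2 = 1 by rewrite -exprMn mulVf ?expr1n// gt_eqF.
by rewrite al2 in e; rewrite -[RHS]e; ring.
Qed.

Let V1 : \int[P]_w V w ^+ 2 = 1.
Proof.
rewrite (gspace_varD gH)// X1 Y1 -/r.
have e : be^-1 ^+ 2 * be ^+ 2 = 1 by rewrite -exprMn mulVf ?expr1n// gt_eqF.
by rewrite be2 in e; rewrite -[RHS]e; ring.
Qed.

Let covX W : H W -> \int[P]_w (X w * W w) =
  al / 2 * \int[P]_w (U w * W w) + be / 2 * \int[P]_w (V w * W w).
Proof.
move=> HW; rewrite covU// covV//.
by field; rewrite !gt_eqF.
Qed.

Let covY W : H W -> \int[P]_w (Y w * W w) =
  al / 2 * \int[P]_w (U w * W w) - be / 2 * \int[P]_w (V w * W w).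
Proof.
move=> HW; rewrite covU// covV//.
by field; rewrite !gt_eqF.
Qed.

Let UV : \int[P]_w (U w * V w) = 0.
Proof.
rewrite covU// [\int[P]_w (X w * V w)]gspace_covC [\int[P]_w (Y w * V w)]gspace_covC.
rewrite !covV// [\int[P]_w (Y w * X w)]gspace_covC !sqE X1 Y1.
by ring.
Qed.

Let sign_changeE w : (X w * Y w < 0) = cone false (be / al) (U w) (V w).
Proof.
have -> : X w * Y w = ((al * U w) ^+ 2 - (be * V w) ^+ 2) / 4.
  by rewrite /U /V; field; rewrite !gt_eqF.
rewrite pmulr_llt0 ?invr_gt0// subr_lt0 /cone/=.
rewrite -[(al * _) ^+ 2]real_normK ?num_real// -[(be * _) ^+ 2]real_normK ?num_real// ltr_pXn2r ?nnegrE//.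
by rewrite !normrM (gtr0_norm al0) (gtr0_norm be0) [be / al * _]mulrAC ltr_pdivlMr// mulrC.
Qed.

(** The exact probability is [arccos r / pi]; a bound linear in the slope of the cone already has
    the right order in the mesh. *)
Lemma sign_change_prob_le :
  \int[P]_w (X w * Y w < 0)%R%:R <= Num.sqrt ((1 - r) / (1 + r)).
Proof.
under eq_Rintegral do rewrite sign_changeE.
have -> : Num.sqrt ((1 - r) / (1 + r)) = be / al.
  apply/eqP; rewrite -(@eqrXn2 _ 2) ?sqrtr_ge0 ?divr_ge0 ?ltW//.
  rewrite sqr_sqrtr; last by rewrite divr_ge0// ltW.
  rewrite exprMn exprVn al2 be2 -mulf_div divff ?mul1r//.
by apply: (Rintegral_cone_le gH) => //; rewrite divr_ge0 ?ltW.
Qed.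

Lemma sign_change_cov Z : H Z ->
  \int[P]_w ((X w * Y w < 0)%R%:R * Z w ^+ 2) =
  \int[P]_w (X w * Y w < 0)%R%:R * \int[P]_w Z w ^+ 2 -
  (2 * \int[P]_w (X w * Z w) * \int[P]_w (Y w * Z w) -
   r * ((\int[P]_w (X w * Z w)) ^+ 2 + (\int[P]_w (Y w * Z w)) ^+ 2)) /
  (pi * Num.sqrt (1 - r ^+ 2)).
Proof.
move=> HZ; set c1 := \int[P]_w (X w * Z w); set c2 := \int[P]_w (Y w * Z w).
pose a := al^-1 * c1 + al^-1 * c2; pose b := be^-1 * c1 + - be^-1 * c2.
have UZ : \int[P]_w (U w * Z w) = a by rewrite covU.
have VZ : \int[P]_w (V w * Z w) = b by rewrite covV.
pose L w : R := a * U w + b * V w; pose W w : R := 1 * Z w + (-1) * L w.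
have HL : H L by exact: (gspaceD gH).
have HW : H W by exact: (gspaceD gH).
have covL K : H K -> \int[P]_w (L w * K w) = a * \int[P]_w (U w * K w) + b * \int[P]_w (V w * K w).
  by move=> HK; exact: (gspace_covDl gH).
have covW K : H K -> \int[P]_w (K w * W w) = \int[P]_w (K w * Z w) - \int[P]_w (L w * K w).
  move=> HK; rewrite gspace_covC [\int[P]_w (K w * Z w)]gspace_covC -[X in X - _]mul1r -mulN1r.
  exact: (gspace_covDl gH).
have LU : \int[P]_w (L w * U w) = a by rewrite covL// sqE U1 gspace_covC UV mulr1 mulr0 addr0.
have LV : \int[P]_w (L w * V w) = b by rewrite covL// sqE V1 UV mulr1 mulr0 add0r.
have UW : \int[P]_w (U w * W w) = 0 by rewrite covW// UZ LU subrr.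
have VW : \int[P]_w (V w * W w) = 0 by rewrite covW// VZ LV subrr.
have LW : \int[P]_w (L w * W w) = 0 by rewrite covL// UW VW !mulr0 addr0.
have L2 : \int[P]_w L w ^+ 2 = a ^+ 2 + b ^+ 2.
  by rewrite -sqE covL// gspace_covC LU gspace_covC LV !expr2.
have W2 : \int[P]_w W w ^+ 2 = \int[P]_w Z w ^+ 2 - (a ^+ 2 + b ^+ 2).
  rewrite -sqE covW// gspace_covC covW// sqE LW subr0 covL// UZ VZ.
  by rewrite !expr2.
have XW : \int[P]_w (X w * W w) = 0 by rewrite covX// UW VW !mulr0 addr0.
have YW : \int[P]_w (Y w * W w) = 0 by rewrite covY// UW VW !mulr0 subr0.
have XNW : \int[P]_w ((-1 * X w) * W w) = 0.
  by under eq_Rintegral do rewrite -mulrA; rewrite RintegralZl ?XW ?mulr0//; exact: (gspace_integrableM gH).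
have YNW : \int[P]_w ((-1 * Y w) * W w) = 0.
  by under eq_Rintegral do rewrite -mulrA; rewrite RintegralZl ?YW ?mulr0//; exact: (gspace_integrableM gH).
have HNX := gspaceZ gH (-1) HX; have HNY := gspaceZ gH (-1) HY.
pose s1 := [:: (X, 0 : R); ((fun w => -1 * Y w), 0)].
pose s2 := [:: ((fun w => -1 * X w), 0 : R); (Y, 0)].
have os1 : orthogonal_to P H W s1.
  by move=> q; rewrite !inE => /orP[]/eqP ->.
have os2 : orthogonal_to P H W s2.
  by move=> q; rewrite !inE => /orP[]/eqP ->.
(* The event is the disjoint union of two open quadrants, each an intersection of two half-spaces,
   as [below_second_moment] requires. *)
have sE w : (X w * Y w < 0)%R%:R = (below s1 w)%:R + (below s2 w)%:R :> R.
  rewrite /below /= !andbT !mulN1r !oppr_lt0.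
  have [Xn|Xp|X0] := ltgtP (X w) 0.
  - by rewrite nmulr_rlt0// addr0.
  - by rewrite pmulr_rlt0// add0r.
  - by rewrite X0 mul0r ltxx addr0.
have mb1 := measurable_below gH os1; have mb2 := measurable_below gH os2.
have ib s : orthogonal_to P H W s -> P.-integrable setT (EFin \o (fun w => (below s w)%:R : R)).
  by move=> os; apply: integrable_bounded (measurable_below gH os) _ => w; exact: natr_bool_le1.
have iK (g : T -> bool) K (mg : measurable_fun setT (fun w => (g w)%:R : R)) :=
  @integrable_boundedM _ _ _ P _ K 1 mg (fun w => natr_bool_le1 _ (g w)).
have iL2 := gspace_integrable_pow gH 2 HL.
have iZ2 := gspace_integrable_pow gH 2 HZ.
set p := \int[P]_w (X w * Y w < 0)%R%:R.
have pE : p = \int[P]_w (below s1 w)%:R + \int[P]_w (below s2 w)%:R.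
  by rewrite /p -RintegralD//; [apply: eq_Rintegral => w _; rewrite sE|exact: ib|exact: ib].
have ZLW w : Z w = L w + W w by rewrite /W; ring.
have -> : \int[P]_w ((X w * Y w < 0)%R%:R * Z w ^+ 2) =
    \int[P]_w ((X w * Y w < 0)%R%:R * L w ^+ 2) + \int[P]_w W w ^+ 2 * p.
  transitivity (\int[P]_w ((below s1 w)%:R * (L w + W w) ^+ 2) +
      \int[P]_w ((below s2 w)%:R * (L w + W w) ^+ 2)).
    rewrite -RintegralD//.
    + by apply: eq_Rintegral => w _; rewrite sE -ZLW mulrDl.
    + by under eq_fun do rewrite -ZLW; exact: iK.
    + by under eq_fun do rewrite -ZLW; exact: iK.
  rewrite (below_second_moment gH HW os1 HL LW) (below_second_moment gH HW os2 HL LW) pE.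
  have -> : \int[P]_w ((X w * Y w < 0)%R%:R * L w ^+ 2) =
     \int[P]_w ((below s1 w)%:R * L w ^+ 2) + \int[P]_w ((below s2 w)%:R * L w ^+ 2).
    rewrite -RintegralD//; [|exact: iK|exact: iK].
    by apply: eq_Rintegral => w _; rewrite sE mulrDl.
  by ring.
pose k := be / al.
have k0 : 0 < k by rewrite divr_gt0.
pose rho := 2 * k / (pi * (1 + k ^+ 2)).
pose cw w : R := (cone false k (U w) (V w))%:R.
have mU := gspace_measurable gH HU; have mV := gspace_measurable gH HV.
have mcw : measurable_fun setT cw by exact: measurable_cone.
have pcw : p = \int[P]_w cw w by apply: eq_Rintegral => w _; rewrite sign_changeE.
have IU : \int[P]_w (cw w * U w ^+ 2) = p - rho.
  by rewrite pcw (Rintegral_cone_sqr gH) ?ltW.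
have coneC w : (cone true k^-1 (V w) (U w))%:R = 1 - cw w :> R.
  rewrite /cw /cone /=.
  have -> : (`|V w| <= k^-1 * `|U w|) = ~~ (`|U w| < k * `|V w|).
    by rewrite -leNgt ler_pdivlMl.
  by case: (_ < _); rewrite ?subrr ?subr0.
have ic : P.-integrable setT (EFin \o cw) by apply: integrable_bounded mcw _ => w; exact: natr_bool_le1.
have iU2 := gspace_integrable_pow gH 2 HU.
have iV2 := gspace_integrable_pow gH 2 HV.
have i1 : P.-integrable setT (EFin \o (fun=> 1 : R)).
  by apply: (@integrable_bounded _ _ _ _ _ 1) => // w; rewrite normr1.
(* Apply the formula for [U] to the complementary cone, with [U] and [V] exchanged and slope
   [1 / k]; [rho] is unchanged under [k -> 1 / k]. *)
have IV : \int[P]_w (cw w * V w ^+ 2) = p + rho.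
  have := @Rintegral_cone_sqr _ _ _ _ _ gH true k^-1 _ _ _ HV HU V1 U1.
  rewrite gspace_covC invr_ge0 ltW// => /(_ isT UV).
  under eq_Rintegral do rewrite coneC mulrBl mul1r.
  under [X in _ = X - _ -> _]eq_Rintegral do rewrite coneC.
  rewrite !RintegralB//; last exact: iK.
  have -> : \int[P]_(_ in [set: T]) 1 = 1 :> R by rewrite Rintegral_cst//= probability_setT mulr1.
  rewrite V1 -pcw.
  have -> : 2 * k^-1 / (pi * (1 + k^-1 ^+ 2)) = rho.
    have pi0 : pi != 0 :> R by rewrite gt_eqF ?pi_gt0.
    have kk : 1 + k ^+ 2 != 0 by rewrite gt_eqF// ltr_wpDr ?sqr_ge0.
    have kn : k != 0 by rewrite gt_eqF.
    rewrite /rho; move: pi pi0 => q q0; field.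
    by rewrite kk kn q0.
  by lra.
have IUV : \int[P]_w (cw w * (U w * V w)) = 0 by rewrite (Rintegral_cone_cross gH) ?ltW.
have -> : \int[P]_w ((X w * Y w < 0)%R%:R * L w ^+ 2) =
    p * (a ^+ 2 + b ^+ 2) + rho * (b ^+ 2 - a ^+ 2).
  transitivity (\int[P]_w (a ^+ 2 * (cw w * U w ^+ 2) + 2 * a * b * (cw w * (U w * V w)) +
       b ^+ 2 * (cw w * V w ^+ 2))).
    by apply: eq_Rintegral => w _; rewrite sign_changeE -/cw /L; ring.
  have iUV := gspace_integrableM gH HU HV.
  rewrite RintegralD//; last 2 first.
  - by apply: integrable_EFinD; apply: integrable_EFinZ; exact: iK.
  - by apply: integrable_EFinZ; exact: iK.
  rewrite RintegralD//; [|by apply: integrable_EFinZ; exact: iK|by apply: integrable_EFinZ; exact: iK].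
  rewrite !RintegralZl//; [|exact: iK|exact: iK|exact: iK].
  by rewrite IU IV IUV; ring.
rewrite W2.
have rr : 0 < 1 - r ^+ 2.
  by rewrite subr_gt0 -[r ^+ 2]real_normK ?num_real// expr_lt1.
have sE2 : Num.sqrt (1 - r ^+ 2) = al * be / 2.
  apply/eqP; rewrite -(@eqrXn2 _ 2) ?sqrtr_ge0 ?divr_ge0 ?mulr_ge0 ?ltW//.
  rewrite sqr_sqrtr ?ltW// !exprMn al2 be2; by apply/eqP; field.
have pi0 : pi != 0 :> R by rewrite gt_eqF ?pi_gt0.
have an0 : al != 0 by rewrite gt_eqF.
have bn0 : be != 0 by rewrite gt_eqF.
have rhoE : rho = al * be / (2 * pi).
  have e : 1 + k ^+ 2 = 4 / al ^+ 2.
    rewrite /k exprMn exprVn be2 al2; field.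
    by rewrite gt_eqF.
  rewrite /rho e /k.
  move: pi pi0 => q q0; move: (al) (be) an0 => A B A0.
  by field; rewrite q0 A0.
have -> : b ^+ 2 - a ^+ 2 = - 4 * (2 * c1 * c2 - r * (c1 ^+ 2 + c2 ^+ 2)) / (al ^+ 2 * be ^+ 2).
  have -> : b ^+ 2 - a ^+ 2 = (al ^+ 2 * (c1 - c2) ^+ 2 - be ^+ 2 * (c1 + c2) ^+ 2) / (al ^+ 2 * be ^+ 2).
    by rewrite /a /b; field; rewrite an0 bn0.
  by congr (_ / _); rewrite al2 be2; ring.
rewrite rhoE sE2.
move: pi pi0 => q q0.
by move: (al) (be) an0 bn0 => A B A0 B0; field; rewrite q0 A0 B0.
Qed.

End sign_change_covariance.

(** * Dyadic grids *)

Section dyadic_grid.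
Context {R : realType}.
Implicit Types p q t : R.

Definition dyadic p q (m j : nat) : R := p + (q - p) * j%:R / 2 ^+ m.

Lemma dyadic_itv p q m j : p <= q -> (j <= 2 ^ m)%N -> dyadic p q m j \in `[p, q].
Proof.
move=> pq jm; rewrite in_itv/=.
have m0 : 0 < 2 ^+ m :> R by rewrite exprn_gt0.
have qp : 0 <= q - p by rewrite subr_ge0.
rewrite /dyadic lerDl divr_ge0 ?mulr_ge0 ?(ltW m0)//= -lerBrDl ler_pdivrMr// ler_wpM2l//.
by rewrite -natrX ler_nat.
Qed.

Lemma dyadic_near p q t m : p < q -> t \in `[p, q] ->
  exists2 j, (j <= 2 ^ m)%N & `|dyadic p q m j - t| <= (q - p) / 2 ^+ m.
Proof.
move=> pq; rewrite in_itv/= => /andP[pt tq].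
have m0 : 0 < 2 ^+ m :> R by rewrite exprn_gt0.
have qp : 0 < q - p by rewrite subr_gt0.
pose x := (t - p) / (q - p) * 2 ^+ m.
have x0 : 0 <= x by rewrite mulr_ge0 ?divr_ge0 ?subr_ge0// ltW.
have /andP[jx xj] := truncn_itv x0.
exists (Num.Def.truncn x).
  rewrite -(ler_nat R) (le_trans jx)// natrX /x ler_piMl ?(ltW m0)// ler_pdivrMr// mul1r.
  by rewrite lerD2r.
have e : dyadic p q m (Num.Def.truncn x) - t =
    (q - p) / 2 ^+ m * ((Num.Def.truncn x)%:R - x).
  by rewrite /dyadic /x; field; rewrite !gt_eqF.
have s0 : 0 <= (q - p) / 2 ^+ m by rewrite divr_ge0// ltW.
rewrite e normrM ger0_norm// ler_piMr//.
rewrite -natr1 in xj.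
by rewrite distrC ger0_norm ?subr_ge0// lerBlDl ltW.
Qed.

Lemma cvg_dyadic_step p q : (q - p) / 2 ^+ m @[m --> \oo] --> (0:R).
Proof.
rewrite -[X in _ --> X](mulr0 (q - p)); apply: cvgM; first exact: cvg_cst.
under eq_fun do rewrite -exprVn.
by apply: cvg_expr; rewrite ger0_norm ?invr_ge0// invf_lt1// ltr1n.
Qed.

Lemma dyadic_dense p q t (f : R -> R) (e : R) : p < q -> t \in `[p, q] ->
  {for t, continuous f} -> 0 < e ->
  \forall m \near \oo, exists2 j, (j <= 2 ^ m)%N & `|f (dyadic p q m j) - f t| < e.
Proof.
move=> pq tpq cf e0.
have /cvgrPdist_lt/(_ e e0)/nbhs_ballP[del /= del0 fdel] := cf.
have /cvgrPdist_lt/(_ del del0) := @cvg_dyadic_step p q.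
apply: filterS => m; rewrite sub0r normrN => sm.
have [j jm jt] := dyadic_near m pq tpq; exists j => //.
rewrite distrC; apply: fdel; rewrite /ball/= distrC (le_lt_trans jt)//.
by rewrite (le_lt_trans (ler_norm _)).
Qed.

End dyadic_grid.

(** A tangential zero without derivatives: zero is attained but not crossed downwards. Contact from
    the other side is expressed through [- f]. *)
Definition tangent (R : realType) (f : R -> R) (p q : R) : Prop :=
  (forall t, t \in `[p, q] -> 0 <= f t) /\ (exists2 t, t \in `[p, q] & f t = 0).

(** * Tangential zeros are negligible *)

Section tangency.
Context d (T : measurableType d) (R : realType) (P : probability T R).
Variable H : set (T -> R).
Hypothesis gH : centered_gaussian_space P H.
Local Notation mu := (@lebesgue_measure R).
Local Notation nu := (normal_prob (0:R) 1).

Lemma normal_prob_itv_le (v del : R) : 0 <= del -> (nu `]v, (v + del)%R] <= del%:E)%E.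
Proof.
move=> d0; rewrite /normal_prob.
apply: (@le_trans _ _ (\int[mu]_(u in `]v, (v + del)%R]) (2^-1)%:E)%E).
  apply: ge0_le_integral => //.
  - by move=> u _; rewrite lee_fin normal_pdf_ge0.
  - by apply/measurable_EFinP; apply: measurable_funTS; exact: measurable_normal_pdf.
  - by move=> u _; rewrite lee_fin (le_trans _ normal_peak1_le)// normal_pdf_ub.
rewrite integral_cst//= lebesgue_measure_itv/=; case: ifPn => _.
  by rewrite -EFinD -EFinM lee_fin; lra.
by rewrite mule0 lee_fin.
Qed.

Lemma measurable_all_has (s : seq (T -> R)) (a : R) :
  {in s, forall Y, measurable_fun setT Y} ->
  measurable [set w | all (fun Y => 0 < Y w)%R s && has (fun Y => Y w <= a)%R s].
Proof.
move=> ms.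
have mall : measurable_fun setT (fun w => all (fun Y : T -> R => 0 < Y w) s).
  elim: s ms => //= Y s' ih mY; apply: measurable_and.
    by apply: measurable_fun_ltr => //; apply: mY; rewrite mem_head.
  by apply: ih => Y' Y's; apply: mY; rewrite inE Y's orbT.
have mhas : measurable_fun setT (fun w => has (fun Y : T -> R => Y w <= a) s).
  elim: s ms {mall} => //= Y s' ih mY; apply: measurable_or.
    by apply: measurable_fun_ler => //; apply: mY; rewrite mem_head.
  by apply: ih => Y' Y's; apply: mY; rewrite inE Y's orbT.
exact: measurable_bool_set (measurable_and mall mhas).
Qed.

(* Conditionally on the part of the [Y]s independent of [Z], the event forces
   [Z] into an interval of length [del]. *)
Lemma small_positive_minimum Z (s : seq (T -> R)) (del : R) : H Z ->
  \int[P]_w Z w ^+ 2 = 1 -> 0 < del ->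
  {in s, forall Y, H Y /\ 2^-1 <= \int[P]_w (Y w * Z w)} ->
  (P [set w | all (fun Y => 0 < Y w)%R s && has (fun Y => Y w <= del / 2)%R s] <= del%:E)%E.
Proof.
move=> HZ Z1 del0; case: s => [|Y0 s] sP.
  rewrite (_ : [set _ | _] = set0) ?measure0 ?lee_fin ?ltW//.
  by apply/seteqP; split => w.
pose c Y := \int[P]_w (Y w * Z w).
(* [V Y = Z - Y / c Y] is orthogonal to [Z]. Here [Y > 0] means [V Y < Z], and [Y <= del / 2] with
   [c Y >= 1/2] gives [V Y >= Z - del]. So the event forces [A < Z <= A + del], where the maximum
   [A] of the [V Y] is independent of [Z]. *)
pose V (Y : T -> R) w : R := 1 * Z w + (- (c Y)^-1) * Y w.
pose A w := foldr (fun Y m => Num.max (V Y w) m) (V Y0 w) s.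
have HV Y : Y \in Y0 :: s -> H (V Y) by move=> /sP[HY _]; exact: (gspaceD gH).
have ltA w y : (A w < y) = all (fun Y => V Y w < y) (Y0 :: s).
  rewrite /A /=; elim: s {sP HV A} => [|Y s ih] /=; first by rewrite andbT.
  by rewrite gt_max ih andbCA.
have leA w Y : Y \in Y0 :: s -> V Y w <= A w.
  rewrite /A; elim: s {sP HV A ltA} => [|Y' s ih] /=; first by rewrite inE => /eqP ->.
  rewrite !inE orbCA => /orP[/eqP ->|]; first by rewrite le_max lexx.
  by move=> h; rewrite le_max ih ?orbT// inE.
have setA y : [set w | A w < y] = [set w | below [seq (V Y, y) | Y <- Y0 :: s] w].
  by apply/seteqP; split => w /=; rewrite ltA /below all_map.
have os y : orthogonal_to P H Z [seq (V Y, y) | Y <- Y0 :: s].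
  move=> q /mapP[Y Ys ->] /=; split; first exact: HV.
  have [HY cY] := sP _ Ys.
  have -> : \int[P]_w (V Y w * Z w) = 1 * \int[P]_w (Z w * Z w) + - (c Y)^-1 * c Y.
    exact: (gspace_covDl gH).
  have -> : \int[P]_w (Z w * Z w) = 1 by rewrite -Z1; apply: eq_Rintegral => w _; rewrite expr2.
  by rewrite mulNr mulVf ?mulr1 ?subrr// gt_eqF// (lt_le_trans _ cY).
have mZ := gspace_measurable gH HZ.
have mA : measurable_fun setT A.
  have : {in s, forall Y, H (V Y)} by move=> Y Ys; apply: HV; rewrite inE Ys orbT.
  rewrite /A; elim: {+}s => [|Y s' ih] ss /=.
    by apply: (gspace_measurable gH); apply: HV; rewrite mem_head.
  apply: measurable_maxr.
    by apply: (gspace_measurable gH); apply: ss; rewrite mem_head.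
  by apply: ih => Y' Ys'; apply: ss; rewrite inE Ys' orbT.
pose A' : T -> measurableTypeR R := A.
have mA' : measurable_fun setT A' := mA.
pose Am : {mfun T >-> measurableTypeR R} := HB.pack A' (isMeasurableFun.Build _ _ _ _ A' mA').
pose f (z : R * R) : \bar R := (((z.2 < z.1) && (z.1 <= z.2 + del))%R%:R)%:E.
have mf : measurable_fun setT f.
  apply/measurable_EFinP; apply: measurable_natr_bool; apply: measurable_and.
    by apply: measurable_fun_ltr; [exact: measurable_snd|exact: measurable_fst].
  apply: measurable_fun_ler; first exact: measurable_fst.
  by apply: measurable_funD => //; exact: measurable_snd.
have f0 z : (0 <= f z)%E by rewrite lee_fin.
have := @independent_joint_law _ _ _ P Z A nu (distribution P Am) mZ mA
  (gspace_standard_law gH HZ Z1) (fun B mB => erefl) _ f mf f0.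
move=> /(_ _)/wrap[].
  move=> x y; rewrite setIC muleC setA; exact: (gspace_below_independence gH).
move=> law.
apply: (@le_trans _ _ (\int[P]_w f (Z w, A w))%E).
  set E := (X in P X).
  have mE : measurable E by apply: measurable_all_has => Y /sP[HY _]; exact: (gspace_measurable gH).
  rewrite -[E]setIT -integral_indic//.
  apply: ge0_le_integral => //.
  - exact/measurable_EFinP/measurable_indic.
  - by apply: (measurableT_comp mf); exact/measurable_fun_pair.
  move=> w _; rewrite lee_fin indicE.
  case: (boolP (_ \in _)) => //; rewrite inE => /andP[/allP pos /hasP[Y Ys Ydel]].
  have cpos Y' : Y' \in Y0 :: s -> 2^-1 <= c Y' by move=> /sP[].
  rewrite (_ : (_ < _ <= _)%R = true)//=; apply/andP; split.
    rewrite ltA; apply/allP => Y' Y's; rewrite /V mul1r mulNr ltrBlDr ltrDl.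
    have c0 : 0 < c Y' by rewrite (lt_le_trans _ (cpos _ Y's)).
    by rewrite mulr_gt0 ?invr_gt0//; exact: pos.
  have c0 : 0 < c Y by rewrite (lt_le_trans _ (cpos _ Ys)).
  rewrite -lerBlDr (le_trans _ (leA w Y Ys))// /V mul1r mulNr lerD2l lerN2.
  rewrite mulrC ler_pdivrMr// (le_trans Ydel)// ler_pM2l//.
  exact: cpos.
rewrite law.
apply: (@le_trans _ _ (\int[distribution P Am]_v del%:E)%E); last first.
  by rewrite integral_cst//= probability_setT mule1.
apply: ge0_le_integral => //.
- by move=> v _; exact: integral_ge0.
- by have := @measurable_fun_fubini_tonelli_G _ _ (measurableTypeR R) (measurableTypeR R) R nu f mf f0.
move=> v _; rewrite (_ : (\int[nu]_u f (u, v))%E = nu `]v, (v + del)%R]); last first.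
  rewrite -[X in _ = normal_prob _ _ X]setIT -integral_indic//; apply: eq_integral => u _.
  by rewrite /f indicE mem_setE in_itv.
exact: normal_prob_itv_le (ltW del0).
Qed.

Lemma null_of_le (E : set T) : measurable E ->
  (forall del : R, 0 < del -> (P E <= del%:E)%E) -> P E = 0%E.
Proof.
move=> mE PE; apply/eqP; rewrite eq_le measure_ge0 andbT.
by apply/lee_addgt0Pr => del del0; rewrite add0e PE.
Qed.

Lemma standard_normal_neq0 Z : H Z -> \int[P]_w Z w ^+ 2 = 1 -> P [set w | Z w = 0] = 0%E.
Proof.
move=> HZ Z1; have mZ := gspace_measurable gH HZ.
have e : [set w | Z w = 0] = Z @^-1` [set 0] by [].
rewrite e (gspace_standard_law gH HZ Z1)//.
apply/eqP; rewrite eq_le measure_ge0 andbT; apply/lee_addgt0Pr => del del0.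
rewrite add0e (le_trans _ (normal_prob_itv_le (- del) (ltW del0)))//.
apply: le_measure; rewrite ?inE//.
by move=> _ ->; rewrite /= in_itv/= addrC subrr lexx andbT oppr_lt0.
Qed.

Lemma liminf_measure_le (C : nat -> set T) (del : R) :
  (forall n, measurable (C n)) -> (forall n, (P (C n) <= del%:E)%E) ->
  (P (\bigcup_m \bigcap_(n in [set n | (m <= n)%N]) C n) <= del%:E)%E.
Proof.
move=> mC PC; pose D m := \bigcap_(n in [set n | (m <= n)%N]) C n.
have mD m : measurable (D m) by apply: bigcap_measurable => //; exists m => /=.
have DC m : (P (D m) <= del%:E)%E.
  rewrite (le_trans _ (PC m))//; apply: le_measure; rewrite ?inE//.
  by move=> w; apply => /=.
have := @nondecreasing_cvg_mu _ _ _ P D mD (bigcup_measurable (fun m _ => mD m)).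
move=> /(_ _)/wrap[].
  by move=> m n mn; apply/subsetPset => w Dw k /= nk; apply: Dw => /=; exact: leq_trans nk.
by move=> cD; rewrite -(cvg_lim _ cD)//; apply: lime_le; [apply: cvgP cD|exact: nearW].
Qed.

(** Off the null set where some grid value vanishes, a tangent path is positive on every grid and,
    by continuity, smaller than any given threshold somewhere on every fine grid. By
    [small_positive_minimum] with [Z = X p] this has probability at most [1 / (k + 1)], for every
    [k]. *)
Lemma tangent_negligible (X : R -> T -> R) (p q : R) : p < q ->
  (forall w, continuous (X ^~ w)) ->
  (forall t, H (X t)) -> (forall t, \int[P]_w X t w ^+ 2 = 1) ->
  (forall t, t \in `[p, q] -> 2^-1 <= \int[P]_w (X t w * X p w)) ->
  P.-negligible [set w | tangent (X ^~ w) p q].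
Proof.
move=> pq cX HX X1 Xp.
pose N := \bigcup_m \bigcup_j [set w | X (dyadic p q m j) w = 0].
have mX t : measurable_fun setT (X t) by exact: (gspace_measurable gH).
have m0 t : measurable [set w | X t w = 0].
  by rewrite -[X in measurable X]setTI; exact: (mX t measurableT [set 0]).
have mN : measurable N by do 2 apply: bigcup_measurable => ? _.
have N0 : P N = 0%E.
  apply/negligibleP => //.
  by do 2 apply: negligible_bigcup => ?; apply/negligibleP => //; exact: standard_normal_neq0.
pose s m := [seq X (dyadic p q m j) | j <- iota 0 (2 ^ m).+1].
pose C (k m : nat) := [set w | all (fun Y => 0 < Y w)%R (s m) &&
  has (fun Y => Y w <= k.+1%:R^-1 / 2)%R (s m)].
have sP m Y : Y \in s m -> exists2 j, (j <= 2 ^ m)%N & Y = X (dyadic p q m j).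
  by move=> /mapP[j]; rewrite mem_iota add0n ltnS => /andP[_ jm] ->; exists j.
have mC k m : measurable (C k m).
  have mY : {in s m, forall Y, measurable_fun setT Y} by move=> Y /sP[j _ ->].
  exact: measurable_all_has.
have PC k m : (P (C k m) <= (k.+1%:R^-1 : R)%:E)%E.
  apply: (small_positive_minimum (HX p) (X1 p)) => //.
  by move=> Y /sP[j jm ->]; split => //; apply: Xp; apply: dyadic_itv => //; exact: ltW.
pose L k := \bigcup_m \bigcap_(n in [set n | (m <= n)%N]) C k n.
have mL k : measurable (L k).
  by apply: bigcup_measurable => m _; apply: bigcap_measurable => //; exists m => /=.
have PL k : (P (L k) <= (k.+1%:R^-1 : R)%:E)%E by exact: liminf_measure_le.
exists (N `|` \bigcap_k L k); split.
- by apply: measurableU => //; apply: bigcap_measurable => //; exists 0%N.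
- apply: null_of_le; first by apply: measurableU => //; apply: bigcap_measurable => //; exists 0%N.
  move=> del del0.
  have [k _ kdel] := near_infty_natSinv_lt (PosNum del0).
  rewrite (le_trans (measureU2 _ _ _))//; first by apply: bigcap_measurable => //; exists 0%N.
  rewrite [X in (X + _)%E]N0 add0e (le_trans _ (_ : P (L k) <= _)%E)//.
    apply: le_measure; rewrite ?inE//; first by apply: bigcap_measurable => //; exists 0%N.
    exact: bigcap_inf.
  by rewrite (le_trans (PL k))// lee_fin ltW// kdel//=.
move=> w /= [pos [t tpq t0]].
have [Nw|Nw] := pselect (N w); [by left|right] => k _.
have := @dyadic_dense _ p q t (X ^~ w) (k.+1%:R^-1 / 2) pq tpq (cX w t).
move=> /(_ _)/wrap[]; first by rewrite divr_gt0 ?invr_gt0.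
move=> -[m _ md]; exists m => // n /= mn.
have [j jn jt] := md n mn.
apply/andP; split.
  apply/allP => Y /sP[i im ->]; rewrite lt_neqAle eq_sym pos; last by apply: dyadic_itv => //; exact: ltW.
  by rewrite andbT; apply/eqP => Xi0; apply: Nw; exists n => //; exists i.
apply/hasP; exists (X (dyadic p q n j)); last first.
  by move: jt; rewrite t0 subr0 => jt; rewrite (le_trans (ler_norm _))// ltW.
by apply/mapP; exists j => //; rewrite mem_iota add0n ltnS.
Qed.

End tangency.

(** * Counting zeros by sign changes *)

Section sign_changes_and_zeros.
Context {R : realType}.
Implicit Types (f : R -> R) (p q t : R).

Definition sign_change f p q (m j : nat) : bool :=
  f (dyadic p q m j) * f (dyadic p q m j.+1) < 0.

Definition sign_changes f p q m : nat := \sum_(j < 2 ^ m) sign_change f p q m j.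

Lemma sign_changesE f p q m :
  sign_changes f p q m = size [seq j <- iota 0 (2 ^ m) | sign_change f p q m j].
Proof.
rewrite /sign_changes -(big_mkord xpredT (fun j => nat_of_bool (sign_change f p q m j))).
by rewrite /index_iota subn0 size_filter -sum1_count [in RHS]big_mkcond/=; apply: eq_bigr => j _; case: sign_change.
Qed.

(** The restriction to cells of length at most [1/2] matches the range in which the correlation with
    the left endpoint is known to be at least [1/2]. *)
Definition transverse f p q : Prop := [/\ continuous f,
  forall m j, f (dyadic p q m j) != 0 &
  forall m j, (q - p) / 2 ^+ m <= 2^-1 ->
    ~ tangent f (dyadic p q m j) (dyadic p q m j.+1) /\
    ~ tangent (fun t => - f t) (dyadic p q m j) (dyadic p q m j.+1)].

Lemma dyadicS p q m j : dyadic p q m j.+1 = dyadic p q m j + (q - p) / 2 ^+ m.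
Proof. by rewrite /dyadic -addrA -natr1; field; rewrite expf_neq0. Qed.

Lemma dyadic_max p q m : dyadic p q m (2 ^ m) = q.
Proof. by rewrite /dyadic natrX mulfK ?expf_neq0// addrC subrK. Qed.

Lemma dyadic_sub p q m j m' i :
  dyadic (dyadic p q m j) (dyadic p q m j.+1) m' i = dyadic p q (m + m') (j * 2 ^ m' + i).
Proof.
rewrite {1}/dyadic dyadicS [_ + _ - _]addrAC subrr add0r /dyadic natrD natrM natrX exprD.
by field; rewrite !expf_neq0.
Qed.

Lemma ler_dyadic p q m : p <= q -> {homo dyadic p q m : i j / (i <= j)%N >-> i <= j}.
Proof.
move=> pq i j ij; rewrite /dyadic lerD2l ler_wpM2r ?invr_ge0 ?exprn_ge0//.
by rewrite ler_wpM2l ?subr_ge0// ler_nat.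
Qed.

Lemma exists_sign_change (g : nat -> R) n i j : (i <= n)%N -> (j <= n)%N ->
  g i < 0 -> 0 < g j -> (forall k, (k <= n)%N -> g k != 0) ->
  exists2 k, (k < n)%N & g k * g k.+1 < 0.
Proof.
move=> ni nj gi gj gn0; apply: contrapT => nex.
have step k : (k < n)%N -> 0 < g k * g k.+1.
  move=> kn; rewrite lt_neqAle eq_sym mulf_neq0 ?gn0// ?(ltnW kn)//= leNgt.
  by apply/negP => h; apply: nex; exists k.
have pos k : (k <= n)%N -> 0 < g 0%N * g k.
  elim: k => [|k ih] kn; first by rewrite -expr2 exprn_even_gt0 ?gn0.
  have := mulr_gt0 (ih (ltnW kn)) (step k kn).
  rewrite (_ : g 0%N * g k * _ = g k ^+ 2 * (g 0%N * g k.+1)); last by ring.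
  by rewrite pmulr_rgt0// exprn_even_gt0//= gn0// ltnW.
have := mulr_gt0 (pos i ni) (pos j nj).
rewrite (_ : g 0%N * g i * _ = g 0%N ^+ 2 * (g i * g j)); last by ring.
rewrite pmulr_rgt0 ?exprn_even_gt0 ?gn0// nmulr_rgt0// => h.
by have := lt_trans gj h; rewrite ltxx.
Qed.

(** In a dyadic cell around [t], of length at most [min e (1/2)], absence of tangency on both sides
    means that [f] takes both signs. Fine grids see both signs, hence a sign change inside this
    cell. *)
Lemma sign_change_near_zero f p q t (e : R) : p < q -> transverse f p q ->
  t \in `[p, q] -> f t = 0 -> 0 < e ->
  \forall m \near \oo, exists k, [/\ (k < 2 ^ m)%N, sign_change f p q m k &
    `|dyadic p q m k - t| <= e].
Proof.
move=> pq [cf f0 ftan] tpq ft e0.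
have me : 0 < Num.min e 2^-1 by rewrite lt_min e0 invr_gt0 ltr0n.
have /cvgrPdist_lt/(_ _ me)[m0 _ /(_ m0 (leqnn _))] := @cvg_dyadic_step R p q.
rewrite sub0r normrN => /ltW sm.
have qp : 0 < q - p by rewrite subr_gt0.
have p20 : 0 < 2 ^+ m0 :> R by rewrite exprn_gt0.
have st0 : 0 < (q - p) / 2 ^+ m0 by rewrite divr_gt0.
rewrite gtr0_norm// le_min in sm; case/andP: sm => sme sm2.
pose x := (t - p) / (q - p) * 2 ^+ m0.
have [pt tq] : p <= t /\ t <= q by move: tpq; rewrite in_itv/= => /andP.
have x0 : 0 <= x by rewrite mulr_ge0 ?divr_ge0 ?subr_ge0// ltW.
have := truncn_itv x0; set j := Num.Def.truncn x => /andP[jx xj].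
(* [q] is a grid point, so [f q] is nonzero. Hence the truncated index [j] is below [2 ^ m0], and
   the cell of [t] does belong to the grid. *)
have ltq : t < q.
  by rewrite lt_neqAle tq andbT; apply: contraNneq (f0 0%N (2 ^ 0)%N) => tq'; rewrite dyadic_max -tq' ft.
have tE : t = p + (q - p) * x / 2 ^+ m0 by rewrite /x; field; rewrite !gt_eqF.
have j2 : (j < 2 ^ m0)%N.
  rewrite -(ltr_nat R) (le_lt_trans jx)// natrX /x gtr_pMl// ltr_pdivrMr// mul1r ltrD2r//.
set p' := dyadic p q m0 j; set q' := dyadic p q m0 j.+1.
have tpq' : t \in `[p', q'].
  rewrite in_itv/= tE /p' /q' /dyadic !lerD2l !ler_wpM2r ?invr_ge0 ?(ltW p20)//=.
    by rewrite ler_pM2l// ltW.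
  by rewrite ler_pM2l.
have p'q' : p' < q' by rewrite /q' dyadicS ltrDl.
have [nt1 nt2] := ftan m0 j sm2.
have [a apq fa] : exists2 a, a \in `[p', q'] & f a < 0.
  apply: contrapT => na; apply: nt1; split; last by exists t.
  by move=> a apq; rewrite leNgt; apply/negP => fa; apply: na; exists a.
have [b bpq fb] : exists2 b, b \in `[p', q'] & 0 < f b.
  apply: contrapT => nb; apply: nt2; split; last by exists t => //; rewrite ft oppr0.
  by move=> b bpq; rewrite oppr_ge0 leNgt; apply/negP => fb; apply: nb; exists b.
have da := dyadic_dense p'q' apq (cf a) (_ : 0 < - f a).
have db := dyadic_dense p'q' bpq (cf b) fb.
rewrite oppr_gt0 in da; have {}da := da fa.
have [M _ hM] := filterI da db.
exists (m0 + M)%N => // m /= mM.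
have [m' em Mm'] : exists2 m', m = (m0 + m')%N & (M <= m')%N.
  by exists (m - m0)%N; move: mM; clear; lia.
have [[i im fi] [i' im' fi']] := hM m' Mm'.
have gi : f (dyadic p' q' m' i) < 0 by move: fi; rewrite ltr_norml => /andP[_]; lra.
have gi' : 0 < f (dyadic p' q' m' i') by move: fi'; rewrite ltr_norml => /andP[]; lra.
have [k km gk] := @exists_sign_change (fun i => f (dyadic p' q' m' i)) (2 ^ m') i i' im im' gi gi'
  (fun k _ => etrans (congr1 (fun x => f x != 0) (dyadic_sub p q m0 j m' k)) (f0 _ _)).
have kE := dyadic_sub p q m0 j m' k; have kE1 := dyadic_sub p q m0 j m' k.+1.
exists (j * 2 ^ m' + k)%N; split.
- rewrite em expnD (leq_trans (_ : _ < j.+1 * 2 ^ m')%N)//.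
    by rewrite mulSn addnC ltn_add2r.
  by rewrite leq_mul2r j2 orbT.
- by rewrite /sign_change em -addnS -kE -kE1.
rewrite em -kE (le_trans _ sme)//.
have := dyadic_itv (ltW p'q') (ltnW km).
move: tpq'; rewrite !in_itv/= => /andP[t1 t2] /andP[k1 k2].
have e1 : (q - p) / 2 ^+ m0 = q' - p' by rewrite /q' dyadicS addrAC subrr add0r.
by rewrite e1 ler_norml; apply/andP; split; lra.
Qed.

Lemma lower_bound_pos (l : seq R) : {in l, forall z, 0 < z} ->
  exists2 e : R, 0 < e & {in l, forall z, e <= z}.
Proof.
elim: l => [_|x l ih lP]; first by exists 1.
have [e e0 el] := ih (fun z zl => lP z (mem_behead (s := x :: l) zl)).
exists (Num.min x e) => [|z]; first by rewrite lt_min e0 lP// mem_head.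
by rewrite inE ge_min => /orP[/eqP ->|/el ->]; rewrite ?lexx ?orbT.
Qed.

(** Each zero has a sign change within distance [e], and distinct zeros are more than [2 e] apart,
    so this assignment is injective. *)
Lemma zeros_le_sign_changes f p q (s : seq R) : p < q -> transverse f p q ->
  uniq s -> {in s, forall t, t \in `[p, q] /\ f t = 0} ->
  \forall m \near \oo, (size s <= sign_changes f p q m)%N.
Proof.
move=> pq tf us sP.
have [e e0 gap] : exists2 e : R, 0 < e & {in s &, forall t t', `|t - t'| <= 2 * e -> t = t'}.
  pose l := [seq z <- [seq `|x - y| | x <- s, y <- s] | 0 < z].
  have lP : {in l, forall z, 0 < z} by move=> z; rewrite mem_filter => /andP[].
  have [e e0 el] := lower_bound_pos lP.
  exists (e / 3) => [|x y xs ys xy]; first by rewrite divr_gt0.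
  apply/eqP; rewrite -subr_eq0 -normr_le0 leNgt; apply/negP => xy0.
  have : e <= `|x - y| by apply: el; rewrite mem_filter xy0; apply/allpairsP; exists (x, y).
  lra.
have near_s : \forall m \near \oo, {in s, forall t, exists k, [/\ (k < 2 ^ m)%N, sign_change f p q m k &
    `|dyadic p q m k - t| <= e]}.
  elim: s sP {us gap} => [_|t s ih sP]; first by apply: nearW.
  have [tpq ft] := sP t (mem_head _ _).
  have h1 := sign_change_near_zero pq tf tpq ft e0.
  have h2 := ih (fun x xs => sP x (mem_behead (s := t :: s) xs)).
  by apply: filterS2 h1 h2 => m a b x; rewrite inE => /orP[/eqP ->|/b].
apply: filterS near_s => m hm.
pose k t := if pselect (exists k, [/\ (k < 2 ^ m)%N, sign_change f p q m k &
    `|dyadic p q m k - t| <= e]) is left h then projT1 (cid h) else 0%N.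
have kP t : t \in s -> [/\ (k t < 2 ^ m)%N, sign_change f p q m (k t) &
    `|dyadic p q m (k t) - t| <= e].
  by move=> ts; rewrite /k; case: pselect => [h|/(_ (hm t ts))//]; case: cid.
rewrite sign_changesE -(size_map k); apply: uniq_leq_size.
  rewrite map_inj_in_uniq// => t t' ts ts' kk; apply: gap => //.
  have [_ _ h1] := kP t ts; have [_ _ h2] := kP t' ts'.
  rewrite -kk in h2; rewrite distrC in h1.
  rewrite -(subrKA (dyadic p q m (k t))) (le_trans (ler_normD _ _))//; lra.
move=> _ /mapP[t ts ->]; have [k1 k2 _] := kP t ts.
by rewrite mem_filter k2 mem_iota.
Qed.

(** The intermediate value theorem gives a zero in the open cell of each sign change; because the
    cells are open and disjoint, these zeros are distinct. *)
Lemma sign_changes_le_zeros f p q m : p < q -> continuous f ->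
  exists s : seq R, [/\ uniq s, size s = sign_changes f p q m &
    {in s, forall t, t \in `[p, q] /\ f t = 0}].
Proof.
move=> pq cf.
have zP j : exists z, sign_change f p q m j ->
    [/\ dyadic p q m j < z, z < dyadic p q m j.+1 & f z = 0].
  rewrite /sign_change; set a := dyadic p q m j; set b := dyadic p q m j.+1.
  have ab : a <= b by apply: ler_dyadic => //; exact: ltW.
  have [ch|_] := boolP (f a * f b < 0); last by exists 0.
  have := @IVT R f a b 0 ab (continuous_subspaceT cf).
  move=> /(_ _)/wrap[].
    rewrite ge_min le_max; have [fa|fa|fa] := ltgtP (f a) 0.
    - by move: ch; rewrite nmulr_rlt0// => /ltW ->; rewrite orbT.
    - by move: ch; rewrite pmulr_rlt0// => /ltW ->; rewrite orbT.
    - by move: ch; rewrite fa mul0r ltxx.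
  move=> [z]; rewrite in_itv/= => /andP[az zb] fz; exists z => _; split => //.
    by rewrite lt_neqAle az andbT; apply: contraTneq ch => ->; rewrite fz mul0r ltxx.
  by rewrite lt_neqAle zb andbT; apply: contraTneq ch => <-; rewrite fz mulr0 ltxx.
have [z zE] := choice zP.
exists [seq z j | j <- iota 0 (2 ^ m) & sign_change f p q m j]; split.
- rewrite map_inj_in_uniq; first by rewrite filter_uniq// iota_uniq.
  suff wl j j' : sign_change f p q m j -> sign_change f p q m j' -> (j < j')%N -> z j < z j'.
    move=> j j'; rewrite !mem_filter => /andP[cj _] /andP[cj' _] zz.
    have [jj|jj|//] := ltngtP j j'.
      by have := wl _ _ cj cj' jj; rewrite zz ltxx.
    by have := wl _ _ cj' cj jj; rewrite zz ltxx.
  move=> /zE[_ z1 _] /zE[z2 _ _] jj.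
  by rewrite (lt_trans z1)// (le_lt_trans _ z2)// ler_dyadic// ltW.
- by rewrite size_map sign_changesE.
move=> _ /mapP[j +  ->]; rewrite mem_filter mem_iota add0n => /andP[/zE[z1 z2 fz] /= j2]; split => //.
have := dyadic_itv (ltW pq) (ltnW j2); have := dyadic_itv (ltW pq) j2.
by rewrite !in_itv/= => /andP[_ h1] /andP[h2 _]; rewrite (le_trans h2 (ltW z1)) (le_trans (ltW z2) h1).
Qed.

(** The second alternative is that of infinitely many zeros. It is excluded almost surely later on,
    through the mean of the sign changes. *)
Lemma sign_changes_num_zeros f (T0 : R) : 0 < T0 -> transverse f (- T0) T0 ->
  (exists k : nat, [/\ num_zeros f T0 = (k%:R)%:E,
     forall m, (sign_changes f (- T0) T0 m <= k)%N &
     \forall m \near \oo, sign_changes f (- T0) T0 m = k]) \/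
  (forall K, \forall m \near \oo, (K <= sign_changes f (- T0) T0 m)%N).
Proof.
move=> T00 tf; have pq : - T0 < T0 by lra.
have [cf _ _] := tf.
pose Z := [set t : R | t \in `[(- T0)%R, T0] /\ f t = 0].
have [finZ|infZ] := pselect (finite_set Z); [left|right].
  have ZP t : t \in fset_set Z <-> Z t by rewrite in_fset_set// inE.
  have upper m : (sign_changes f (- T0) T0 m <= #|` fset_set Z|)%N.
    have [s [us <- sP]] := sign_changes_le_zeros m pq cf.
    by apply: uniq_leq_size => // t /sP h; apply/ZP.
  exists #|` fset_set Z|; split => //.
    by rewrite /num_zeros -/Z /counting asboolT.
  have := @zeros_le_sign_changes f _ _ (enum_fset (fset_set Z)) pq tf (fset_uniq _) (fun t h => (ZP t).1 h).
  by apply: filterS => m h; apply/eqP; rewrite eqn_leq upper.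
move=> K; have [B BZ BK] := infinite_set_fset K infZ.
have := @zeros_le_sign_changes f _ _ (enum_fset B) pq tf (fset_uniq _) (fun t h => BZ t h).
by apply: filterS => m; exact: leq_trans.
Qed.

End sign_changes_and_zeros.

(** * The infinite product of cosines *)

Section cosine_product.
Context {R : realType}.
Implicit Types t h x u : R.
Local Notation C := (@cos_fact_product R).

Definition cos_partial (n : nat) t : R := \prod_(k < n) cos (t / k.+1`!%:R).

Lemma cos_partialS n t : cos_partial n.+1 t = cos_partial n t * cos (t / n.+1`!%:R).
Proof. by rewrite /cos_partial big_ord_recr. Qed.

Lemma cos_fact_productE t : C t = lim (cos_partial n t @[n --> \oo]).
Proof.
rewrite /cos_fact_product; congr (limn _); apply/funext => n.
by rewrite big_add1 /= big_mkord.
Qed.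

Lemma cos_ge0_1 x : `|x| <= 1 -> 0 <= cos x.
Proof.
rewrite ler_norml => /andP[x1 x2]; apply: cos_ge0_pihalf.
by have := @pihalf_ge1 R; move: (pi / 2) => p p1; rewrite (le_trans x2 p1) (le_trans _ x1)// lerN2.
Qed.

Lemma normr_fact_le t k : `|t| <= k.+1%:R -> `|t / k.+1`!%:R| <= 1.
Proof.
move=> tk; rewrite normrM normfV normr_nat ler_pdivrMr ?ltr0n ?fact_gt0// mul1r.
by rewrite (le_trans tk)// ler_nat factS leq_pmulr// fact_gt0.
Qed.

(** Beyond index [K] all angles are at most [1], so the cosines lie in [[0, 1]] and the tail
    products decrease and stay nonnegative. *)
Lemma is_cvg_cos_partial t : cvg (cos_partial n t @[n --> \oo]).
Proof.
pose K := (Num.Def.truncn `|t|).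
have tK j : `|t| <= (K + j).+1%:R.
  by rewrite (le_trans (ltW (truncnS_gt _)))// ler_nat ltnS leq_addr.
pose v n : R := \prod_(j < n) cos (t / (K + j).+1`!%:R).
have v0 n : 0 <= v n.
  by apply: prodr_ge0 => j _; apply: cos_ge0_1; exact: normr_fact_le.
have cv : cvg (v n @[n --> \oo]).
  apply: nonincreasing_is_cvgn; last by exists 0 => _ [n _ <-].
  apply/nonincreasing_seqP => n; rewrite /v big_ord_recr/= ler_piMr ?cos_le1//.
  exact: v0.
have : cvg (cos_partial K t * v n @[n --> \oo]).
  by apply: is_cvgM => //; exact: is_cvg_cst.
have -> : (fun n => cos_partial K t * v n) = (fun n => cos_partial (n + K) t).
  apply/funext => n; rewrite /cos_partial addnC.
  by rewrite big_split_ord.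
move=> c; apply/cvg_ex; exists (lim (cos_partial (n + K) t @[n --> \oo])).
by rewrite -(cvg_shiftn K).
Qed.

Lemma cvg_cos_partial t : cos_partial n t @[n --> \oo] --> C t.
Proof. by rewrite cos_fact_productE; exact: is_cvg_cos_partial. Qed.

Lemma cos_product_norm t : `|C t| <= 1.
Proof.
have n1 n : `|cos_partial n t| <= 1.
  elim: n => [|n ih]; first by rewrite /cos_partial big_ord0 normr1.
  by rewrite cos_partialS normrM mulr_ile1// cos_max.
have c : `|cos_partial n t| @[n --> \oo] --> `|C t| by apply: cvg_norm; exact: cvg_cos_partial.
by rewrite -(cvg_lim _ c)//; apply: limr_le; [apply: cvgP c|exact: nearW].
Qed.

Lemma cos_product0 : C 0 = 1.
Proof.
rewrite -(cvg_lim _ (@cvg_cos_partial 0))//; apply/cvg_lim => //.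
rewrite (_ : cos_partial ^~ 0 = fun=> 1); first exact: cvg_cst.
by apply/funext => n; rewrite /cos_partial big1// => k _; rewrite mul0r cos0.
Qed.

Lemma cos_productN t : C (- t) = C t.
Proof.
rewrite !cos_fact_productE; congr (limn _); apply/funext => n.
by apply: eq_bigr => k _; rewrite mulNr cosN.
Qed.

(** A product of terms [1 - a_j] is at least [1] minus the sum of the [a_j]; for
    [a_j = 3 c 4^-(j+1)] the sum over [j < n] is [c (1 - 4^-n)]. *)
Lemma prod_ge_geometric (c : R) (y : nat -> R) n : 0 <= c <= 1 ->
  (forall j, 0 <= y j /\ 1 - 3 * c * 4^-1 ^+ j.+1 <= y j) ->
  1 - c * (1 - 4^-1 ^+ n) <= \prod_(j < n) y j.
Proof.
move=> /andP[c0 c1] yP; elim: n => [|n ih]; first by rewrite big_ord0 expr0 subrr mulr0 subr0.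
rewrite big_ord_recr/=; have [y0 yn] := yP n.
apply: (@le_trans _ _ ((1 - c * (1 - 4^-1 ^+ n)) * y n)); last exact: ler_wpM2r.
set q : R := 4^-1 ^+ n.
have q0 : 0 <= q by rewrite exprn_ge0.
have q1 : q <= 1 by rewrite exprn_ile1// invf_le1// ler1n.
have cq : 0 <= c * (1 - q) by rewrite mulr_ge0// subr_ge0.
have cq1 : c * (1 - q) <= 1 by rewrite mulr_ile1// ?subr_ge0// gerBl.
rewrite exprS -/q in yn *.
apply: (@le_trans _ _ ((1 - c * (1 - q)) * (1 - 3 * c * (4^-1 * q)))); last first.
  by rewrite ler_wpM2l// subr_ge0.
have : 0 <= c * (1 - q) * (c * q) by rewrite mulr_ge0// mulr_ge0.
lra.
Qed.

Lemma fact_ge_expn n j : (0 < n)%N -> (n`! * 2 ^ j <= (n + j)`!)%N.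
Proof.
move=> n0; elim: j => [|j ih]; first by rewrite muln1 addn0.
by rewrite addnS factS expnS mulnCA leq_mul// ltnS addn_gt0 n0.
Qed.

(** Every further factorial at least doubles, so squared angles drop by a factor [4]. This is the
    decay that [prod_ge_geometric] expects. *)
Lemma cos_ge_geometric (a : R) n j : (0 < n)%N -> `|a| <= n`!%:R ->
  1 - a ^+ 2 / n`!%:R ^+ 2 / 2 * 4^-1 ^+ j <= cos (a / (n + j)`!%:R).
Proof.
move=> n0 an; have f0 : 0 < n`!%:R :> R by rewrite ltr0n fact_gt0.
have := one_minus_cos_le (a / (n + j)`!%:R).
have : (a / (n + j)`!%:R) ^+ 2 <= a ^+ 2 / n`!%:R ^+ 2 * 4^-1 ^+ j.
  rewrite exprMn -mulrA ler_wpM2l ?sqr_ge0//.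
  have -> : 4^-1 = 2^-1 ^+ 2 :> R by field.
  rewrite -exprM mulnC exprM -!exprVn -exprMn lerXn2r ?nnegrE ?mulr_ge0 ?invr_ge0 ?exprn_ge0//.
  rewrite exprVn -invfM lef_pV2 ?posrE ?mulr_gt0 ?exprn_gt0 ?ltr0n ?fact_gt0//.
  by rewrite -natrX -natrM ler_nat fact_ge_expn.
lra.
Qed.

Lemma cos_product_ge h : `|h| <= 1 -> 1 - h ^+ 2 <= C h.
Proof.
move=> h1; have h2 : h ^+ 2 <= 1 by rewrite -[h ^+ 2]real_normK ?num_real// expr_le1.
have h20 := sqr_ge0 h.
rewrite -(cvg_lim _ (@cvg_cos_partial h))//; apply: limr_ge; first exact: is_cvg_cos_partial.
apply: nearW => n.
(* With [c = 2/3 h^2] the first coefficient [3 c / 4] is the [h^2 / 2] of [cos_ge_geometric]. *)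
have c01 : 0 <= 2 / 3 * h ^+ 2 <= 1 by apply/andP; split; lra.
have := @prod_ge_geometric (2 / 3 * h ^+ 2) (fun k => cos (h / k.+1`!%:R)) n c01.
move=> /(_ _)/wrap[].
  move=> j; split.
    apply: cos_ge0_1; apply: normr_fact_le; rewrite (le_trans h1)// ler1n//.
  have := @cos_ge_geometric h 1 j isT h1.
  rewrite add1n (_ : 1`! = 1%N)// expr1n divr1 [4^-1 ^+ j.+1]exprS; lra.
have q0 : 0 <= 4^-1 ^+ n :> R by rewrite exprn_ge0.
apply: le_trans; set q := _ ^+ n in q0 *.
have : 0 <= h ^+ 2 * q by rewrite mulr_ge0.
lra.
Qed.

(** All factors but the first have absolute value at most [1], so [C h <= cos h < 1]. *)
Lemma cos_product_lt1 h : 0 < h <= 1 -> C h < 1.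
Proof.
move=> /andP[h0 h1].
have n1 n : `|cos_partial n.+1 h| <= cos h.
  elim: n => [|n ih].
    rewrite cos_partialS /cos_partial big_ord0 mul1r divr1 ger0_norm// cos_ge0_1//.
    by rewrite ger0_norm// ltW.
  by rewrite cos_partialS normrM (le_trans _ ih)// ler_piMr// cos_max.
have ch : C h <= cos h.
  have := @cvg_cos_partial h; rewrite -cvg_shiftS => c.
  rewrite -(cvg_lim _ c)//; apply: limr_le; first exact: cvgP c.
  by apply: nearW => n; exact: le_trans (ler_norm _) (n1 n).
rewrite (le_lt_trans ch)// -subr_gt0 one_minus_cos pmulr_rgt0// exprn_gt0//.
have := @sin_ge_cubic R (h / 2).
move=> /(_ _)/wrap[]; first by rewrite divr_ge0// ltW.
apply: lt_le_trans.
rewrite (_ : _ - _ = h / 2 * (1 - h ^+ 2 / 8)); last by field.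
rewrite mulr_gt0 ?divr_gt0//.
have : h ^+ 2 <= 1 by rewrite expr_le1// ltW.
lra.
Qed.

(** The angle of the factor [k!] at the point [2 pi g + u], reduced modulo [2 pi]. *)
Definition good_angle (g : nat) u (k : nat) : R := (2 * pi * (g %% k`!)%:R + u) / k`!%:R.

Lemma good_angleE g u k : exists n : nat,
  (2 * pi * g%:R + u) / k`!%:R = good_angle g u k + (pi *+ 2) *+ n.
Proof.
exists (g %/ k`!)%N; rewrite {1}(divn_eq g k`!) /good_angle natrD natrM.
have f0 : k`!%:R != 0 :> R by rewrite pnatr_eq0 -lt0n fact_gt0.
rewrite -[_ *+ (_ %/ _)]mulr_natr -[pi *+ 2]mulr_natr.
by move: pi => p; field.
Qed.

Lemma cos_good_angle g u k : cos ((2 * pi * g%:R + u) / k`!%:R) = cos (good_angle g u k).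
Proof. by have [n ->] := good_angleE g u k; rewrite (periodicn (@cosD2pi R)). Qed.

Lemma sin_good_angle g u k : sin ((2 * pi * g%:R + u) / k`!%:R) = sin (good_angle g u k).
Proof. by have [n ->] := good_angleE g u k; rewrite (periodicn (@sinD2pi R)). Qed.

(** Here [a], [b] and [a'], [b'] are cosine and sine of [theta] and [eta], while [A], [B] are the
    partial products at [t + h] and [t - h]. A new factor changes the half-sum to
    [a a' (A + B) / 2 + b b' (B - A) / 2]; keeping [A <= B] as an invariant makes the last term
    nonnegative. *)
Lemma products_step (a b a' b' D e A B : R) : 0 <= a -> 0 <= b -> 0 <= a' -> 0 <= b' ->
  0 <= D -> 0 <= e -> D + e <= (A + B) / 2 -> A <= B ->
  D * (a * a') + e * (a * a') <= (A * (a * a' - b * b') + B * (a * a' + b * b')) / 2 /\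
  A * (a * a' - b * b') <= B * (a * a' + b * b').
Proof.
move=> a0 b0 a'0 b'0 D0 e0 h AB.
have aa : 0 <= a * a' by rewrite mulr_ge0.
have bb : 0 <= b * b' by rewrite mulr_ge0.
have h1 : a * a' * (D + e) <= a * a' * ((A + B) / 2) by rewrite ler_wpM2l.
have h2 : 0 <= b * b' * ((B - A) / 2) by rewrite mulr_ge0// divr_ge0// subr_ge0.
have h3 : 0 <= a * a' * ((B - A) / 2) by rewrite mulr_ge0// divr_ge0// subr_ge0.
have h4 : 0 <= b * b' * ((A + B) / 2) by rewrite mulr_ge0// (le_trans _ h)// addr_ge0.
by split; move: h1 h2 h3 h4; lra.
Qed.

(** * Lower bound for the gap at good points *)

Section good_points.
Variables (n g : nat) (u h : R).
Hypotheses (n3 : (3 <= n)%N) (gn : (8 * g < n`!)%N).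
Hypothesis gmod : forall k, (8 * (g %% k`!) < k`!)%N.
Hypotheses (u01 : 4^-1 <= u <= 2^-1) (h01 : 0 < h <= 1).
Let t : R := 2 * pi * g%:R + u.

Let theta k := t / k`!%:R.
Let eta k := h / k`!%:R.

Let f1 k : 1 <= k`!%:R :> R.
Proof. by rewrite ler1n fact_gt0. Qed.

Let angle_ge0 k : 0 <= good_angle g u k.
Proof.
have [u1 u2] := andP u01.
by rewrite divr_ge0// addr_ge0 ?mulr_ge0 ?pi_ge0//; lra.
Qed.

Let angle_le k : good_angle g u k <= pi / 4 + 2^-1 / k`!%:R.
Proof.
have [u1 u2] := andP u01.
have f0 : 0 < k`!%:R :> R by rewrite ltr0n fact_gt0.
rewrite /good_angle mulrDl lerD//; last by rewrite ler_wpM2r// invr_ge0 ltW.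
have g8 : (g %% k`!)%:R <= k`!%:R / 8 :> R.
  by rewrite ler_pdivlMr// -natrM ler_nat mulnC ltnW.
rewrite ler_pdivrMr//.
have p2 : 0 <= 2 * pi :> R by rewrite mulr_ge0// pi_ge0.
have := ler_wpM2l p2 g8.
by move: pi => p; lra.
Qed.

Let angle_le_pihalf k : good_angle g u k <= pi / 2.
Proof.
rewrite (le_trans (angle_le k))//.
have : 2^-1 / k`!%:R <= 2^-1 :> R by rewrite ler_piMr// invf_le1// (lt_le_trans ltr01).
by have := @pi_ge2 R; move: pi => p; lra.
Qed.

Let cos_theta_ge0 k : 0 <= cos (theta k).
Proof.
rewrite cos_good_angle; apply: cos_ge0_pihalf; rewrite angle_le_pihalf andbT.
by rewrite (le_trans _ (angle_ge0 k))// oppr_le0 divr_ge0// pi_ge0.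
Qed.

Let sin_theta_ge0 k : 0 <= sin (theta k).
Proof.
rewrite sin_good_angle; apply: sin_ge0_pi; rewrite angle_ge0/=.
by rewrite (le_trans (angle_le_pihalf k))// ler_pdivrMr// ler_peMr ?pi_ge0// ler1n.
Qed.

(** For [k >= 3] the reduced angle is at most [pi / 4 + 1/12 < 13/12], and [1 - 169/288 > 1/4].
    These are the factors responsible for [4^-n]. *)
Let cos_theta_ge k : (3 <= k)%N -> 4^-1 <= cos (theta k).
Proof.
move=> k3; rewrite cos_good_angle.
have k6 : 6 <= k`!%:R :> R by rewrite (ler_nat _ 6) (@leq_trans 3`!)// leq_fact.
have : 2^-1 / k`!%:R <= 12^-1 :> R.
  by rewrite ler_pdivrMr ?(lt_le_trans _ k6)//; lra.
have := angle_le k; have := angle_ge0 k; have := one_minus_cos_le (good_angle g u k).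
move: (good_angle g u k) (2^-1 / k`!%:R) => a b.
have p4 : pi < 4 :> R by have := @pihalf_lt2 R; lra.
move: pi p4 => p p4 h1 h2 h3 h4.
have : a ^+ 2 <= (13 / 12) ^+ 2 by rewrite lerXn2r// ?nnegrE//; lra.
rewrite (_ : (13 / 12) ^+ 2 = 169 / 144 :> R); last by field.
lra.
Qed.

Let eta_itv k : 0 <= eta k <= 1.
Proof.
have [h0 h1] := andP h01; have f0 := lt_le_trans ltr01 (f1 k).
by rewrite /eta divr_ge0 ?(ltW h0) ?(ltW f0)//= ler_pdivrMr// mul1r (le_trans h1).
Qed.

Let cos_eta_ge0 k : 0 <= cos (eta k).
Proof. by have /andP[e0 e1] := eta_itv k; rewrite cos_ge0_1// ger0_norm. Qed.

Let sin_ge_half x : 0 <= x <= 1 -> x / 2 <= sin x.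
Proof.
move=> /andP[x0 x1]; apply: le_trans (sin_ge_cubic x0).
have : 0 <= x * (1 - x ^+ 2) by rewrite mulr_ge0// subr_ge0 expr_le1.
rewrite (_ : x * (1 - x ^+ 2) = x - x ^+ 3); last by ring.
lra.
Qed.

Let sin_eta_ge0 k : 0 <= sin (eta k).
Proof.
have e := eta_itv k; apply: le_trans (sin_ge_half e).
by case/andP: e => e0 _; rewrite divr_ge0.
Qed.

(** A single factor has no gap, as [cos (theta + eta) + cos (theta - eta) = 2 cos theta cos eta].
    Two factors produce exactly [s], of order [h^2], and the factors from the third on multiply it
    by [Q]. *)
Let s := sin (theta 1) * sin (eta 1) * (sin (theta 2) * sin (eta 2)).
Let Q J : R := \prod_(j < J) (cos (theta (3 + j)) * cos (eta (3 + j))).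

Let prod_cosD K : cos_partial K (t + h) = \prod_(k < K) cos (theta k.+1 + eta k.+1).
Proof. by apply: eq_bigr => k _; rewrite mulrDl. Qed.

Let prod_cosB K : cos_partial K (t - h) = \prod_(k < K) cos (theta k.+1 - eta k.+1).
Proof. by apply: eq_bigr => k _; rewrite mulrBl. Qed.

Let s_ge0 : 0 <= s. Proof. by rewrite !mulr_ge0. Qed.

Let Q_ge0 J : 0 <= Q J. Proof. by apply: prodr_ge0 => j _; rewrite mulr_ge0. Qed.

(* The two products satisfy [a' = cc a + ss b], [b' = cc b + ss a], where all
   the cosines and sines are nonnegative. *)
Let products_gap J :
  cos_partial (2 + J) t * cos_partial (2 + J) h + s * Q J <=
    (cos_partial (2 + J) (t + h) + cos_partial (2 + J) (t - h)) / 2 /\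
  cos_partial (2 + J) (t + h) <= cos_partial (2 + J) (t - h).
Proof.
elim: J => [|J [ih1 ih2]].
  rewrite addn0 !prod_cosD !prod_cosB /Q /cos_partial !big_ord_recr !big_ord0 /= -/(theta 1) -/(theta 2) -/(eta 1) -/(eta 2).
  rewrite !cosB !cosD !mul1r /s.
  have := cos_theta_ge0 1; have := cos_theta_ge0 2; have := sin_theta_ge0 1; have := sin_theta_ge0 2.
  have := cos_eta_ge0 1; have := cos_eta_ge0 2; have := sin_eta_ge0 1; have := sin_eta_ge0 2.
  move: (cos (theta 1)) (cos (theta 2)) (sin (theta 1)) (sin (theta 2)) => a b c e'.
  move: (cos (eta 1)) (cos (eta 2)) (sin (eta 1)) (sin (eta 2)) => a' b' c' e''.
  move=> x1 x2 x3 x4 x5 x6 x7 x8; split.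
    by rewrite le_eqVlt; apply/orP; left; apply/eqP; field.
  have y1 : 0 <= a * a' * (e' * e'') by rewrite !mulr_ge0.
  have y2 : 0 <= c * c' * (b * b') by rewrite !mulr_ge0.
  lra.
have D0 : 0 <= cos_partial (2 + J) t * cos_partial (2 + J) h.
  by apply: mulr_ge0; apply: prodr_ge0 => k _; [exact: cos_theta_ge0|exact: cos_eta_ge0].
have [h1 h2] := products_step (cos_theta_ge0 (3 + J)) (sin_theta_ge0 (3 + J))
  (cos_eta_ge0 (3 + J)) (sin_eta_ge0 (3 + J)) D0 (mulr_ge0 s_ge0 (Q_ge0 J)) ih1 ih2.
have eD : cos ((t + h) / (3 + J)`!%:R) = cos (theta (3 + J)) * cos (eta (3 + J)) -
    sin (theta (3 + J)) * sin (eta (3 + J)) by rewrite mulrDl cosD.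
have eB : cos ((t - h) / (3 + J)`!%:R) = cos (theta (3 + J)) * cos (eta (3 + J)) +
    sin (theta (3 + J)) * sin (eta (3 + J)) by rewrite mulrBl cosB.
rewrite addnS !(cos_partialS (2 + J)) eD eB; split => //.
have -> : Q J.+1 = Q J * (cos (theta (3 + J)) * cos (eta (3 + J))) by rewrite /Q big_ord_recr.
by rewrite [X in X + _ <= _]mulrACA [s * (_ * _)]mulrA.
Qed.

(** Since [g] vanishes modulo [1!] and [2!], the first two angles are [u] and [u / 2]. The bound
    [u >= 1/4] keeps their sines away from zero, which is why the window for [u] avoids the point
    [2 pi g] itself. *)
Let s_ge : (h / 32) ^+ 2 <= s.
Proof.
have [h0 h1] := andP h01; have [u1 u2] := andP u01.
have s1 : u / 2 <= sin (theta 1).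
  rewrite sin_good_angle /good_angle (_ : 1`! = 1%N)// modn1 mulr0 add0r divr1.
  by apply: sin_ge_half; apply/andP; split; lra.
have s2 : u / 4 <= sin (theta 2).
  rewrite sin_good_angle /good_angle.
  have -> : (g %% 2`! = 0)%N by have := gmod 2; rewrite (_ : 2`! = 2%N)//; case: (g %% 2)%N => // k; lia.
  rewrite mulr0 add0r (_ : 2`! = 2%N)//.
  have := @sin_ge_half (u / 2); rewrite (_ : u / 2 / 2 = u / 4); last by field.
  by apply; apply/andP; split; lra.
have s3 : h / 2 <= sin (eta 1).
  have := sin_ge_half (eta_itv 1); rewrite {1}/eta (_ : 1`! = 1%N)// divr1//.
have s4 : h / 4 <= sin (eta 2).
  have := sin_ge_half (eta_itv 2); rewrite {1}/eta (_ : 2`! = 2%N)//.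
  by rewrite (_ : h / 2 / 2 = h / 4)//; field.
have -> : (h / 32) ^+ 2 = 8^-1 * (h / 2) * (16^-1 * (h / 4)) by field.
by apply: ler_pM; [lra|lra|apply: ler_pM; lra|apply: ler_pM; lra].
Qed.

(** The cosines of [eta] contribute [1/3]. Those of [theta] contribute [1/4] for each index from [3]
    to [n], and another [1/3] beyond [n], where [|t| <= 2 n!] makes the angles decay
    geometrically. *)
Let Q_ge J : 4^-1 ^+ n / 9 <= Q (n - 2 + J).
Proof.
have [h0 h1] := andP h01; have [u1 u2] := andP u01.
have c23 : 0 <= (2 / 3 : R) <= 1 by apply/andP; split; lra.
have q1 m : 4^-1 ^+ m <= 1 :> R by rewrite exprn_ile1// invf_le1// ler1n.
have q0 m : 0 <= 4^-1 ^+ m :> R by rewrite exprn_ge0.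
rewrite /Q big_split/=.
have Qh : 3^-1 <= \prod_(j < n - 2 + J) cos (eta (3 + j)).
  have := @prod_ge_geometric (2 / 3) (fun j => cos (eta (3 + j))) (n - 2 + J) c23.
  move=> /(_ _)/wrap[]; last first.
    apply: le_trans; have := q1 (n - 2 + J)%N; have := q0 (n - 2 + J)%N; lra.
  move=> j; split => //.
  have := @cos_ge_geometric h 3 j isT; rewrite -/(eta _).
  move=> /(_ _)/wrap[]; first by rewrite gtr0_norm// (le_trans h1).
  apply: le_trans; rewrite (_ : 3`! = 6%N)// exprS.
  have : 0 <= 4^-1 ^+ j * (1 - h ^+ 2) :> R by rewrite mulr_ge0// subr_ge0 expr_le1// ltW.
  have := q0 j.
  move: (4^-1 ^+ j) => q; lra.
have Qt : 4^-1 ^+ n / 3 <= \prod_(j < n - 2 + J) cos (theta (3 + j)).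
  rewrite big_split_ord/=; apply: ler_pM; rewrite ?exprn_ge0//.
    apply: (@le_trans _ _ (4^-1 ^+ (n - 2))).
      by rewrite ler_wiXn2l ?leq_subr// invf_le1// ler1n.
    rewrite -[X in _ ^+ X]card_ord -prodr_const; apply: ler_prod => j _.
    by rewrite invr_ge0 ler0n/= cos_theta_ge.
  have := @prod_ge_geometric (2 / 3) (fun j => cos (theta (3 + (n - 2 + j)))) J c23.
  move=> /(_ _)/wrap[]; last first.
    apply: le_trans; have := q1 J; have := q0 J; lra.
  move=> j; split => //.
  have -> : (3 + (n - 2 + j) = n + j.+1)%N by move: n3; clear; lia.
  have f0 : 0 < n`!%:R :> R by rewrite ltr0n fact_gt0.
  have t2 : `|t| <= 2 * n`!%:R.
    have g8 : g%:R <= n`!%:R / 8 :> R by rewrite ler_pdivlMr// -natrM ler_nat mulnC ltnW.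
    have p4 : pi < 4 :> R by have := @pihalf_lt2 R; lra.
    have p0 := @pi_ge0 R.
    have : pi * g%:R <= 4 * (n`!%:R / 8) :> R by apply: ler_pM => //; exact: ltW.
    have pg : 0 <= pi * g%:R :> R by rewrite mulr_ge0.
    have := f1 n.
    by rewrite /t -[2 * pi * _]mulrA; move: (pi * _) pg => pg' ? ? ?; rewrite ger0_norm; lra.
  have := one_minus_cos_le (theta (n + j.+1)).
  have : theta (n + j.+1) ^+ 2 <= (2 * 2^-1 ^+ j.+1) ^+ 2.
    rewrite -[leLHS]real_normK ?num_real// lerXn2r ?nnegrE ?mulr_ge0 ?exprn_ge0//.
    rewrite /theta normrM normfV normr_nat ler_pdivrMr ?ltr0n ?fact_gt0//.
    rewrite (le_trans t2)// -mulrA ler_pM2l// exprVn ler_pdivlMl ?exprn_gt0//.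
    by rewrite mulrC -natrX -natrM ler_nat fact_ge_expn// ltnW// ltnW.
  have -> : (2 * 2^-1 ^+ j.+1) ^+ 2 = 4 * 4^-1 ^+ j.+1 :> R.
    rewrite exprMn -exprM mulnC exprM (_ : 2^-1 ^+ 2 = 4^-1 :> R); last by field.
    by rewrite (_ : 2 ^+ 2 = 4 :> R)//; ring.
  rewrite -/(theta _).
  move: (4^-1 ^+ j.+1) => q; lra.
have q00 : 0 <= 4^-1 ^+ n / 3 :> R by rewrite divr_ge0.
have := ler_pM q00 (_ : 0 <= 3^-1) Qt Qh; rewrite -mulrA -invfM -natrM.
by apply; rewrite invr_ge0.
Qed.

(** The limit of [products_gap]; [96 = 3 * 32] absorbs the [1/9] of [Q_ge]. *)
Lemma cos_product_gap : (h / 96) ^+ 2 * 4^-1 ^+ n <= C (t + h) + C (t - h) - 2 * C h * C t.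
Proof.
have cvgK x : cos_partial (n + J) x @[J --> \oo] --> C x.
  under eq_fun do rewrite addnC.
  by have := @cvg_cos_partial x; rewrite -(cvg_shiftn n).
have c : cos_partial (n + J) (t + h) + cos_partial (n + J) (t - h) -
    2 * cos_partial (n + J) h * cos_partial (n + J) t @[J --> \oo] -->
    C (t + h) + C (t - h) - 2 * C h * C t.
  apply: cvgB; first by apply: cvgD; exact: cvgK.
  by apply: cvgM; [apply: cvgM; [exact: cvg_cst|exact: cvgK]|exact: cvgK].
rewrite -(cvg_lim _ c)//; apply: limr_ge; first exact: cvgP c.
apply: nearW => J.
have [+ _] := products_gap (n - 2 + J); have -> : (2 + (n - 2 + J) = n + J)%N by move: n3; clear; lia.
have q0 : 0 <= 4^-1 ^+ n / 9 :> R by rewrite divr_ge0// exprn_ge0.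
have := ler_pM (sqr_ge0 (h / 32)) q0 s_ge (Q_ge J).
have : 0 <= (h / 96) ^+ 2 * 4^-1 ^+ n by rewrite mulr_ge0 ?sqr_ge0 ?exprn_ge0.
rewrite (_ : (h / 32) ^+ 2 * (4^-1 ^+ n / 9) = (h / 96) ^+ 2 * 4^-1 ^+ n); last by field.
set a := (h / 96) ^+ 2 * _; set b := s * _.
set c1 := cos_partial _ _; set c2 := cos_partial _ _; set c3 := cos_partial _ _; set c4 := cos_partial _ _.
rewrite -[2 * _ * _]mulrA [c2 * c1]mulrC.
by move: (c1 * c2) => x; lra.
Qed.

End good_points.

End cosine_product.

(** Factorial number system: [g] is a sum of [d_m m!] with [d_m] below about [(m + 1) / 8] instead
    of [m + 1]. Reduction modulo [k!] truncates the expansion, so all residues inherit the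
    smallness. *)
Fixpoint good_naturals (n : nat) : seq nat :=
  if n is m.+1 then
    [seq g + d * m`! | d <- iota 0 (maxn 1 (m.+1 %/ 8)), g <- good_naturals m]%N
  else [:: 0%N].

Lemma good_naturalsP n g : g \in good_naturals n ->
  (8 * g < n`!)%N /\ forall k, (8 * (g %% k`!) < k`!)%N.
Proof.
elim: n g => [|n ih] g /=.
  by rewrite inE => /eqP ->; split => // k; rewrite mod0n muln0 fact_gt0.
move=> /allpairsP[[d g'] /= [dn g'n ->]].
have [g'1 g'2] := ih g' g'n.
(* Together with [8 g' < n!] this yields [8 (g' + d n!) < (8 d + 1) n! <= (n + 1)!]. *)
have h1 : (8 * d + 1 <= n.+1)%N by move: dn; rewrite mem_iota; clear; lia.
have h2 : (8 * (g' + d * n`!) < n.+1`!)%N.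
  rewrite factS (@leq_trans ((8 * d + 1) * n`!))//; last by rewrite leq_mul2r h1 orbT.
  by rewrite mulnDr mulnDl mul1n mulnA addnC ltn_add2l.
split => // k.
have [kn|nk] := leqP k n.
  have /dvdnP[q ->] : (k`! %| n`!)%N.
    by rewrite -(subnKC kn); elim: (n - k)%N => [|j jh]; rewrite ?addn0// addnS factS dvdn_mull.
  by rewrite mulnA [(g' + _)%N]addnC modnMDl.
have nk' : (n.+1`! <= k`!)%N by rewrite leq_fact.
have h3 := leq_trans h2 nk'; rewrite modn_small//.
by apply: leq_ltn_trans h3; rewrite leq_pmull.
Qed.

Lemma good_naturals_uniq n : uniq (good_naturals n).
Proof.
elim: n => //= n ih; apply: allpairs_uniq => //; first exact: iota_uniq.
move=> [d g] [d' g'] /allpairsP[[d1 g1] /= [_ g1n [-> ->]]] /allpairsP[[d2 g2] /= [_ g2n [-> ->]]].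
have lt x : x \in good_naturals n -> (x < n`!)%N.
  by move=> /good_naturalsP[+ _]; apply: leq_ltn_trans; rewrite leq_pmull.
move=> e; have dd : d1 = d2.
  by have := congr1 (divn^~ n`!) e; rewrite ![(_ + _ * _)%N]addnC !divnMDl ?fact_gt0// !divn_small ?lt// !addn0.
by move: e; rewrite dd => /addIn ->.
Qed.

(** Restricting a digit costs a factor [8], and rounding down costs at most another [2]. *)
Lemma size_good_naturals n : (n`! <= 16 ^ n * size (good_naturals n))%N.
Proof.
elim: n => // n ih.
rewrite /= size_allpairs size_iota expnS factS mulnACA leq_mul//.
by clear; lia.
Qed.

(** * Sum of squared gaps over a lattice *)

Section lattice_sum.
Context {R : realType}.
Local Notation C := (@cos_fact_product R).

(** From the first multiple of [h] beyond [a] on, the window of length [1/4] holds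
    [K = floor (1 / (4 h))] multiples, and [h <= 1/8] makes [K] at least half of [1 / (4 h)]. *)
Lemma count_lattice_ge (a h : R) (D : nat) : 0 <= a -> 0 < h <= 8^-1 -> a + 4^-1 < D%:R * h ->
  (8 * h)^-1 <= \sum_(d < D) (a <= d%:R * h <= a + 4^-1)%R%:R.
Proof.
move=> a0 /andP[h0 h8] aD.
have hi0 : 0 < h^-1 by rewrite invr_gt0.
have hh : h * h^-1 = 1 by rewrite mulfV// gt_eqF.
pose d0 := (Num.Def.truncn (a / h)).+1; pose K := Num.Def.truncn (h^-1 / 4).
have ah0 : 0 <= a / h by rewrite divr_ge0// ltW.
have /andP[d1] := truncn_itv ah0; rewrite -/d0 => d2.
have K0 : 0 <= h^-1 / 4 by rewrite divr_ge0// ltW.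
have /andP[k1 k2] := truncn_itv K0.
rewrite -/K in k1 k2; rewrite -[K.+1%:R]natr1 in k2.
have d0a : a <= d0%:R * h by rewrite -ler_pdivrMr// ltW.
have d0h : d0%:R * h <= a + h.
  rewrite -ler_pdivlMr// mulrDl divff ?gt_eqF// /d0 -natr1 lerD2r//.
have inP k : (k < K)%N -> a <= (d0 + k)%:R * h <= a + 4^-1.
  move=> kK; rewrite natrD mulrDl; apply/andP; split.
    by rewrite (le_trans d0a)// lerDl mulr_ge0// ltW.
  have : k.+1%:R * h <= 4^-1.
    rewrite -ler_pdivlMr// mulrC (le_trans _ k1)// ?ler_nat//.
  rewrite -natr1 mulrDl mul1r; lra.
have KD : (K <= \sum_(d < D) (a <= d%:R * h <= a + 4^-1)%R)%N.
  rewrite -(big_mkord xpredT (fun d => (a <= d%:R * h <= a + 4^-1)%R : nat)).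
  have -> : (\sum_(0 <= d < D) (a <= d%:R * h <= a + 4^-1)%R)%N =
      size [seq d <- iota 0 D | (a <= d%:R * h <= a + 4^-1)%R].
    rewrite /index_iota subn0 size_filter -sum1_count [in RHS]big_mkcond/=.
    by apply: eq_bigr => j _; case: (_ <= _ <= _).
  rewrite -{1}(size_iota d0 K); apply: uniq_leq_size; first exact: iota_uniq.
  move=> d; rewrite mem_iota => /andP[dd dK].
  have := inP (d - d0)%N; rewrite subnKC// ltn_subLR// => /(_ dK) dP.
  rewrite mem_filter dP mem_iota/= add0n -(ltr_nat R) -(ltr_pM2r h0).
  by case/andP: dP => _ /le_lt_trans; apply.
rewrite -natr_sum (le_trans _ (_ : K%:R <= _))//; last by rewrite ler_nat.
have : 8 <= h^-1 by rewrite -[leLHS]invrK lef_pV2// posrE// invr_gt0.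
rewrite invfM; lra.
Qed.

(** The windows [[2 pi g + 1/4, 2 pi g + 1/2]] are disjoint for distinct [g], so the indicators of
    the good windows sum to at most [1] at each lattice point, and each window contains at least
    [1 / (8 h)] points. *)
Lemma lattice_sum_ge n (h : R) (D : nat) : (3 <= n)%N -> 0 < h <= 8^-1 ->
  n`!%:R <= D%:R * h ->
  ((h / 96) ^+ 2 * 4^-1 ^+ n) ^+ 2 * ((size (good_naturals n))%:R / (8 * h)) <=
  \sum_(d < D) (C (d%:R * h + h) + C (d%:R * h - h) - 2 * C h * C (d%:R * h)) ^+ 2.
Proof.
move=> n3 h8 nD; have /andP[h0 h81] := h8.
set c := (h / 96) ^+ 2 * _.
have c0 : 0 <= c by rewrite mulr_ge0 ?sqr_ge0// exprn_ge0.
pose Pg g (d : nat) := (2 * pi * g%:R + 4^-1 <= d%:R * h <= 2 * pi * g%:R + 4^-1 + 4^-1).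
set G := good_naturals n.
apply: (@le_trans _ _ (\sum_(d < D) c ^+ 2 * \sum_(g <- G) (Pg g d)%:R)); last first.
  apply: ler_sum => d _; have [hG|nG] := boolP (has (Pg^~ d) G); last first.
    rewrite big1_seq ?mulr0 ?sqr_ge0// => g /= gG.
    by move: nG => /hasPn/(_ g gG)/negbTE ->.
  have /hasP[g gG Pgd] := hG.
  have -> : \sum_(g <- G) (Pg g d)%:R = 1 :> R.
    rewrite (bigD1_seq g)//= ?good_naturals_uniq// Pgd big1_seq ?addr0// => g' /andP[g'g g'G].
    case: (boolP (Pg g' d)) => // Pg'd; exfalso; move: g'g; apply/negP; rewrite negbK.
    have p2 := @pi_ge2 R.
    have sep (x y : nat) : Pg x d -> Pg y d -> ~~ (x < y)%N.
      move=> /andP[_ x2] /andP[y1 _]; apply/negP => xy.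
      have : x.+1%:R <= y%:R :> R by rewrite ler_nat.
      rewrite -natr1 => xy'; have : 2 * pi * (x%:R + 1) <= 2 * pi * y%:R :> R.
        by rewrite ler_wpM2l// mulr_ge0// pi_ge0.
      rewrite mulrDr mulr1; move: x2 y1 p2.
      by move: (d%:R * h) (2 * pi * x%:R) (2 * pi * y%:R) => z a b; move: pi => p; lra.
    by rewrite eqn_leq leqNgt sep// leqNgt sep.
  have gap : c <= C (d%:R * h + h) + C (d%:R * h - h) - 2 * C h * C (d%:R * h).
    have [g1 g2] := good_naturalsP gG.
    have := @cos_product_gap R n g (d%:R * h - 2 * pi * g%:R) h n3 g1 g2.
    rewrite subrKC; apply; last by rewrite h0 (le_trans h81)// invf_le1// ler1n.
    have := Pgd; rewrite /Pg; move: (d%:R * h) (2 * pi * g%:R) => z a /andP[z1 z2].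
    by apply/andP; split; lra.
  by rewrite mulr1 lerXn2r ?nnegrE// (le_trans c0).
rewrite -mulr_sumr exchange_big/= ler_wpM2l ?exprn_ge0//.
rewrite -sum1_size natr_sum mulr_suml big_seq [leRHS]big_seq; apply: ler_sum => g gG.
rewrite (_ : 1%:R / (8 * h) = (8 * h)^-1); last by rewrite div1r.
apply: (@count_lattice_ge (2 * pi * g%:R + 4^-1)) => //.
  by rewrite addr_ge0// !mulr_ge0// pi_ge0.
have [g8 _] := good_naturalsP gG.
apply: lt_le_trans nD.
(* The window ends before the lattice does: [2 pi g + 1/2 < 8 g + 1 <= n!]. *)
have : 8 * g%:R + 1 <= n`!%:R :> R by rewrite -natrM natr1 ler_nat.
have p4 : pi < 4 :> R by have := @pihalf_lt2 R; lra.
have : pi * g%:R <= 4 * g%:R :> R by rewrite ler_wpM2r// ltW.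
by rewrite -[2 * pi * _]mulrA; move: (pi * _) => x; lra.
Qed.

End lattice_sum.

Lemma sqr_sum_le (R : realFieldType) (n : nat) (a : 'I_n -> R) :
  (\sum_(i < n) a i) ^+ 2 <= n%:R * \sum_(i < n) a i ^+ 2.
Proof.
have -> : (\sum_(i < n) a i) ^+ 2 = \sum_(i < n) \sum_(j < n) a i * a j.
  by rewrite expr2 big_distrlr.
have -> : n%:R * \sum_(i < n) a i ^+ 2 = \sum_(i < n) \sum_(j < n) ((a i ^+ 2 + a j ^+ 2) / 2).
  under [RHS]eq_bigr do rewrite -mulr_suml big_split/= sumr_const card_ord.
  rewrite -mulr_suml big_split/= sumr_const card_ord sumrMnl.
  by rewrite -[_ *+ n]mulr_natl; field.
apply: ler_sum => i _; apply: ler_sum => j _.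
by rewrite ler_pdivlMr// -subr_ge0 (_ : _ - _ = (a i - a j) ^+ 2) ?sqr_ge0//; ring.
Qed.

(** * Variance of the number of sign changes on a grid *)

Section sign_change_variance.
Context d (T : measurableType d) (R : realType) (P : probability T R).
Variable H : set (T -> R).
Hypothesis gH : centered_gaussian_space P H.
Variables (x : nat -> T -> R) (C : R -> R) (h : R).
Hypothesis Hx : forall i, H (x i).
Hypothesis covx : forall i j, \int[P]_w (x i w * x j w) = C (i%:R * h - j%:R * h).
Hypotheses (C0 : C 0 = 1) (C1 : forall t, `|C t| <= 1) (CN : forall t, C (- t) = C t).
Let r := C h.
Hypothesis r1 : `|r| < 1.
Variable M : nat.
Hypothesis M0 : (0 < M)%N.

Let cell j w : R := (x j w * x j.+1 w < 0)%R%:R.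
Let N w : R := \sum_(j < M) cell j w.
Let y i w : R := 2 * (x i w * x i.+1 w) - r * (x i w ^+ 2 + x i.+1 w ^+ 2).
Let gam i j := \int[P]_w (x i w * x j w).
Let q : R := pi * Num.sqrt (1 - r ^+ 2).

Let mx i : measurable_fun setT (x i). Proof. exact: (gspace_measurable gH). Qed.

Let gam_diag i : \int[P]_w x i w ^+ 2 = 1.
Proof.
transitivity (gam i i); first by apply: eq_Rintegral => w _; rewrite expr2.
by rewrite /gam covx subrr.
Qed.

Let gamS i : gam i i.+1 = r.
Proof.
by rewrite /gam covx -natr1 mulrDl mul1r opprD addrA subrr add0r CN.
Qed.

Let gamSS i j : gam i.+1 j.+1 = gam i j.
Proof. by rewrite /gam !covx; congr C; rewrite -!natr1; ring. Qed.

Let mcell j : measurable_fun setT (cell j).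
Proof. by apply: measurable_lt_indic; exact: measurable_funM. Qed.

Let cell1 j w : `|cell j w| <= 1. Proof. exact: natr_bool_le1. Qed.

Let rm : 0 < 1 - r. Proof. by move: r1; rewrite ltr_norml => /andP[? ?]; lra. Qed.

Let rr : 0 < 1 - r ^+ 2.
Proof. by rewrite subr_gt0 -[r ^+ 2]real_normK ?num_real// expr_lt1. Qed.

Let q0 : 0 < q. Proof. by rewrite mulr_gt0 ?pi_gt0 ?sqrtr_gt0. Qed.

Let isqr Z : H Z -> P.-integrable setT (EFin \o (fun w => Z w ^+ 2)).
Proof. exact: (gspace_integrable_pow gH 2). Qed.

Let sumx i w : R := 1 * x i w + 1 * x i.+1 w.

Let Hsum i : H (sumx i). Proof. exact: (gspaceD gH). Qed.

(** Polarization: [sign_change_cov] concerns squares of elements of the space, so the product in [y]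
    is rewritten by means of squares. *)
Let yE i w : y i w = sumx i w ^+ 2 + - (1 + r) * (x i w ^+ 2 + x i.+1 w ^+ 2).
Proof. by rewrite /y /sumx; ring. Qed.

Let iy i : P.-integrable setT (EFin \o y i).
Proof.
have e : y i = fun w => sumx i w ^+ 2 + - (1 + r) * (x i w ^+ 2 + x i.+1 w ^+ 2).
  by apply/funext => w; exact: yE.
rewrite e; apply: integrable_EFinD; first exact: isqr.
by apply: integrable_EFinZ; apply: integrable_EFinD; exact: isqr.
Qed.

Let var_sum i : \int[P]_w sumx i w ^+ 2 = 2 * (1 + r).
Proof. by rewrite (gspace_varD gH)// !gam_diag -/(gam _ _) gamS; ring. Qed.

Let mean_y i : \int[P]_w y i w = 0.
Proof.
under eq_Rintegral do rewrite yE.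
rewrite RintegralD//; [|exact: isqr|]; last first.
  by apply: integrable_EFinZ; apply: integrable_EFinD; exact: isqr.
rewrite RintegralZl//; last by apply: integrable_EFinD; exact: isqr.
rewrite RintegralD//; [|exact: isqr|exact: isqr].
by rewrite var_sum !gam_diag; ring.
Qed.

(** Half the covariance of [y j] and [y i], arranged as a square plus a term whose double sum
    telescopes. *)
Let kap j i := (gam j.+1 i + gam j i.+1 - 2 * r * gam j i) ^+ 2 +
  (1 - r ^+ 2) * (2 * gam j i ^+ 2 - gam j.+1 i ^+ 2 - gam j i.+1 ^+ 2).

Let cell_cov j i : \int[P]_w (cell j w * y i w) = - (kap j i / q).
Proof.
have iC Z : H Z -> P.-integrable setT (EFin \o (fun w => cell j w * Z w ^+ 2)).
  by move=> HZ; apply: (integrable_boundedM (mcell j) (cell1 j)); exact: isqr.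
transitivity (\int[P]_w (cell j w * sumx i w ^+ 2 + - (1 + r) * (cell j w * x i w ^+ 2 + cell j w * x i.+1 w ^+ 2))).
  by apply: eq_Rintegral => w _; rewrite yE; ring.
rewrite RintegralD//; [|exact: iC|]; last first.
  by apply: integrable_EFinZ; apply: integrable_EFinD; exact: iC.
rewrite RintegralZl//; last by apply: integrable_EFinD; exact: iC.
rewrite RintegralD//; [|exact: iC|exact: iC].
have rj : `|\int[P]_w (x j w * x j.+1 w)| < 1 by rewrite -/(gam _ _) gamS.
have sc := sign_change_cov gH (Hx j) (Hx j.+1) (gam_diag j) (gam_diag j.+1) rj.
rewrite (sc _ (Hsum i)) (sc _ (Hx i)) (sc _ (Hx i.+1)) var_sum !gam_diag.
have covs k : \int[P]_w (x k w * sumx i w) = gam k i + gam k i.+1.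
  rewrite gspace_covC (gspace_covDl gH)// ![\int[P]_w (_ * x k w)]gspace_covC; rewrite /gam; ring.
rewrite !covs -!/(gam _ _) gamS gamSS -/q /kap.
move: (gam j i) (gam j.+1 i) (gam j i.+1) => a b e.
move: (\int[P]_w _) => p.
by field; rewrite gt_eqF.
Qed.

(** As [gam] is constant along diagonals, the second part of [kap] telescopes in both indices. Only
    the corners remain: [2 - gam 0 M ^ 2 - gam M 0 ^ 2], which is nonnegative. *)
Let sum_kap_ge : \sum_(j < M) \sum_(i < M) (gam j.+1 i + gam j i.+1 - 2 * r * gam j i) ^+ 2 <=
  \sum_(j < M) \sum_(i < M) kap j i.
Proof.
rewrite /kap; under [leRHS]eq_bigr do rewrite big_split/= -mulr_sumr.
rewrite big_split/= -mulr_sumr lerDl mulr_ge0 ?(ltW rr)//.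
have g2 i j : gam i j ^+ 2 <= 1.
  by rewrite -[leLHS]real_normK ?num_real// expr_le1// /gam covx C1.
pose D j := gam j 0 ^+ 2 - gam j M ^+ 2.
have -> : \sum_(j < M) \sum_(i < M) (2 * gam j i ^+ 2 - gam j.+1 i ^+ 2 - gam j i.+1 ^+ 2) =
    \sum_(j < M) (D j - D j.+1).
  apply: eq_bigr => j _.
  have tele k : \sum_(i < M) (gam k i ^+ 2 - gam k i.+1 ^+ 2) = D k.
    rewrite -(big_mkord xpredT (fun i => gam k i ^+ 2 - gam k i.+1 ^+ 2)).
    under eq_bigr do rewrite -opprB.
    by rewrite sumrN telescope_sumr// opprB.
  rewrite -!tele -sumrB; apply: eq_bigr => i _; rewrite gamSS; ring.
rewrite -(big_mkord xpredT (fun j => D j - D j.+1)).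
under eq_bigr do rewrite -opprB.
rewrite sumrN telescope_sumr// opprB /D.
have gd k : gam k k = 1 by rewrite /gam covx subrr.
rewrite !gd expr1n; have := g2 0%N M; have := g2 M 0%N; lra.
Qed.

Let Delta i w : R := 1 * x i w + (-1) * x i.+1 w.

Let HDelta i : H (Delta i). Proof. exact: (gspaceD gH). Qed.

(** In [y = - Delta^2 + (1 - r) (x_i^2 + x_(i+1)^2)] both terms are of order [1 - r]. With
    [E Delta^2 = 2 (1 - r)] and Gaussian fourth moments the two parts of the bound integrate to
    [24 (1 - r)^2] each. *)
Let bound i w : R := 2 * Delta i w ^+ 4 + 4 * (1 - r) ^+ 2 * (x i w ^+ 4 + x i.+1 w ^+ 4).

Let y_bound i w : y i w ^+ 2 <= bound i w.
Proof.
have -> : y i w = - Delta i w ^+ 2 + (1 - r) * (x i w ^+ 2 + x i.+1 w ^+ 2).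
  by rewrite /y /Delta; ring.
rewrite /bound; move: (Delta i w) (x i w) (x i.+1 w) => D a b.
have := sqr_ge0 (D ^+ 2 + (1 - r) * (a ^+ 2 + b ^+ 2)).
have : 0 <= 2 * (1 - r) ^+ 2 * (a ^+ 2 - b ^+ 2) ^+ 2 by apply: mulr_ge0; [apply: mulr_ge0 => //|]; exact: sqr_ge0.
move=> h1 h2; rewrite -subr_ge0; apply: le_trans (addr_ge0 h1 h2) _.
by rewrite le_eqVlt; apply/orP; left; apply/eqP; ring.
Qed.

Let i4 Z : H Z -> P.-integrable setT (EFin \o (fun w => Z w ^+ 4)).
Proof. exact: (gspace_integrable_pow gH 4). Qed.

Let ibound i : P.-integrable setT (EFin \o bound i).
Proof.
apply: integrable_EFinD; first by apply: integrable_EFinZ; exact: i4.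
by apply: integrable_EFinZ; apply: integrable_EFinD; exact: i4.
Qed.

Let int_bound i : \int[P]_w bound i w = 48 * (1 - r) ^+ 2.
Proof.
rewrite RintegralD//; last 2 first.
- by apply: integrable_EFinZ; exact: i4.
- by apply: integrable_EFinZ; apply: integrable_EFinD; exact: i4.
rewrite !RintegralZl//; [|by apply: integrable_EFinD; exact: i4|exact: i4].
rewrite RintegralD//; [|exact: i4|exact: i4].
rewrite !(gspace_moment4 gH)// !gam_diag (gspace_varD gH)// !gam_diag -/(gam _ _) gamS.
by ring.
Qed.

(** Cauchy-Schwarz against [Y], the sum of the [y i]. The centring [c] is free because [Y] has mean
    zero. *)
Lemma sign_change_variance_ge (c : R) :
  (\sum_(j < M) \sum_(i < M) (C (j%:R * h - i%:R * h + h) + C (j%:R * h - i%:R * h - h) -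
     2 * C h * C (j%:R * h - i%:R * h)) ^+ 2) ^+ 2 <=
  \int[P]_w (N w - c) ^+ 2 * (48 * M%:R ^+ 2 * (1 - r) ^+ 2) * (pi ^+ 2 * (1 - r ^+ 2)).
Proof.
set S := \sum_(j < M) _.
have SE : S = \sum_(j < M) \sum_(i < M) (gam j.+1 i + gam j i.+1 - 2 * r * gam j i) ^+ 2.
  apply: eq_bigr => j _; apply: eq_bigr => i _; rewrite /gam !covx.
  by congr ((C _ + C _ - _) ^+ 2); rewrite -natr1; ring.
have S0 : 0 <= S by apply: sumr_ge0 => j _; apply: sumr_ge0 => i _; exact: sqr_ge0.
pose F w := N w - c; pose Y w := \sum_(i < M) y i w.
pose BB w := M%:R * \sum_(i < M) bound i w.
have SK := sum_kap_ge; set K := \sum_(j < M) \sum_(i < M) kap j i in SK.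
have mN : measurable_fun setT N by apply: measurable_sum => j; exact: mcell.
have mF : measurable_fun setT F by exact: measurable_funB.
have F1 w : `|F w| <= M%:R + `|c|.
  rewrite (le_trans (ler_normB _ _))// lerD2r (le_trans (ler_norm_sum _ _ _))//.
  have h1 : \sum_(j < M) `|cell j w| <= \sum_(j < M) 1 by apply: ler_sum => j _; exact: cell1.
  by rewrite (le_trans h1)// sumr_const card_ord.
have iF2 : P.-integrable setT (EFin \o (fun w => F w ^+ 2)).
  apply: (@integrable_bounded _ _ _ _ _ ((M%:R + `|c|) ^+ 2)); first exact: measurable_funX.
  by move=> w; rewrite normrX lerXn2r ?nnegrE ?addr_ge0.
have iY : P.-integrable setT (EFin \o Y) by apply: integrable_EFin_sum.
have iFY : P.-integrable setT (EFin \o (fun w => F w * Y w)).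
  exact: (integrable_boundedM mF F1).
have iBB : P.-integrable setT (EFin \o BB).
  by apply: integrable_EFinZ; exact: integrable_EFin_sum.
have intBB : \int[P]_w BB w = 48 * M%:R ^+ 2 * (1 - r) ^+ 2.
  rewrite RintegralZl//; last exact: integrable_EFin_sum.
  rewrite Rintegral_sum//; under eq_bigr do rewrite int_bound.
  by rewrite sumr_const card_ord -mulr_natr; ring.
have intFY : \int[P]_w (F w * Y w) = - (K / q).
  transitivity (\int[P]_w (\sum_(j < M) \sum_(i < M) cell j w * y i w + - c * Y w)).
    apply: eq_Rintegral => w _; rewrite /F mulrBl mulNr; congr (_ - _).
    by rewrite /N /Y big_distrlr.
  have icy j i : P.-integrable setT (EFin \o (fun w => cell j w * y i w)).
    exact: (integrable_boundedM (mcell j) (cell1 j)).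
  rewrite RintegralD//; last 2 first.
  - by apply: integrable_EFin_sum => j; apply: integrable_EFin_sum.
  - exact: integrable_EFinZ.
  have Y0 : \int[P]_w Y w = 0 by rewrite Rintegral_sum// big1.
  rewrite RintegralZl// Y0 mulr0 addr0.
  rewrite Rintegral_sum; last by move=> j; apply: integrable_EFin_sum.
  rewrite /K mulr_suml -sumrN; apply: eq_bigr => j _.
  rewrite Rintegral_sum// mulr_suml -sumrN; apply: eq_bigr => i _.
  exact: cell_cov.
set V := \int[P]_w (N w - c) ^+ 2; set B := 48 * _ * _ in intBB *.
have B0 : 0 < B by rewrite /B mulr_gt0 ?exprn_gt0// mulr_gt0 ?exprn_gt0// ltr0n.
(* Nonnegativity of [E (F - s Y)^2], with [Y^2] replaced by its majorant [BB]; optimizing [s] gives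
   the Cauchy-Schwarz bound. *)
have quad s : 0 <= V - 2 * s * - (K / q) + s ^+ 2 * B.
  have -> : V - 2 * s * - (K / q) + s ^+ 2 * B =
      \int[P]_w (F w ^+ 2 + (- (2 * s) * (F w * Y w) + s ^+ 2 * BB w)).
    rewrite RintegralD//; last by apply: integrable_EFinD; exact: integrable_EFinZ.
    rewrite RintegralD//; [|exact: integrable_EFinZ|exact: integrable_EFinZ].
    by rewrite [X in _ + (X + _)]RintegralZl// [X in _ + (_ + X)]RintegralZl// intFY intBB /V; ring.
  apply: Rintegral_ge0 => w _.
  have Y2 : Y w ^+ 2 <= BB w.
    rewrite (le_trans (sqr_sum_le _))// /BB ler_wpM2l//; apply: ler_sum => i _; exact: y_bound.
  have := ler_wpM2l (sqr_ge0 s) Y2; have := sqr_ge0 (F w - s * Y w).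
  move: (F w) (Y w) (BB w) => a b e; rewrite sqrrB; lra.
have AB : (K / q) ^+ 2 <= V * B.
  have := quad (- (K / q) / B).
  rewrite (_ : _ + _ = V - (K / q) ^+ 2 / B); last by field; rewrite !gt_eqF.
  by rewrite subr_ge0 ler_pdivrMr.
have -> : pi ^+ 2 * (1 - r ^+ 2) = q ^+ 2 by rewrite /q exprMn sqr_sqrtr// ltW.
apply: (@le_trans _ _ (K ^+ 2)).
  by rewrite -SE in SK; rewrite lerXn2r ?nnegrE// (le_trans S0).
by rewrite -ler_pdivrMr ?exprn_gt0// -expr_div_n.
Qed.

End sign_change_variance.

(** * The Gaussian space spanned by a process *)

Section gaussian_process_space.
Context d (T : measurableType d) (R : realType) (P : probability T R).

Variable X : R -> {RV P >-> R}.
Hypotheses (gX : gaussian_process P X) (cX : centered_process P X).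

Definition linear_combination (s : seq (R * R)) (w : T) : R := \sum_(p <- s) p.1 * X p.2 w.

Lemma gaussian_process_space :
  centered_gaussian_space P (range linear_combination).
Proof.
have mX t : measurable_fun setT (X t : T -> R) by exact: measurable_funPT.
have lawX s : gaussian_law P (linear_combination s).
  have := gX (fun i => (tnth (in_tuple s) i).2) (fun i => (tnth (in_tuple s) i).1).
  rewrite (_ : (fun w => _) = linear_combination s)//; apply/funext => w.
  by rewrite /linear_combination [RHS]big_tnth.
have iX t : P.-integrable setT (EFin \o (X t : T -> R)).
  apply: gaussian_law_integrable => //.
  have := lawX [:: (1, t)]; congr gaussian_law; apply/funext => w.
  by rewrite /linear_combination big_seq1 mul1r.
have X0 t : \int[P]_w X t w = 0.
  by have := cX t; rewrite unlock /Rintegral => ->.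
split.
  move=> a b _ _ [s _ <-] [s' _ <-].
  exists ([seq (a * p.1, p.2) | p <- s] ++ [seq (b * p.1, p.2) | p <- s']) => //.
  apply/funext => w; rewrite /linear_combination big_cat/= !big_map/= !mulr_sumr.
  by congr (_ + _); apply: eq_bigr => p _; rewrite mulrA.
move=> _ [s _ <-]; split.
- by apply: measurable_sum => p; exact: measurable_funM.
- exact: lawX.
rewrite Rintegral_sum; last by move=> p; exact: integrable_EFinZ.
by rewrite big1// => p _; rewrite RintegralZl// X0 mulr0.
Qed.

Lemma gaussian_process_mem t : range linear_combination (X t : T -> R).
Proof.
exists [:: (1, t)] => //; apply/funext => w.
by rewrite /linear_combination big_seq1 mul1r.
Qed.

Lemma gaussian_process_cov (C : R -> R) : has_reduced_covariance P X C ->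
  forall s t, \int[P]_w (X s w * X t w) = C (s - t).
Proof.
move=> covX s t; have := covX s t; rewrite unlock.
have E0 u : fine 'E_P[X u] = 0 by rewrite cX.
rewrite !E0.
rewrite unlock /Rintegral => /(congr1 fine) /= <-; congr fine.
apply: eq_integral => w _.
by rewrite (_ : ((X s \- cst 0) * (X t \- cst 0)) w = (X s w - 0) * (X t w - 0))// !subr0.
Qed.

End gaussian_process_space.

Section nonmeasurable_minorant.
Context d (T : measurableType d) (R : realType) (mu : {measure set T -> \bar R}).

(** The integral of a nonnegative function is a supremum over simple functions below it, hence
    monotone even for nonmeasurable [f]. It is applied to the squared deviation of the number of
    zeros, whose measurability is controlled only off a null set. *)
Lemma ge0_le_integral_nonmeasurable (g f : T -> \bar R) :
  (forall w, 0 <= g w)%E -> (forall w, g w <= f w)%E ->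
  (\int[mu]_w g w <= \int[mu]_w f w)%E.
Proof.
move=> g0 gf; have f0 w : (0 <= f w)%E := le_trans (g0 w) (gf w).
rewrite !ge0_integralE//; apply: ereal_sup_le => _ [h hg <-].
exists h => // w; apply: le_trans (hg w) _.
by rewrite !patch_setT.
Qed.

End nonmeasurable_minorant.

(** For each [i < M] only the rows [j = i + e] with [e < M] are kept; all discarded terms are
    nonnegative. *)
Lemma double_sum_ge (R : realDomainType) (F : R -> R) (h : R) (M : nat) :
  (forall t, 0 <= F t) ->
  M%:R * (\sum_(e < M) F (e%:R * h)) <=
  \sum_(j < M + M) \sum_(i < M + M) F (j%:R * h - i%:R * h).
Proof.
move=> F0; rewrite exchange_big/= big_split_ord/=.
apply: ler_wpDr; first by apply: sumr_ge0 => i _; exact: sumr_ge0.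
rewrite -[X in X%:R * _](card_ord M) -sum1_card natr_sum mulr_suml.
apply: ler_sum => i _; rewrite mul1r.
rewrite -(big_mkord xpredT (fun j => F (j%:R * h - i%:R * h))).
have iM : (i + M <= M + M)%N by rewrite leq_add2r ltnW.
rewrite (big_cat_nat (n := i)) ?(leq_trans _ iM) ?leq_addr//= ler_wpDl ?sumr_ge0//.
rewrite (big_cat_nat (n := i + M)) ?leq_addr//= ler_wpDr ?sumr_ge0//.
rewrite -{1}[i : nat]add0n big_addn addKn big_mkord le_eqVlt; apply/orP; left; apply/eqP.
by apply: eq_bigr => e _; rewrite natrD mulrDl addrK.
Qed.

(** [96^-4] comes from the squared gap. In [640 = 8 * 80], the [8] is that of [1 / (8 h)], and [80]
    satisfies [80^2 >= 6144 = 48 * 4 * 16 * 2], the constants of the Cauchy-Schwarz bound. *)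
Definition gap_constant (R : realFieldType) : R := 96^-1 ^+ 4 / 640.

Lemma gap_constant_gt0 (R : realFieldType) : 0 < gap_constant R.
Proof.
apply: divr_gt0; last by rewrite ltr0n.
by apply: exprn_gt0; rewrite invr_gt0 ltr0n.
Qed.

(** The mesh cancels: [S] is at least [M h^3 v], while the factor of [V] is at most [(80 M h^3)^2],
    because [1 - r <= h^2] and [1 - r^2 <= 2 h^2]. *)
Lemma variance_arithmetic (R : realFieldType) (M h G q b r V S p : R) :
  0 < M -> 0 < h -> 0 <= G -> 0 <= q -> 0 <= b -> 0 <= r < 1 -> 1 - r <= h ^+ 2 ->
  0 <= V -> 0 <= p <= 4 ->
  M * (((h * b) ^+ 2 * q) ^+ 2 * (G / (8 * h))) <= S ->
  S ^+ 2 <= V * (48 * (2 * M) ^+ 2 * (1 - r) ^+ 2) * (p ^+ 2 * (1 - r ^+ 2)) ->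
  (G * q ^+ 2 * (b ^+ 4 / 640)) ^+ 2 <= V.
Proof.
move=> M0 h0 G0 q0 b0 /andP[r0 r1] rh V0 /andP[p0 p4] MS SV.
pose u := M * h ^+ 3; pose v := G * q ^+ 2 * b ^+ 4 / 8.
have u0 : 0 < u by rewrite mulr_gt0 ?exprn_gt0.
have v0 : 0 <= v by rewrite divr_ge0// !mulr_ge0 ?exprn_ge0.
have uv : u * v <= S.
  by apply: le_trans MS; rewrite le_eqVlt; apply/orP; left; apply/eqP; rewrite /u /v; field; rewrite gt_eqF.
have p16 : p ^+ 2 <= 16 by have : p ^+ 2 <= 4 ^+ 2 by [rewrite lerXn2r ?nnegrE]; lra.
have m0 : 0 <= 1 - r by rewrite subr_ge0 ltW.
have r2 : 1 - r ^+ 2 <= 2 * h ^+ 2.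
  rewrite (_ : 1 - r ^+ 2 = (1 + r) * (1 - r)); last by ring.
  by apply: ler_pM => //; lra.
have r20 : 0 <= 1 - r ^+ 2 by rewrite subr_ge0 expr_le1// ltW.
have r4 : (1 - r) ^+ 2 <= h ^+ 4.
  rewrite (_ : h ^+ 4 = (h ^+ 2) ^+ 2); last by rewrite -exprM.
  by rewrite lerXn2r ?nnegrE ?sqr_ge0.
have M2 : 0 <= 48 * (2 * M) ^+ 2 by rewrite mulr_ge0// sqr_ge0.
have h1 : 48 * (2 * M) ^+ 2 * (1 - r) ^+ 2 * (p ^+ 2 * (1 - r ^+ 2)) <=
    48 * (2 * M) ^+ 2 * h ^+ 4 * (16 * (2 * h ^+ 2)).
  apply: ler_pM.
  - by rewrite mulr_ge0// sqr_ge0.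
  - by rewrite mulr_ge0// sqr_ge0.
  - by rewrite ler_wpM2l.
  - by apply: ler_pM => //; rewrite sqr_ge0.
have h2 : 48 * (2 * M) ^+ 2 * h ^+ 4 * (16 * (2 * h ^+ 2)) <= (80 * u) ^+ 2.
  rewrite (_ : 48 * (2 * M) ^+ 2 * h ^+ 4 * _ = 6144 * u ^+ 2); last by rewrite /u; ring.
  rewrite (_ : (80 * u) ^+ 2 = 6400 * u ^+ 2); last by ring.
  by have := sqr_ge0 u; move: (u ^+ 2) => x; lra.
have h3 : (u * v) ^+ 2 <= V * (80 * u) ^+ 2.
  apply: (@le_trans _ _ (S ^+ 2)).
    by rewrite lerXn2r ?nnegrE// ?(le_trans _ uv)// mulr_ge0// ltW.
  rewrite (le_trans SV)// -mulrA ler_wpM2l//; exact: le_trans h2.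
have u2 : 0 < (80 * u) ^+ 2 by rewrite exprn_gt0// mulr_gt0.
move: h3; rewrite -ler_pdivrMr//; apply: le_trans.
by rewrite le_eqVlt; apply/orP; left; apply/eqP; rewrite /v; field; rewrite gt_eqF.
Qed.

(** * From sign changes to the number of zeros *)

Section counting_zeros.
Context d (T : measurableType d) (R : realType) (P : probability T R).
Variable X : R -> {RV P >-> R}.
Hypotheses (gX : gaussian_process P X) (cX : centered_process P X).
Local Notation C := (@cos_fact_product R).
Hypothesis covX : has_reduced_covariance P X C.
Hypothesis contX : forall w, continuous (fun t => X t w).
Variable T0 : R.
Hypothesis T00 : 0 < T0.
Local Notation grid := (dyadic (- T0) T0).
Local Notation H := (range (linear_combination X)).
Let gH : centered_gaussian_space P H := gaussian_process_space gX cX.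
Let HX t : H (X t : T -> R) := gaussian_process_mem X t.
Let covC := gaussian_process_cov cX covX.

Let mX t : measurable_fun setT (X t : T -> R). Proof. exact: measurable_funPT. Qed.

Let X1 t : \int[P]_w X t w ^+ 2 = 1.
Proof.
transitivity (\int[P]_w (X t w * X t w)); first by apply: eq_Rintegral => w _; rewrite expr2.
by rewrite covC subrr cos_product0.
Qed.

Let pT : - T0 < T0. Proof. by rewrite (lt_trans _ T00)// oppr_lt0. Qed.

Let C_half t : `|t| <= 2^-1 -> 2^-1 <= C t.
Proof.
move=> t2; apply: le_trans (cos_product_ge (le_trans t2 _)); last by rewrite invf_le1// ler1n.
have : t ^+ 2 <= 2^-1 ^+ 2 by rewrite -[t ^+ 2]real_normK ?num_real// lerXn2r ?nnegrE.
rewrite (_ : 2^-1 ^+ 2 = 4^-1 :> R); last by field.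
lra.
Qed.

Lemma transverse_ae : P.-negligible [set w | ~ transverse (fun t => X t w) (- T0) T0].
Proof.
pose Z m j := [set w | X (grid m j) w = 0].
pose A m j := [set w | (T0 - - T0) / 2 ^+ m <= 2^-1 /\
  tangent (fun t => X t w) (grid m j) (grid m j.+1)].
pose B m j := [set w | (T0 - - T0) / 2 ^+ m <= 2^-1 /\
  tangent (fun t => - X t w) (grid m j) (grid m j.+1)].
have nZ m j : P.-negligible (Z m j).
  apply/negligibleP; last exact: (standard_normal_neq0 gH).
  have := mX (grid m j) measurableT (measurable_set1 0); rewrite setTI.
  by congr measurable.
have step m j : (T0 - - T0) / 2 ^+ m <= 2^-1 -> grid m j < grid m j.+1 /\
    forall t, t \in `[grid m j, grid m j.+1] -> 2^-1 <= C (t - grid m j).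
  move=> h2; rewrite dyadicS; split; first by rewrite ltrDl divr_gt0// ?exprn_gt0// subr_gt0.
  move=> t; rewrite in_itv/= => /andP[t1 t2]; apply: C_half.
  by rewrite ger0_norm ?subr_ge0// (le_trans _ h2)// lerBlDl.
have nA m j : P.-negligible (A m j).
  have [h2|h2] := boolP ((T0 - - T0) / 2 ^+ m <= 2^-1); last first.
    by apply: negligibleS (negligible_set0 _) => w [] h; rewrite h in h2.
  have [s1 s2] := step m j h2.
  apply: negligibleS (tangent_negligible gH s1 contX HX X1 _); first by move=> w [].
  by move=> t ht; rewrite covC s2.
have nB m j : P.-negligible (B m j).
  have [h2|h2] := boolP ((T0 - - T0) / 2 ^+ m <= 2^-1); last first.
    by apply: negligibleS (negligible_set0 _) => w [] h; rewrite h in h2.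
  have [s1 s2] := step m j h2.
  have cN w : continuous (fun t => - X t w) by move=> t; apply: cvgN; exact: contX.
  have HN t : H (fun w => - X t w).
    by have := gspaceZ gH (-1) (HX t); congr H; apply/funext => w; rewrite mulN1r.
  have N1 t : \int[P]_w (- X t w) ^+ 2 = 1.
    by rewrite -(X1 t); apply: eq_Rintegral => w _; rewrite sqrrN.
  apply: negligibleS (tangent_negligible gH s1 cN HN N1 _); first by move=> w [].
  by move=> t ht; under eq_Rintegral do rewrite mulrNN; rewrite covC s2.
have : P.-negligible (\bigcup_m \bigcup_j (Z m j `|` A m j `|` B m j)).
  by do 2 apply: negligible_bigcup => ?; do 2?[apply: negligibleU => //].
apply: negligibleS => w nt; apply: contrapT => nU; apply: nt; split.
- exact: contX.
- by move=> m j; apply/eqP => Xz; apply: nU; exists m => //; exists j => //; left; left.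
move=> m j h2; split => tg; apply: nU; exists m => //; exists j => //.
  by left; right; split.
by right; split.
Qed.

Definition crossings m w : R := (sign_changes (fun t => X t w) (- T0) T0 m)%:R.

Lemma crossingsE m w : crossings m w =
  \sum_(j < 2 ^ m) (X (grid m j) w * X (grid m j.+1) w < 0)%R%:R.
Proof. by rewrite /crossings natr_sum. Qed.

Lemma measurable_crossings m : measurable_fun setT (crossings m).
Proof.
rewrite (_ : crossings m = fun w => \sum_(j < 2 ^ m) (X (grid m j) w * X (grid m j.+1) w < 0)%R%:R).
  by apply: measurable_sum => j; apply: measurable_lt_indic; exact: measurable_funM.
by apply/funext => w; exact: crossingsE.
Qed.

Lemma integrable_crossings m : P.-integrable setT (EFin \o crossings m).
Proof.
apply: (@integrable_bounded _ _ _ _ _ (2 ^+ m)); first exact: measurable_crossings.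
move=> w; rewrite ger0_norm /crossings ?ler0n// -natrX ler_nat.
by rewrite sign_changesE size_filter (leq_trans (count_size _ _))// size_iota.
Qed.

Let step m : R := (T0 - - T0) / 2 ^+ m.

Let step0 m : 0 < step m. Proof. by rewrite divr_gt0 ?exprn_gt0// subr_gt0. Qed.

Let step_near e : 0 < e -> \forall m \near \oo, step m <= e.
Proof.
move=> e0; have /cvgrPdist_lt/(_ _ e0) := @cvg_dyadic_step R (- T0) T0.
by apply: filterS => m; rewrite sub0r normrN -/(step m) gtr0_norm// => /ltW.
Qed.

Let cov_step m j : \int[P]_w (X (grid m j) w * X (grid m j.+1) w) = C (step m).
Proof. by rewrite covC dyadicS opprD addrA subrr add0r cos_productN. Qed.

Let cov_bounds m : step m <= 2^-1 ->
  [/\ `|C (step m)| < 1, 0 <= C (step m) & 1 - C (step m) <= step m ^+ 2].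
Proof.
move=> h2; have h1 : step m <= 1 by rewrite (le_trans h2)// invf_le1// ler1n.
have Ch : 2^-1 <= C (step m) by apply: C_half; rewrite gtr0_norm.
have C0 : 0 <= C (step m) by rewrite (le_trans _ Ch).
split => //; first by rewrite ger0_norm// cos_product_lt1// step0.
by rewrite lerBlDr -lerBlDl cos_product_ge// gtr0_norm.
Qed.

(** Each cell changes sign with probability at most [sqrt (1 - C h) <= h], so the mean is bounded by
    the total length, uniformly in the mesh. *)
Lemma crossings_mean_le m : step m <= 2^-1 -> \int[P]_w crossings m w <= 2 * T0.
Proof.
move=> h2; have [C1 C0 Ch] := cov_bounds h2.
under eq_Rintegral do rewrite crossingsE.
rewrite Rintegral_sum; last first.
  move=> j; apply: (@integrable_bounded _ _ _ _ _ 1).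
    by apply: measurable_lt_indic; exact: measurable_funM.
  by move=> w; exact: natr_bool_le1.
have -> : 2 * T0 = \sum_(j < 2 ^ m) step m.
  rewrite sumr_const card_ord -[RHS]mulr_natr natrX /step; field.
  by rewrite expf_neq0.
apply: ler_sum => j _.
have r1 : `|\int[P]_w (X (grid m j) w * X (grid m j.+1) w)| < 1 by rewrite cov_step.
apply: (le_trans (sign_change_prob_le gH (HX _) (HX _) (X1 _) (X1 _) r1)).
have s0 := ltW (step0 m).
rewrite cov_step -[leRHS](ger0_norm s0) -sqrtr_sqr ler_sqrt ?sqr_ge0// (le_trans _ Ch)//.
have C1' : 0 <= 1 - C (step m) by rewrite subr_ge0 (le_trans (ler_norm _))// ltW.
by rewrite ler_piMr// invf_le1 ?lerDl// ltr_wpDr.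
Qed.

(** With infinitely many zeros the sign changes would exceed every [K] on all fine grids. Markov's
    inequality and the uniform bound on the mean make this a null event. *)
Lemma crossings_limit : exists E : set T, [/\ measurable E, P E = 0%E &
  forall w, ~ E w -> let f := fine (num_zeros (fun t => X t w) T0) in
    (forall m, crossings m w <= f) /\ (\forall m \near \oo, crossings m w = f)].
Proof.
have [E0 [mE0 PE0 tE0]] := transverse_ae.
have i2 : 0 < 2^-1 :> R by rewrite invr_gt0.
have [M _ hM] := step_near i2.
(* Levels are shifted by [M], from which on the mesh is at most [1/2] and [crossings_mean_le]
   applies. *)
pose L K := \bigcup_m \bigcap_(n in [set n | (m <= n)%N]) [set w | (K.+1%:R <= crossings (n + M) w)%R].
have mC K n : measurable [set w | (K.+1%:R <= crossings n w)%R].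
  by apply: measurable_bool_set; apply: measurable_fun_ler => //; exact: measurable_crossings.
have PC K n : (P [set w | (K.+1%:R <= crossings (n + M) w)%R] <= (2 * T0 / K.+1%:R)%:E)%E.
  have K0 : 0 < K.+1%:R :> R by rewrite ltr0n.
  have hn := crossings_mean_le (hM (n + M)%N (leq_addl _ _)).
  set D := [set w | _] in mC *; have mD : measurable D by exact: mC.
  have iD : P.-integrable setT (EFin \o (\1_D : T -> R)).
    by apply: (@integrable_bounded _ _ _ _ _ 1) => // w; rewrite indicE natr_bool_le1.
  have : 0 <= \int[P]_w (crossings (n + M) w + (- K.+1%:R) * \1_D w).
    apply: Rintegral_ge0 => w _; rewrite indicE mulNr subr_ge0.
    by case: (boolP (w \in D)) => [|_]; rewrite ?mulr0 ?ler0n// inE mulr1.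
  rewrite RintegralD//; [|exact: integrable_crossings|exact: integrable_EFinZ].
  rewrite RintegralZl// Rintegral_indic_fine// mulNr subr_ge0 => h.
  rewrite -[P D]fineK ?fin_num_measure// lee_fin ler_pdivlMr// mulrC.
  exact: le_trans hn.
have mL K : measurable (L K).
  by apply: bigcup_measurable => m _; apply: bigcap_measurable => //; exists m => /=.
have mE : measurable (\bigcap_K L K) by apply: bigcap_measurable => //; exists 0%N.
exists (E0 `|` \bigcap_K L K); split; first exact: measurableU.
- apply: null_of_le => [|del del0]; first exact: measurableU.
  rewrite (le_trans (measureU2 _ _ _))// [X in (X + _)%E]PE0 add0e.
  pose K := Num.Def.truncn (2 * T0 / del).
  rewrite (le_trans _ (_ : P (L K) <= _)%E)//.
    by apply: le_measure; rewrite ?inE//; exact: bigcap_inf.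
  rewrite (le_trans (liminf_measure_le _ (PC K)))//.
  rewrite lee_fin ler_pdivrMr ?ltr0n// [del * _]mulrC -ler_pdivrMr// ltW//.
  exact: truncnS_gt.
move=> w /not_orP[wE0 wL] f.
have tw : transverse (fun t => X t w) (- T0) T0 by apply: contrapT => h; apply: wE0; exact: tE0.
have [[k [fk Nk Nk']]|inf] := sign_changes_num_zeros T00 tw.
  by rewrite /f fk /crossings /=; split=> [m|]; [rewrite ler_nat|apply: filterS Nk' => m ->].
exfalso; apply: wL => K _; have [m _ hm] := inf K.+1.
exists m => // n /= mn; rewrite /crossings ler_nat.
by apply: hm => /=; rewrite (leq_trans mn)// leq_addr.
Qed.

(** An infinite integral leaves nothing to prove. Otherwise the limit is square integrable and
    dominates the sign changes, so their second moments about [c] converge. *)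
Lemma zeros_variance_ge (c V0 : R) :
  (\forall m \near \oo, V0 <= \int[P]_w (crossings m w - c) ^+ 2) ->
  (V0%:E <= \int[P]_w ((fine (num_zeros (fun t => X t w) T0) - c) ^+ 2)%:E)%E.
Proof.
move=> hV; have [E [mE PE0 hE]] := crossings_limit.
pose f w := fine (num_zeros (fun t => X t w) T0).
(* Cutting off the null set makes the limit [g] measurable, and [f] agrees with [g] off [E]. *)
pose out w : R := \1_(~` E) w.
have mout : measurable_fun setT out by apply: measurable_indic; exact: measurableC.
have outE w : E w -> out w = 0 by move=> Ew; rewrite /out indicE memNset//=; apply.
have outNE w : ~ E w -> out w = 1 by move=> Ew; rewrite /out indicE mem_set.
pose Nn m w := crossings m w * out w; pose g w := f w * out w.
have cN w : Nn m w @[m --> \oo] --> g w.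
  have [Ew|nEw] := pselect (E w).
    by rewrite /Nn /g outE// mulr0; under eq_fun do rewrite mulr0; exact: cvg_cst.
  have [_ h] := hE w nEw; apply: cvg_near_cst; apply: filterS h => m h.
  by rewrite /Nn /g h.
have Ng m w : 0 <= Nn m w <= g w.
  have [Ew|nEw] := pselect (E w); first by rewrite /Nn /g outE// !mulr0 lexx.
  have [h _] := hE w nEw.
  by rewrite /Nn /g outNE// !mulr1 h andbT /crossings ler0n.
have mNn m : measurable_fun setT (Nn m) by apply: measurable_funM => //; exact: measurable_crossings.
have mg : measurable_fun setT g by apply: (measurable_fun_cvg mNn) => w _; exact: cN.
have mgc : measurable_fun setT (fun w => (g w - c) ^+ 2).
  by apply: measurable_funX; exact: measurable_funB.
have aeE (F G : T -> R) : (forall w, ~ E w -> F w = G w) -> {ae P, forall w, setT w -> (F w)%:E = (G w)%:E}.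
  move=> FG; exists E; split => // w /= nFG; apply: contrapT => nE; apply: nFG => _.
  by rewrite FG.
have minor : (\int[P]_w ((g w - c) ^+ 2)%:E <= \int[P]_w ((f w - c) ^+ 2)%:E)%E.
  rewrite (ae_eq_integral (fun w => ((g w - c) ^+ 2 * out w)%:E))//; last 3 first.
  - exact/measurable_EFinP.
  - by apply/measurable_EFinP; exact: measurable_funM.
  - by apply: aeE => w nE; rewrite outNE// mulr1.
  apply: ge0_le_integral_nonmeasurable => w; rewrite lee_fin.
    by rewrite mulr_ge0 ?sqr_ge0// /out indicE.
  have [Ew|nEw] := pselect (E w); first by rewrite outE// mulr0 sqr_ge0.
  by rewrite /g outNE// !mulr1.
apply: le_trans minor.
have [fin|] := boolP (\int[P]_w ((g w - c) ^+ 2)%:E < +oo)%E; last first.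
  by rewrite -leNgt leye_eq => /eqP ->; exact: leey.
have ig : P.-integrable setT (EFin \o (fun w => (g w - c) ^+ 2)).
  apply/integrableP; split; first exact/measurable_EFinP.
  rewrite (eq_integral (fun w => ((g w - c) ^+ 2)%:E))// => w _ /=.
  by rewrite ger0_norm ?sqr_ge0.
rewrite -[leRHS]fineK; last exact: integrable_fin_num ig.
rewrite lee_fin.
have lim : \int[P]_w (Nn m w - c) ^+ 2 @[m --> \oo] --> \int[P]_w (g w - c) ^+ 2.
  (* As [0 <= Nn m w <= g w], the square [(Nn m w - c)^2] is at most [2 g^2 + 2 c^2], and
     [g^2 <= 2 (g - c)^2 + 2 c^2]. *)
  apply: (@Rintegral_dominated_cvg _ _ _ _ _ _ (fun w => 4 * (g w - c) ^+ 2 + 6 * c ^+ 2)).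
  - by move=> m; apply: measurable_funX; exact: measurable_funB.
  - move=> w; rewrite expr2; under eq_fun do rewrite expr2.
    by apply: cvgM; apply: cvgB => //; exact: cvg_cst.
  - apply: integrable_EFinD; first exact: integrable_EFinZ.
    exact: finite_measure_integrable_cst.
  move=> m w; have /andP[n0 ng] := Ng m w.
  rewrite ger0_norm ?sqr_ge0//.
  have : Nn m w ^+ 2 <= g w ^+ 2 by rewrite lerXn2r ?nnegrE// (le_trans n0).
  move: (Nn m w) (g w) => x y h; rewrite -subr_ge0.
  have h1 := sqr_ge0 (x + c); have h2 := sqr_ge0 (y - 2 * c).
  rewrite (_ : _ - _ = (x + c) ^+ 2 + 2 * (y - 2 * c) ^+ 2 + 2 * (y ^+ 2 - x ^+ 2)); last by ring.
  by rewrite !addr_ge0// mulr_ge0// subr_ge0.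
apply: (cvgr_to_ge lim); apply: filterS hV => m /le_trans; apply.
rewrite le_eqVlt; apply/orP; left; apply/eqP; congr fine.
apply: ae_eq_integral => //.
- apply/measurable_EFinP; apply: measurable_funX; apply: measurable_funB => //; exact: measurable_crossings.
- by apply/measurable_EFinP; apply: measurable_funX; exact: measurable_funB.
- by apply: aeE => w nE; rewrite /Nn outNE// mulr1.
Qed.

(** At level [m + 1] the grid has [2 M] cells with [M = 2^m] and [M h = T0]. The differences kept by
    [double_sum_ge] are then the multiples of [h] below [T0], which reach past all good points below
    [n!]. *)
Lemma crossings_variance_ge (n : nat) (c : R) : (3 <= n)%N -> n`!%:R <= T0 ->
  \forall m \near \oo, (n`!%:R * 256^-1 ^+ n * gap_constant R) ^+ 2 <=
    \int[P]_w (crossings m w - c) ^+ 2.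
Proof.
move=> n3 nT; have i8 : 0 < 8^-1 :> R by rewrite invr_gt0.
have [m0 _ hm0] := step_near i8; exists m0.+1 => // -[//|m] /= m0m.
have h8 : step m.+1 <= 8^-1 by apply: hm0 => /=; exact: ltnW.
set h := step m.+1 in h8.
have h0 : 0 < h := step0 m.+1.
have h2 : h <= 2^-1 by rewrite (le_trans h8)// lef_pV2 ?posrE// ler_nat.
have [r1 r0 rh] := cov_bounds h2.
set V := \int[P]_w _.
have V0 : 0 <= V by apply: Rintegral_ge0 => w _; exact: sqr_ge0.
have hM : (2 ^ m)%:R * h = T0.
  by rewrite natrX /h /step exprS; field; rewrite expf_neq0.
have covx i j : \int[P]_w (X (grid m.+1 i) w * X (grid m.+1 j) w) = C (i%:R * h - j%:R * h).
  by rewrite covC; congr C; rewrite /dyadic /h /step; ring.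
have M0 : (0 < 2 ^ m.+1)%N by rewrite expn_gt0.
have := sign_change_variance_ge gH (fun i => HX (grid m.+1 i)) covx (cos_product0 (R := R))
  (@cos_product_norm R) (@cos_productN R) r1 M0 c.
rewrite -/h; set S := \sum_(j < _) _.
have -> : \int[P]_w (\sum_(j < 2 ^ m.+1) (X (grid m.+1 j) w * X (grid m.+1 j.+1) w < 0)%R%:R - c) ^+ 2 = V.
  by apply: eq_Rintegral => w _; rewrite crossingsE.
have -> : (2 ^ m.+1)%:R = 2 * (2 ^ m)%:R :> R by rewrite expnS natrM.
move=> SV.
pose F t := (C (t + h) + C (t - h) - 2 * C h * C t) ^+ 2.
have SF : (2 ^ m)%:R * (\sum_(e < 2 ^ m) F (e%:R * h)) <= S.
  rewrite /S expnS mul2n -addnn; apply: double_sum_ge => t; exact: sqr_ge0.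
have h08 : 0 < h <= 8^-1 by rewrite h0.
have lat := @lattice_sum_ge R n h (2 ^ m) n3 h08; rewrite hM in lat; have {}lat := lat nT.
have m20 : 0 < (2 ^ m)%:R :> R by rewrite ltr0n expn_gt0.
have aS := le_trans (ler_wpM2l (ltW m20) lat) SF.
have r01 : 0 <= C h < 1 by rewrite r0 (le_lt_trans (ler_norm _)).
have p4 : 0 <= (pi : R) <= 4.
  by rewrite pi_ge0/= ltW//; have := @pihalf_lt2 R; rewrite ltr_pdivrMr//; lra.
have q0 : 0 <= 4^-1 ^+ n :> R by rewrite exprn_ge0.
have := variance_arithmetic m20 h0 (ler0n _ _) q0 (_ : 0 <= 96^-1 :> R) r01 rh V0 p4 aS SV.
rewrite invr_ge0 ler0n => /(_ isT); apply: le_trans.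
rewrite -/(gap_constant R); have k0 := ltW (gap_constant_gt0 R).
move: (gap_constant R) k0 => k k0.
rewrite lerXn2r ?nnegrE ?mulr_ge0 ?exprn_ge0// ler_wpM2r//.
have b0 : 0 < 16^-1 ^+ n :> R by rewrite exprn_gt0.
(* [256 = 16 * 16]: one factor is the squared [4^-n] of the gap, the other the proportion of good
   integers. *)
have -> : 256^-1 ^+ n = 16^-1 ^+ n * 16^-1 ^+ n :> R by rewrite -exprMn; congr (_ ^+ n); field.
have -> : (4^-1 ^+ n) ^+ 2 = 16^-1 ^+ n :> R by rewrite exprAC; congr (_ ^+ n); field.
rewrite mulrA ler_pM2r// exprVn ler_pdivrMr ?exprn_gt0// mulrC -natrX -natrM ler_nat.
exact: size_good_naturals.
Qed.

End counting_zeros.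

(** * Growth of the factorial and conclusion *)

Lemma expn_le_fact q j : (q ^ j <= (q + j)`!)%N.
Proof.
elim: j => [|j ih]; first by rewrite expn0 fact_gt0.
by rewrite addnS factS expnS leq_mul// ltnW// ltnS leq_addr.
Qed.

(** Choose [q] with [q^eps >= 2 B]. From [n! >= q^(n - q)] follows [n!^eps >= (2 B)^(n - q)], and
    the surplus [2^(n - q)] eventually exceeds [A B^q]. *)
Lemma fact_powR_ge (R : realType) (eps A B : R) : 0 < eps -> 1 <= B ->
  exists n0, forall n, (n0 <= n)%N -> A * B ^+ n <= n`!%:R `^ eps.
Proof.
move=> e0 B1; have B0 : 0 < B := lt_le_trans ltr01 B1.
pose q := (Num.Def.truncn ((2 * B) `^ eps^-1)).+1.
have qB : 2 * B <= q%:R `^ eps.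
  have -> : 2 * B = ((2 * B) `^ eps^-1) `^ eps.
    by rewrite -powRrM mulVf ?gt_eqF// powRr1// mulr_ge0// ltW.
  by apply: ge0_ler_powR; rewrite ?nnegrE ?powR_ge0// ltW// truncnS_gt.
pose k := (Num.Def.truncn (A * B ^+ q)).+1.
exists (q + k)%N => n nqk.
have [j -> kj] : exists2 j, n = (q + j)%N & (k <= j)%N.
  by exists (n - q)%N; move: nqk; clear; lia.
apply: (@le_trans _ _ ((q ^ j)%:R `^ eps)); last first.
  by apply: ge0_ler_powR; rewrite ?nnegrE ?(ltW e0)// ler_nat expn_le_fact.
rewrite natrX -[q%:R ^+ j]powR_mulrn// powRAC powR_mulrn ?powR_ge0//.
apply: (@le_trans _ _ ((2 * B) ^+ j)); last by rewrite lerXn2r ?nnegrE ?powR_ge0// mulr_ge0// ltW.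
rewrite exprD mulrA exprMn ler_wpM2r ?exprn_ge0// ?(ltW B0)//.
rewrite (le_trans (ltW (truncnS_gt _)))// -/k -natrX ler_nat (leq_trans kj)//.
by rewrite ltnW// ltn_expl.
Qed.

Lemma fact_floor (R : realType) (T : R) (n0 : nat) : n0`!%:R <= T ->
  exists n, [/\ (n0 <= n)%N, n`!%:R <= T & T < n.+1`!%:R].
Proof.
move=> n0T; pose Q n := n`!%:R <= T.
have Qb n : Q n -> (n <= (Num.Def.truncn T).+1)%N.
  move=> Qn; rewrite -(ler_nat R) (le_trans _ (ltW (truncnS_gt _)))// (le_trans _ Qn)// ler_nat.
  by case: n {Qn} => // n; rewrite factS leq_pmulr// fact_gt0.
have Q0 : exists n, Q n by exists n0.
have [n Qn nmax] := ex_maxnP Q0 Qb.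
exists n; split => //; first exact: nmax.
by rewrite ltNge; apply/negP => /nmax; rewrite ltnn.
Qed.

Lemma variance_integral d (T : measurableType d) (R : realType) (P : probability T R) (f : T -> R) :
  ('V_P[f] = \int[P]_w ((f w - fine 'E_P[f]) ^+ 2)%:E)%E.
Proof.
rewrite /variance unlock; move: (fine 'E_P[f]%E) => e; rewrite unlock.
by apply: eq_integral => w _; rewrite expr2.
Qed.

Theorem proposition11 (R : realType) (d : measure_display)
    (Omega : measurableType d) (P : probability Omega R)
    (X : R -> {RV P >-> R})
    (gaussX : gaussian_process P X)
    (centeredX : centered_process P X)
    (covX : has_reduced_covariance P X (@cos_fact_product R))
    (contX : forall w : Omega, continuous (fun t : R => X t w))
    (eps : R) (eps_gt0 : 0 < eps) :
  ((T `^ (eps - 2))%:E *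
     'V_P[fun w : Omega => fine (num_zeros (fun t : R => X t w) T)])%E
    @[T --> +oo] --> +oo%E.
Proof.
apply/cvgeyPge => A.
pose k := gap_constant R; have k0 : 0 < k := gap_constant_gt0 R.
pose b : R := 256; have b1 : 1 <= b by rewrite ler1n.
have b0 : 0 < b := lt_le_trans ltr01 b1.
have B1 : 1 <= (2 * b) ^+ 2 by apply: exprn_ege1; lra.
(* The rate to be beaten: [L] loses [b^(2 n)], and replacing [T] by [2^n n!] in [T^2] loses
   [2^(2 n)]. *)
have [n0 hn0] := fact_powR_ge (A / k ^+ 2) eps_gt0 B1.
pose c : R := (maxn 3 n0)`!%:R.
have near_fact : \forall T \near +oo, c <= T.
  by apply: nbhs_pinfty_ge; exact: num_real.
apply: filterS near_fact => T /fact_floor[n [n0n nT Tn]].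
have n3 : (3 <= n)%N by rewrite (leq_trans _ n0n)// leq_maxl.
have {}n0n : (n0 <= n)%N by rewrite (leq_trans _ n0n)// leq_maxr.
have f1 : 1 <= n`!%:R :> R by rewrite ler1n fact_gt0.
have f0 : 0 < n`!%:R :> R := lt_le_trans ltr01 f1.
have T0 : 0 < T := lt_le_trans f0 nT.
pose f w := fine (num_zeros (fun t => X t w) T).
pose L := (n`!%:R * b^-1 ^+ n * k) ^+ 2.
(* The lower bound holds for every centring constant, so it applies to [fine 'E_P[f]] whatever its
   value. *)
have VL : (L%:E <= 'V_P[f])%E.
  have := zeros_variance_ge gaussX centeredX covX contX T0
    (crossings_variance_ge gaussX centeredX covX T0 (fine 'E_P[f]%E) n3 nT).
  by rewrite -variance_integral.
apply: (@le_trans _ _ ((T `^ (eps - 2))%:E * L%:E)%E); last first.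
  by rewrite lee_wpmul2l// lee_fin powR_ge0.
rewrite -EFinM lee_fin.
have T2 : T `^ (eps - 2) = T `^ eps / T ^+ 2.
  rewrite powRB; first by rewrite powR_mulrn// ltW.
  by rewrite (gt_eqF T0) implybT.
rewrite T2.
have Teps : n`!%:R `^ eps <= T `^ eps.
  by apply: ge0_ler_powR; rewrite ?nnegrE ?(ltW eps_gt0) ?(ltW f0) ?(ltW T0).
(* Between consecutive factorials [T] exceeds [n!] by a factor below [n + 1 <= 2^n], a negligible
   loss. *)
have Tsq : T <= 2 ^+ n * n`!%:R.
  rewrite (le_trans (ltW Tn))// factS natrM ler_pM2r// -natrX ler_nat.
  by rewrite ltn_expl.
set Ne := n`!%:R `^ eps in Teps *; have Ne0 : 0 <= Ne by rewrite powR_ge0.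
have k2 : 0 < k ^+ 2 by rewrite exprn_gt0.
have D0 : 0 < (2 * b) ^+ 2 ^+ n by rewrite !exprn_gt0// mulr_gt0.
have h1 : A <= Ne * k ^+ 2 / (2 * b) ^+ 2 ^+ n.
  rewrite ler_pdivlMr// -ler_pdivrMr// mulrAC; exact: hn0.
apply: (le_trans h1).
have -> : Ne * k ^+ 2 / (2 * b) ^+ 2 ^+ n = Ne / (2 ^+ n * n`!%:R) ^+ 2 * L.
  rewrite /L -exprM mulnC exprM [(2 * b) ^+ n]exprMn exprVn.
  move: (b ^+ n) (n`!%:R) f0 (exprn_gt0 n b0) => bn N N0 bn0.
  have tn0 : 0 < 2 ^+ n :> R by rewrite exprn_gt0.
  by move: (2 ^+ n) tn0 => tn tn0; field; rewrite !gt_eqF.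
rewrite ler_wpM2r ?sqr_ge0// ler_pM// ?invr_ge0 ?sqr_ge0//.
have tN0 : 0 < 2 ^+ n * n`!%:R := lt_le_trans T0 Tsq.
by rewrite lef_pV2 ?posrE ?exprn_gt0// lerXn2r ?nnegrE// ltW.
Qed.
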